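(* Let $\beta\ge5$ and $\epsilon_1,\epsilon_2\in\{1,-1\}$. Let $\Gamma_4$ be the quotient of $[8,2^\beta,2^{\beta-1}]^+$ by the relations $\sigma_2\sigma_1^2=\sigma_1^2\sigma_2^{1+\epsilon_12^{\beta-2}}$, $\sigma_3^{-1}\sigma_2=\sigma_2^{3+\epsilon_22^{\beta-2}}\sigma_3^{1+2^{\beta-2}}$, $\sigma_3\sigma_2^{-1}=\sigma_2^{-3+\epsilon_22^{\beta-2}}\sigma_3^{-1+2^{\beta-2}}$. Then $\Gamma_4$ is the automorphism group, with standard generators $\sigma_1,\sigma_2,\sigma_3$, of an atomic chiral $4$-polytope of type $\{8,2^\beta,2^{\beta-1}\}$.
   Context: $[p,q,r]^+=\langle\sigma_1,\sigma_2,\sigma_3\mid\sigma_1^p=\sigma_2^q=\sigma_3^r=(\sigma_1\sigma_2)^2=(\sigma_2\sigma_3)^2=(\sigma_1\sigma_2\sigma_3)^2=1\rangle$. Standard generators of a chiral polytope with base flag $\Phi$: $\Phi\sigma_i=\Phi^{i(i-1)}$, $\Phi^j$ the flag differing from $\Phi$ only in its $j$-face. Tight: type $\{p,q,r\}$ with exactly $2pqr$ flags. A tight chiral $4$-polytope is atomic if it does not properly cover any tight chiral polytope. *)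

(* Defs.v *)
From HB Require Import structures.
From mathcomp Require Import all_boot all_fingroup all_algebra.
Set Implicit Arguments. Unset Strict Implicit. Unset Printing Implicit Defensive.

Record grp := Grp {
  gT :> Type;
  gmul : gT -> gT -> gT;
  ginv : gT -> gT;
  gone : gT;
  gmulA : associative gmul;
  gmul1 : left_id gone gmul;
  gmulV : left_inverse gone ginv gmul }.

Fixpoint gpow (G : grp) (x : gT G) (n : nat) : gT G :=
  match n with 0 => @gone G | n'.+1 => @gmul G x (gpow x n') end.

Definition gzpow (G : grp) (x : gT G) (z : int) : gT G :=
  match z with Posz n => gpow x n | Negz n => @ginv G (gpow x n.+1) end.

Definition permGrp (F : finType) : grp :=
  @Grp {perm F} (fun x y => (x * y)%g) (fun x => (x^-1)%g) 1%g
       (@mulgA _) (@mul1g _) (@mulVg _).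

Definition is_sign (e : int) : bool := ((e == 1) || (e == -1))%R.

(* Defining relations of Gamma_4 : those of [8, 2^beta, 2^(beta-1)]^+ plus
   the three extra relations of the theorem. *)
Definition rels4 (G : grp) (beta : nat) (e1 e2 : int) (a b c : gT G) : Prop :=
  let m := @gmul G in
  let zp := @gzpow G in
  let t := (2%:Z ^+ (beta - 2)%N)%R in
  [/\ gpow a 8 = @gone G, gpow b (2 ^ beta) = @gone G & gpow c (2 ^ beta.-1) = @gone G] /\
  [/\ gpow (m a b) 2 = @gone G, gpow (m b c) 2 = @gone G & gpow (m (m a b) c) 2 = @gone G] /\
  [/\
      m b (gpow a 2) = m (gpow a 2) (zp b (1 + e1 * t)%R),
      m (@ginv G c) b = m (zp b (3 + e2 * t)%R) (zp c (1 + t)%R)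
    & m c (@ginv G b) = m (zp b (- 3 + e2 * t)%R) (zp c (- 1 + t)%R) ].

Definition presents4 (F : finType) (A : {set {perm F}}) (beta : nat) (e1 e2 : int)
    (s1 s2 s3 : {perm F}) : Prop :=
  [/\ A = (<<[set s1; s2; s3]>>)%g,
      @rels4 (permGrp F) beta e1 e2 s1 s2 s3
    & forall (H : grp) (h1 h2 h3 : gT H), @rels4 H beta e1 e2 h1 h2 h3 ->
        exists f : {perm F} -> gT H,
          [/\ forall x y, x \in A -> y \in A -> f (x * y)%g = @gmul H (f x) (f y),
              f s1 = h1, f s2 = h2 & f s3 = h3] ].

(* A (finite) ranked poset.  Ranks are shifted by one with respect to the
   paper: the paper's rank -1 .. n is our 0 .. n+1. *)
Record pstruct (F : finType) := PStruct { rk : F -> nat; ple : rel F }.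

Section Poly.
Variables (F : finType) (P : pstruct F).
Local Notation r := (rk P).
Local Notation le := (ple P).

Definition plt (x y : F) : bool := le x y && (x != y).

Definition is_chain (A : {set F}) : bool :=
  [forall x in A, forall y in A, le x y || le y x].

Definition is_flag (A : {set F}) : bool :=
  is_chain A && [forall B : {set F}, (is_chain B && (A \subset B)) ==> (B == A)].

Definition adj_in (C : {set F}) : rel {set F} :=
  fun A B => [&& is_flag A, is_flag B, C \subset A, C \subset B & #|A :\: B| == 1].

(* A and B are j-adjacent flags (j = the paper's rank, 0 <= j <= n-1) *)
Definition adjflag (j : nat) (A B : {set F}) : bool :=
  [&& is_flag A, is_flag B, #|A :\: B| == 1 & [forall x in A :\: B, r x == j.+1]].

Definition is_polytope (n : nat) : Prop :=
  [/\ (forall x, le x x),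
      (forall x y, le x y -> le y x -> x = y) &
      (forall x y z, le x y -> le y z -> le x z)] /\
  [/\
      (exists m, r m = 0 /\ forall x, le m x),
      (exists M, r M = n.+1 /\ forall x, le x M) &
      (forall x y, plt x y -> r x < r y)] /\
  [/\
      (forall A, is_flag A -> #|A| = n.+2),
      (forall x y, le x y -> r y = (r x).+2 -> #|[set z | plt x z && plt z y]| = 2)
    &
      (forall A B, is_flag A -> is_flag B -> connect (adj_in (A :&: B)) A B) ].

Definition is_aut (g : {perm F}) : bool := [forall x, forall y, le (g x) (g y) == le x y].

Definition PAut : {set {perm F}} := [set g : {perm F} | is_aut g].

Definition same_orbit (A B : {set F}) : bool := [exists g in PAut, g @: A == B].

Definition chiral : Prop :=
  (exists A0 B0, [/\ is_flag A0, is_flag B0 &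
     forall C, is_flag C -> same_orbit A0 C \/ same_orbit B0 C]) /\
  (forall j A B, adjflag j A B -> ~~ same_orbit A B).

(* Schlaefli type {p1,p2,p3} of a rank-4 polytope: every section G/F with
   paper ranks rank F = j-2, rank G = j+1 is a p_j-gon (it has p_j faces of
   paper rank j). *)
Definition has_type4 (p1 p2 p3 : nat) : Prop :=
  forall j x y, 1 <= j <= 3 -> le x y -> r x = j.-1 -> r y = j + 2 ->
    #|[set z | [&& plt x z, plt z y & r z == j.+1]]| = nth 0 [:: p1; p2; p3] j.-1.

Definition flags : {set {set F}} := [set A | is_flag A].

Definition tight4 (p1 p2 p3 : nat) : Prop :=
  has_type4 p1 p2 p3 /\ #|flags| = 2 * p1 * p2 * p3.

Definition std_gens (Phi : {set F}) (s1 s2 s3 : {perm F}) : Prop :=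
  [/\ s1 \in PAut, s2 \in PAut & s3 \in PAut] /\
  [/\ exists Psi, adjflag 1 Phi Psi && adjflag 0 Psi (s1 @: Phi),
      exists Psi, adjflag 2 Phi Psi && adjflag 1 Psi (s2 @: Phi) &
      exists Psi, adjflag 3 Phi Psi && adjflag 2 Psi (s3 @: Phi)].

End Poly.

Definition covering (F1 F2 : finType) (P1 : pstruct F1) (P2 : pstruct F2)
    (g : F1 -> F2) : Prop :=
  [/\ forall x y, ple P1 x y -> ple P2 (g x) (g y),
      forall x, rk P2 (g x) = rk P1 x
    & forall j (A B : {set F1}), adjflag P1 j A B -> adjflag P2 j (g @: A) (g @: B)].

Definition properly_covers (F1 F2 : finType) (P1 : pstruct F1) (P2 : pstruct F2) : Prop :=
  exists g : F1 -> F2, covering P1 P2 g /\ ~ injective g.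

Definition tight_chiral4 (F : finType) (P : pstruct F) : Prop :=
  [/\ is_polytope P 4, chiral P & exists p1 p2 p3, tight4 P p1 p2 p3].

Definition atomic4 (F : finType) (P : pstruct F) : Prop :=
  tight_chiral4 P /\
  forall (F2 : finType) (Q : pstruct F2), tight_chiral4 Q -> ~ properly_covers P Q.

(* Main.v *)
(** Write a, b, c for the generators, t = 2^(beta-2).  In any group satisfying
    the relations every element is a^i b^j c^k, so the group has order at most
    8 * 4t * 2t; the resulting multiplication rules are polynomial in i, j, k
    and define permutations of Z/8 x Z/4t x Z/2t that attain this order.  The
    cosets of <b,c>, <ab,c>, <a,bc>, <a,b> then form a tight polytope: faces
    whose ranks differ by at least two are always incident, and the sections of
    rank two are polygons.

    A reflection would invert the action k = 1 +- t of a^2 on <b> by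
    conjugation, forcing b^(2t) = 1; hence the polytope is chiral.  A tight
    chiral polytope covered by it has a group in which the relations hold, and
    by the normal form its order is the product of the orders of a, b, c.  If
    one of these orders drops, then b^(2t) = 1, and then the relations, which
    together with the orders present the quotient, are invariant under the
    reflection; so the quotient is not chiral. *)

Require Import Defs.
From HB Require Import structures.
From mathcomp Require Import all_boot all_order all_fingroup all_algebra.
From mathcomp Require Import cyclic zify ring.
Set Implicit Arguments. Unset Strict Implicit. Unset Printing Implicit Defensive.
Import Order.TTheory GRing.Theory Num.Theory.

(** * Groups given by operations *)

(* The presentation speaks of arbitrary, possibly infinite groups, hence the bare record [grp]: the
   normal form is proved at that level, so that it holds in the finite groups of the construction
   and also in a product of one of them with any group H, where it yields the universal property.
   The obstacle is the order. The normal form bounds it only from above; attaining the bound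
   requires explicit permutations, whose bijectivity and relations are congruences modulo 8, 4t and
   2t between polynomials containing binomials C(x) = x (x - 1) / 2. These are settled by explicit
   quotients and cofactors that [ring] verifies. The condition beta >= 5 enters as 8 | t. It makes
   t^2 vanish modulo 4t, so that (1 + e1 t)^2 is 1 + 2t modulo 4t, and with t = 8 s it gives t C(x)
   = 4 s x (x - 1), with integer coefficients. The orders of the generators divide powers of two, so
   the first order to drop does so by killing a^4, b^(2t) or c^t; that each of these kills b^(2t)
   makes atomicity a single case. *)
Declare Scope grp_scope.
Delimit Scope grp_scope with grp.
Infix "*" := (@gmul _) : grp_scope.
Notation "x ^-1" := (@ginv _ x) : grp_scope.
Notation "1" := (@gone _) : grp_scope.
(* Sealed copy of [gzpow]: unsealed, rewriting by associativity would match
   numeral powers up to conversion and unfold them. *)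
HB.lock Definition zpow (G : grp) (x : G) (n : int) : G := gzpow x n.
Notation "x ^z n" := (@zpow _ x n%R) (at level 29, left associativity) : grp_scope.

Section GrpTheory.
Variable G : grp.
Implicit Types x y u v : G.
Local Open Scope grp_scope.

Lemma gKV x y : x^-1 * (x * y) = y.
Proof. by rewrite gmulA gmulV gmul1. Qed.

Lemma gmul_inj x : injective (@gmul G x).
Proof. by move=> y y' e; rewrite -(gKV x y) e gKV. Qed.

Lemma gmulVr x : x * x^-1 = 1.
Proof. by rewrite -[LHS]gmul1 -{1}(gmulV (x^-1)) -gmulA (gKV x) gmulV. Qed.

Lemma gmul1r x : x * 1 = x.
Proof. by rewrite -(gmulV x) gmulA gmulVr gmul1. Qed.

Lemma gVK x y : x * (x^-1 * y) = y.
Proof. by rewrite gmulA gmulVr gmul1. Qed.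

Lemma gmulK x y : y * x * x^-1 = y.
Proof. by rewrite -gmulA gmulVr gmul1r. Qed.

Lemma gmulKV x y : y * x^-1 * x = y.
Proof. by rewrite -gmulA gmulV gmul1r. Qed.

Lemma gmul_injr x : injective (fun y => @gmul G y x).
Proof. by move=> y y' /(congr1 (fun u => u * x^-1)); rewrite !gmulK. Qed.

Lemma ginvK x : x^-1^-1 = x.
Proof. by apply: (@gmul_inj (x^-1)); rewrite gmulVr gmulV. Qed.

Lemma ginvM x y : (x * y)^-1 = y^-1 * x^-1.
Proof. by apply: (@gmul_inj (x * y)); rewrite gmulVr gmulA gmulK gmulVr. Qed.

Lemma ginv1 : 1^-1 = 1 :> G.
Proof. by rewrite -[LHS]gmul1 gmulVr. Qed.

Lemma gpowSr x n : gpow x n.+1 = gpow x n * x.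
Proof. by elim: n => [|n IH]; [rewrite /= gmul1 gmul1r | rewrite -[LHS]/(x * gpow x n.+1) {1}IH gmulA]. Qed.

Lemma zpowE x n : gzpow x n = x ^z n. Proof. by rewrite unlock. Qed.

Lemma gzpow0 x : x ^z 0 = 1. Proof. by rewrite unlock. Qed.

Lemma gzpow1 x : x ^z 1 = x. Proof. by rewrite unlock; apply: gmul1r. Qed.

Lemma gzpowSz x (m : int) : x ^z (m + 1) = x * x ^z m.
Proof.
rewrite unlock; case: m => n; first by rewrite (_ : (Posz n + 1)%R = Posz n.+1) //; lia.
case: n => [|n].
  by rewrite (_ : (Negz 0 + 1)%R = Posz 0) //= gmul1r gmulVr.
rewrite (_ : (Negz n.+1 + 1)%R = Negz n); last lia.
by rewrite /gzpow (gpowSr x n.+1) ginvM gVK.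
Qed.

Lemma gzpowPz x (m : int) : x ^z (m - 1) = x^-1 * x ^z m.
Proof. by rewrite -{2}(subrK 1%R m) gzpowSz gKV. Qed.

Lemma gpow0 x : gpow x 0 = 1. Proof. by []. Qed.

Lemma gpowS x n : gpow x n.+1 = x * gpow x n. Proof. by []. Qed.

Lemma gpow2 x : gpow x 2 = x * x. Proof. by rewrite /= gmul1r. Qed.

Lemma gzpowD x (m n : int) : x ^z (m + n) = x ^z m * x ^z n.
Proof.
elim/int_rect: m => [|m IH|m IH]; first by rewrite add0r gzpow0 gmul1.
- by rewrite -addn1 PoszD addrAC !gzpowSz IH gmulA.
- rewrite -addn1 PoszD opprD addrAC [in RHS]addrC.
  by rewrite gzpowPz IH addrC gzpowPz gmulA.
Qed.

Lemma gzpowN x (m : int) : x ^z (- m) = (x ^z m)^-1.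
Proof. by apply: (@gmul_inj (x ^z m)); rewrite -gzpowD subrr gzpow0 gmulVr. Qed.

Lemma gzpowN1 x : x ^z (-1) = x^-1.
Proof. by rewrite gzpowN gzpow1. Qed.

Lemma gzpowSzr x (m : int) : x ^z (m + 1) = x ^z m * x.
Proof. by rewrite gzpowD gzpow1. Qed.

Lemma gzpow1n n : 1 ^z n = 1 :> G.
Proof.
have H m : gpow (1 : G) m = 1 by elim: m => //= m ->; rewrite gmul1.
by rewrite unlock; case: n => n; rewrite /gzpow H ?ginv1.
Qed.

Lemma gzpow_semiconj u x y (n : int) : u * x = y * u -> u * x ^z n = y ^z n * u.
Proof.
move=> e; elim/int_rect: n => [|m IH|m IH]; first by rewrite !gzpow0 gmul1 gmul1r.
- by rewrite -addn1 PoszD !gzpowSz gmulA e -!gmulA IH.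
- rewrite -addn1 PoszD opprD !gzpowPz -gmulA -IH.
  by rewrite !gmulA; congr (_ * _); apply: (@gmul_inj y); rewrite !gmulA gmulVr gmul1 -e gmulK.
Qed.

Lemma gzpowMl x y (n : int) : y * x = x * y -> (x * y) ^z n = x ^z n * y ^z n.
Proof.
move=> e; elim/int_rect: n => [|m IH|m IH]; first by rewrite !gzpow0 gmul1.
- rewrite -addn1 PoszD !gzpowSz IH -!gmulA; congr (_ * _).
  by rewrite !gmulA; congr (_ * _); apply: gzpow_semiconj.
- rewrite -addn1 PoszD opprD !gzpowPz IH ginvM -!gmulA.
  have cu : y^-1 * x^-1 = x^-1 * y^-1 by rewrite -!ginvM e.
  rewrite gmulA cu -gmulA; congr (_ * _); rewrite !gmulA; congr (_ * _).
  apply: gzpow_semiconj; apply: (@gmul_inj y); rewrite gVK gmulA e.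
  by rewrite gmulK.
Qed.

Lemma gzpow_gpow x n : x ^z (Posz n) = gpow x n. Proof. by rewrite unlock. Qed.

Lemma gzpowM x (m n : int) : x ^z (m * n) = (x ^z m) ^z n.
Proof.
elim/int_rect: n => [|n IH|n IH]; first by rewrite mulr0 !gzpow0.
- by rewrite -addn1 PoszD mulrDr mulr1 !gzpowD IH gzpow1.
- by rewrite -addn1 PoszD opprD mulrBr mulr1 !gzpowD IH gzpowN1 (gzpowN x m).
Qed.

Lemma gpow1n n : gpow (1 : G) n = 1.
Proof. by rewrite -gzpow_gpow gzpow1n. Qed.

Lemma gpowM x (m n : nat) : gpow x (m * n) = gpow (gpow x m) n.
Proof. by rewrite -!gzpow_gpow PoszM gzpowM. Qed.

Lemma gpowD x (m n : nat) : gpow x (m + n) = gpow x m * gpow x n.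
Proof. by rewrite -!gzpow_gpow PoszD gzpowD. Qed.

Lemma gzpow_mod x N (m n : int) : gpow x N = 1 -> (N %| (m - n)%R)%Z -> x ^z m = x ^z n.
Proof.
move=> e /dvdzP[k d]; rewrite -(subrK n m) d gzpowD mulrC gzpowM gzpow_gpow e.
by rewrite gzpow1n gmul1.
Qed.

(** Integer exponents suit computation, natural ones suit induction on right multiplication; finite
    order allows the passage from the first to the second. *)
Lemma gzpow_nat x N (m : int) : 0 < N -> gpow x N = 1 -> exists n, x ^z m = gpow x n.
Proof.
move=> N0 e; exists `|m %% N|%Z; rewrite -gzpow_gpow; apply: gzpow_mod e _.
rewrite gez0_abs ?modz_ge0 //; last by lia.
by rewrite -eqz_mod_dvd modz_mod.
Qed.

Lemma gmul_sq x y : gpow (x * y) 2 = 1 -> x * y = y^-1 * x^-1.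
Proof. by rewrite /= gmul1r => e; rewrite -ginvM; apply: (@gmul_inj (x * y)); rewrite e gmulVr. Qed.

End GrpTheory.

(** * Consequences of the relations *)

Lemma pow2_int beta : (2%:Z ^+ (beta - 2))%R = Posz (2 ^ (beta - 2)).
Proof. by rewrite -[RHS]natz natrX natz. Qed.

Lemma pow2_8s beta : 5 <= beta -> exists s, 2 ^ (beta - 2) = (8 * s)%N /\ 0 < s.
Proof.
move=> b5; exists (2 ^ (beta - 5)); split; last by rewrite expn_gt0.
by rewrite -[8]/(2 ^ 3) -expnD; congr (2 ^ _); lia.
Qed.

Lemma pow2_4t beta : 5 <= beta -> 2 ^ beta = (4 * 2 ^ (beta - 2))%N.
Proof. by move=> b5; rewrite -[4]/(2 ^ 2) -expnD; congr (2 ^ _); lia. Qed.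

Lemma pow2_2t beta : 5 <= beta -> 2 ^ beta.-1 = (2 * 2 ^ (beta - 2))%N.
Proof. by move=> b5; rewrite -expnS; congr (2 ^ _); lia. Qed.

Section Rels4.
Variables (G : grp) (beta : nat) (e1 e2 : int) (a b c : G).
Hypotheses (beta5 : 5 <= beta) (se1 : is_sign e1) (se2 : is_sign e2).
Hypothesis R4 : rels4 beta e1 e2 a b c.
Local Open Scope grp_scope.

Let t := 2 ^ (beta - 2).

Let rels4_t : (2%:Z ^+ (beta - 2))%R = Posz t := pow2_int beta.
Let rels4_t8 : exists s, t = (8 * s)%N /\ 0 < s := pow2_8s beta5.
Let rels4_4t : 2 ^ beta = (4 * t)%N := pow2_4t beta5.
Let rels4_2t : 2 ^ beta.-1 = (2 * t)%N := pow2_2t beta5.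

Let t2_gt0 : 0 < 2 * t. Proof. by rewrite muln_gt0 expn_gt0. Qed.
Let t4_gt0 : 0 < 4 * t. Proof. by rewrite muln_gt0 expn_gt0. Qed.

Lemma rels4_a8 : gpow a 8 = 1. Proof. by case: R4 => [[]]. Qed.
Lemma rels4_b4t : gpow b (4 * t) = 1. Proof. by rewrite -rels4_4t; case: R4 => [[]]. Qed.
Lemma rels4_c2t : gpow c (2 * t) = 1. Proof. by rewrite -rels4_2t; case: R4 => [[]]. Qed.
Lemma rels4_ab : a * b = b^-1 * a^-1.
Proof. by apply: gmul_sq; case: R4 => [_ [[]]]. Qed.
Lemma rels4_bc : b * c = c^-1 * b^-1.
Proof. by apply: gmul_sq; case: R4 => [_ [[]]]. Qed.
Lemma rels4_ba : b * a = a^-1 * b^-1.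
Proof. by apply: (@gmul_injr _ b); rewrite gmulKV -gmulA rels4_ab gVK. Qed.
Lemma rels4_cb : c * b = b^-1 * c^-1.
Proof. by apply: (@gmul_injr _ c); rewrite gmulKV -gmulA rels4_bc gVK. Qed.
Lemma rels4_abc : a * b * c = c^-1 * (b^-1 * a^-1).
Proof. by rewrite -ginvM; apply: gmul_sq; case: R4 => [_ [[]]]. Qed.
Lemma rels4_r1 : b * a ^z 2 = a ^z 2 * b ^z (1 + e1 * t).
Proof. by rewrite -rels4_t ?(gzpow_gpow _ 2) ?unlock; case: R4 => [_ [_ []]]. Qed.
Lemma rels4_r2 : c^-1 * b = b ^z (3 + e2 * t) * c ^z (1 + Posz t).
Proof. by rewrite -rels4_t ?(gzpow_gpow _ 2) ?unlock; case: R4 => [_ [_ []]]. Qed.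
Lemma rels4_r3 : c * b^-1 = b ^z (- 3 + e2 * t) * c ^z (- 1 + Posz t).
Proof. by rewrite -rels4_t ?(gzpow_gpow _ 2) ?unlock; case: R4 => [_ [_ []]]. Qed.

(** With b^-1 = c b c, the relation on c b^-1 evaluates c c b and the inverted relation on c^-1 b
    evaluates c b c c. Both words occur in c c b c c, and comparing the two evaluations leaves a
    factor c^t on each side. *)
Lemma rels4_ct_b :
  c ^z (Posz t) * b ^z (- 3 + e2 * t) = b ^z (- 3 - e2 * t) * c ^z (Posz t).
Proof.
have bV : b^-1 = c * b * c.
  by rewrite -gmulA rels4_bc gVK.
have e1' : c * (c * b) = b ^z (-3 + e2 * t) * c ^z (-2 + Posz t).
  apply: (@gmul_injr _ c); rewrite -(gmulA c (c * b) c) -bV rels4_r3 -gmulA.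
  by rewrite -gzpowSzr; congr (_ * c ^z _); ring.
have e2' : c * b * c * c = c ^z (- (1 + Posz t)) * b ^z (- (3 + e2 * t)).
  by rewrite -bV 2!gzpowN -ginvM -rels4_r2 ginvM ginvK.
have e3 : c ^z (Posz t) * (c * (c * b)) * c = b ^z (- 3 - e2 * t) * c^-1.
  apply: (@gmul_injr _ c); rewrite gmulKV.
  transitivity (c ^z (1 + Posz t) * (c * b * c * c)).
    by rewrite addrC gzpowD gzpow1 -!gmulA.
  by rewrite e2' gmulA -gzpowD subrr gzpow0 gmul1; congr (b ^z _); ring.
move: e3; rewrite e1' => e3.
apply: (@gmul_injr _ (c ^z (-2 + Posz t) * c)); rewrite -!gmulA in e3 *.
rewrite e3; congr (_ * _).
by rewrite -gzpowSzr -!gzpowD -gzpowN1; apply: (gzpow_mod rels4_c2t); apply/dvdzP; exists (-1)%R; lia.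
Qed.

(** The number -3 + e2 t is odd, hence has an inverse w modulo 4t. Raising [rels4_ct_b] to the power
    2w turns the left exponent into 2, and the right one too: they differ by 2 e2 t, and the factor
    2 makes this a multiple of 4t. *)
Lemma rels4_ct_b2 : c ^z (Posz t) * b ^z 2 = b ^z 2 * c ^z (Posz t).
Proof.
have [s [ts s0]] := rels4_t8.
have cop : coprimez (-3 + e2 * t) (Posz (2 ^ beta)).
  rewrite coprimezE absz_nat coprimeXr // coprimen2.
  by case/orP: se2 => /eqP ->; rewrite ts; lia.
have /coprimezP[[w v] /= wv] := cop; rewrite rels4_4t in wv.
have H := gzpow_semiconj (2 * w) rels4_ct_b; rewrite -!gzpowM in H.
rewrite (@gzpow_mod _ b (4 * t)%N ((-3 + e2 * t) * (2 * w))%R 2 rels4_b4t) in H; last first.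
  by apply/dvdzP; exists (-2 * v)%R; move: wv; rewrite PoszM; lia.
rewrite (@gzpow_mod _ b (4 * t)%N ((-3 - e2 * t) * (2 * w))%R 2 rels4_b4t) in H => //.
by apply/dvdzP; exists (-2 * v - e2 * w)%R; move: wv; rewrite PoszM; lia.
Qed.

Lemma rels4_c_b2 : c * b ^z 2 = b ^z (2 + e2 * t) * c ^z (1 + Posz t).
Proof.
apply: (@gmul_inj _ b).
rewrite !gmulA -gzpowSz (_ : 2 + e2 * t + 1 = 3 + e2 * t)%R; last by ring.
by rewrite -rels4_r2 rels4_bc -gmulA -gzpowPz gzpow1.
Qed.

(** Conjugation by c sends b^2 to b^(2 + e2 t) c^t. The first factor is a power of b^2, so the two
    factors commute and the m-th power splits. *)
Lemma rels4_c_b2m (m : int) :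
  c * b ^z (2 * m) = b ^z ((2 + e2 * t) * m) * c ^z (1 + Posz t * m).
Proof.
have step : c * b ^z 2 = (b ^z (2 + e2 * t) * c ^z (Posz t)) * c.
  by rewrite rels4_c_b2 (addrC 1%R) gzpowSzr gmulA.
have [s [ts s0]] := rels4_t8.
have comm : c ^z (Posz t) * b ^z (2 + e2 * t) = b ^z (2 + e2 * t) * c ^z (Posz t).
  rewrite (_ : 2 + e2 * t = 2 * (1 + e2 * (4 * s)))%R; last by rewrite ts PoszM; ring.
  by rewrite gzpowM; apply: gzpow_semiconj rels4_ct_b2.
rewrite gzpowM (gzpow_semiconj m step) (addrC 1%R) gzpowSzr gmulA; congr (_ * _).
by rewrite !gzpowM gzpowMl.
Qed.

(** * Normal forms in <b, c> and in <a, b, c> *)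

Definition nf2 (x : G) := exists j k : int, x = b ^z j * c ^z k.

(** As t = 8 s, the exponent (2 + e2 t) m is again even, so c can be moved across repeatedly. *)
Lemma nf2_c_b2 (n : nat) (m : int) :
  exists m' k : int, gpow c n * b ^z (2 * m) = b ^z (2 * m') * c ^z k.
Proof.
have [s [ts s0]] := rels4_t8.
elim: n => [|n [m' [k e]]]; first by exists m, 0%R; rewrite ?gpow0 ?mulr0 ?gzpow0 ?gmul1 ?gmul1r.
exists ((1 + e2 * (4 * s)) * m')%R, (1 + Posz t * m' + k)%R.
rewrite gpowS -gmulA e gmulA rels4_c_b2m -gmulA -gzpowD; congr (b ^z _ * _).
by rewrite ts PoszM; ring.
Qed.

Lemma nf2_cb (n : nat) : nf2 (gpow c n * b).
Proof.
elim: n => [|n [j [k e]]]; first by exists 1%R, 0%R; rewrite ?gpow0 ?mulr0 ?addr0 ?gzpow0 ?gmul1 ?gmul1r ?gzpow1.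
have [k' ek] := gzpow_nat k t2_gt0 rels4_c2t.
have [m [k'' e']] := nf2_c_b2 k' (-1).
exists (j + 2 * m)%R, (k'' - 1)%R.
(* The even power b^-2 is split off from c b = b^-1 c^-1: the induction hypothesis absorbs the
   remaining b, and [nf2_c_b2] moves the powers of c past b^-2. *)
have cb : c * b = b ^z 1 * b ^z (-2) * c^-1.
  by rewrite rels4_cb -gzpowD gzpowN1.
rewrite gpowSr -gmulA cb !gmulA gzpow1 e -(gmulA (b ^z j)) ek.
by rewrite e' -!gmulA -gzpowN1 -gzpowD gmulA -gzpowD.
Qed.

Lemma nf2_mulb x : nf2 x -> nf2 (x * b).
Proof.
move=> [j [k ->]].
have [k' ->] := gzpow_nat k t2_gt0 rels4_c2t.
have [j' [k'' e]] := nf2_cb k'.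
by exists (j + j')%R, k''; rewrite -gmulA e gmulA gzpowD.
Qed.

Lemma nf2_mulbV x : nf2 x -> nf2 (x * b^-1).
Proof.
move=> H; have [n e] := gzpow_nat (-1) t4_gt0 rels4_b4t.
rewrite gzpowN1 in e; rewrite e.
by elim: n {e} => [|n IH]; rewrite ?gpow0 ?gmul1r // gpowSr gmulA; apply: nf2_mulb.
Qed.

Lemma nf_ba (n : nat) : exists m n' : int, gpow b n * a = a ^z (1 + 2 * m) * b ^z n'.
Proof.
have ba2 (k : int) (m : nat) : exists k' : int, b ^z k * a ^z (2 * Posz m) = a ^z (2 * Posz m) * b ^z k'.
  elim: m k => [|m IH] k; first by exists k; rewrite ?gpow0 ?mulr0 ?gzpow0 ?gmul1 ?gmul1r.
  have [k' e] := IH ((1 + e1 * t) * k)%R; exists k'.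
  have step := gzpow_semiconj k (esym rels4_r1).
  rewrite (_ : 2 * Posz m.+1 = 2 + 2 * Posz m)%R ; last lia.
  rewrite (gzpowD a 2).
  by rewrite gmulA -step -gmulA -gzpowM e gmulA.
elim: n => [|n [m [n' e]]]; first by exists 0%R, 0%R; rewrite ?gpow0 ?mulr0 ?addr0 ?gzpow0 ?gmul1 ?gmul1r ?gzpow1.
have [k ek] := ba2 n' 3.
exists (m + 3)%R, (k - 1)%R.
(* Here a^-1 is written as a a^6 by a^8 = 1: the single a is absorbed by the induction hypothesis,
   and [ba2], which is proved for natural multiples of 2, handles a^6. *)
have ba : b * a = a * a ^z (2 * 3) * b^-1.
  rewrite rels4_ba -gzpowSz -gzpowN1; congr (_ * _).
  by apply: (gzpow_mod rels4_a8); apply/dvdzP; exists (-1)%R.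
rewrite gpowSr -gmulA ba !gmulA e -!gmulA (gmulA (b ^z n')) ek !gmulA -gzpowD -gmulA.
by rewrite -gzpowN1 -gzpowD; congr (a ^z _ * _); ring.
Qed.

Definition nf3 (x : G) := exists i j k : int, x = a ^z i * (b ^z j * c ^z k).

Lemma nf3_mulc x : nf3 x -> nf3 (x * c).
Proof.
move=> [i [j [k ->]]]; exists i, j, (k + 1)%R.
by rewrite gzpowSzr !gmulA.
Qed.

Lemma nf3_mulb x : nf3 x -> nf3 (x * b).
Proof.
move=> [i [j [k ->]]]; have [|j' [k' e]] := @nf2_mulb (b ^z j * c ^z k); first by exists j, k.
by exists i, j', k'; rewrite -gmulA e.
Qed.

(** Both a b and a b c square to 1, so conjugation by a b inverts c. This is how a power of c is
    carried past a. *)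
Lemma rels4_abcV : (a * b) * c^-1 = c * (a * b).
Proof.
apply: (@gmul_injr _ c); rewrite gmulKV rels4_ab -gmulA.
by rewrite -rels4_ab rels4_abc gVK rels4_ab.
Qed.

Lemma rels4_ca (k : int) : c ^z k * a = a * (b * c ^z (- k) * b^-1).
Proof.
apply: (@gmul_injr _ b); rewrite -!gmulA gmulV gmul1r gmulA.
by have := gzpow_semiconj k rels4_abcV; rewrite -gzpowN1 -gzpowM mulN1r !gmulA => <-.
Qed.

Lemma nf3_mula x : nf3 x -> nf3 (x * a).
Proof.
move=> [i [j [k ->]]].
have [n en] := gzpow_nat j t4_gt0 rels4_b4t.
have [m [n' e]] := nf_ba n.
have [|j' [k' e']] := @nf2_mulbV (b ^z (n' + 1) * c ^z (- k)); first by exists (n' + 1)%R, (- k)%R.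
exists (i + (1 + 2 * m))%R, j', k'.
rewrite -!gmulA rels4_ca en (gmulA (gpow b n)) e gzpowD -gmulA -e' gzpowD gzpow1.
by rewrite !gmulA.
Qed.

Lemma nf3_mul x y : nf3 x -> nf3 y -> nf3 (x * y).
Proof.
move=> Hx [i [j [k ->]]].
have [s [ts s0]] := rels4_t8.
have [i' ->] := gzpow_nat i (isT : 0 < 8) rels4_a8.
have [j' ->] := gzpow_nat j t4_gt0 rels4_b4t.
have [k' ->] := gzpow_nat k t2_gt0 rels4_c2t.
have H (y' : G) : (forall x, nf3 x -> nf3 (x * y')) -> forall n x, nf3 x -> nf3 (x * gpow y' n).
  by move=> Hy n; elim: n => [|n IH] x' Hx'; rewrite ?gpow0 ?gmul1r // gpowSr gmulA; apply/Hy/IH.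
rewrite !gmulA; apply: (H _ nf3_mulc); apply: (H _ nf3_mulb); exact: (H _ nf3_mula).
Qed.

Lemma nf3_nat x : nf3 x -> exists i j k : nat, x = gpow a i * (gpow b j * gpow c k).
Proof.
have [s [ts s0]] := rels4_t8.
move=> [i [j [k ->]]].
have [i' ->] := gzpow_nat i (isT : 0 < 8) rels4_a8.
have [j' ->] := gzpow_nat j t4_gt0 rels4_b4t.
have [k' ->] := gzpow_nat k t2_gt0 rels4_c2t.
by exists i', j', k'.
Qed.

(** * Collapse of b^(2t) and the reflected triple *)

Lemma rels4_b2t (m n : int) :
  b ^z m = b ^z n -> ((4 * t)%N %| (2 * Posz t - (m - n))%R)%Z \/ ((4 * t)%N %| (2 * Posz t + (m - n))%R)%Z ->
  gpow b (2 * t) = 1.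
Proof.
move=> e H.
have e' : b ^z (m - n) = 1 by rewrite gzpowD e -gzpowD subrr gzpow0.
rewrite -gzpow_gpow; case: H => H.
  by rewrite -e'; apply: gzpow_mod rels4_b4t _; rewrite PoszM.
rewrite -[RHS]ginv1 -e' -gzpowN; apply: gzpow_mod rels4_b4t _.
by rewrite PoszM opprK.
Qed.

(** Since t^2 is a multiple of 4t, the square of 1 + e1 t is 1 + 2 e1 t modulo 4t, which misses 1 by
    exactly 2t. *)
Lemma rels4_kappa : b ^z ((1 + e1 * t) * (1 + e1 * t)) = b ^z 1 -> gpow b (2 * t) = 1.
Proof.
have [s [ts s0]] := rels4_t8.
move=> /rels4_b2t; apply.
by case/orP: se1 => /eqP ->; [left | right]; apply/dvdzP;
  [exists (- (2 * Posz s))%R | exists (2 * Posz s)%R]; rewrite ts !PoszM; ring.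
Qed.

(** If a^4 = 1, then conjugation by a^2 is an involution on <b>, so [rels4_kappa] applies. If c^t =
    1, then [rels4_ct_b] equates two powers of b whose exponents differ by 2 e2 t. *)
Lemma rels4_drop : gpow a 4 = 1 \/ gpow b (2 * t) = 1 \/ gpow c t = 1 -> gpow b (2 * t) = 1.
Proof.
case=> [a4|[//|ct]].
  apply: rels4_kappa; rewrite gzpowM gzpow1.
  have a22 : a ^z 2 * a ^z 2 = 1 by rewrite -gzpowD -[(2 + 2)%R]/(Posz 4) gzpow_gpow.
  apply: (@gmul_inj _ (a ^z 2)); rewrite (gzpow_semiconj _ (esym rels4_r1)).
  apply: (@gmul_inj _ (a ^z 2)); rewrite !gmulA a22 gmul1 -rels4_r1.
  by rewrite -gmulA a22 gmul1r.
apply: (@rels4_b2t (-3 + e2 * t)%R (-3 - e2 * t)%R).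
  by have := rels4_ct_b; rewrite gzpow_gpow ct gmul1 gmul1r.
by case/orP: se2 => /eqP ->; [left | right]; apply/dvdzP; exists 0%R; ring.
Qed.

(** If reflections r0, ..., r3 existed with a = r0 r1, b = r1 r2, c = r2 r3, conjugation by r2 would
    send (a, b, c) to (a b^2, b^-1, c^-1). This is the reflected triple; its first entry is a
    conjugate of a^-1. *)
Lemma rels4_reflect_a : a * b ^z 2 = b^-1 * a^-1 * b.
Proof. by rewrite -rels4_ab -gmulA; congr (_ * _); rewrite (gzpowD b 1 1) gzpow1. Qed.

Lemma rels4_reflect_a2 : (a * b ^z 2) ^z 2 = b^-1 * a ^z (-2) * b.
Proof.
rewrite (gzpowD _ 1 1) gzpow1 rels4_reflect_a (gzpowD _ (-1) (-1)) gzpowN1.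
by rewrite -!gmulA gVK.
Qed.

Lemma zpowV (x : G) (n : int) : x^-1 ^z n = x ^z (- n).
Proof. by rewrite -gzpowN1 -gzpowM mulN1r. Qed.

(* Conjugation by a^2 sends b to b^k with k = 1 + e1 t; the reflected triple
   asks the same of conjugation by a^-2. *)
Lemma rels4_chiral :
  (b^-1) * (a * b ^z 2) ^z 2 = (a * b ^z 2) ^z 2 * (b^-1) ^z (1 + e1 * t) ->
  gpow b (2 * t) = 1.
Proof.
rewrite rels4_reflect_a2 zpowV -!gmulA => /gmul_inj e.
have {}e : b^-1 * a ^z (-2) = a ^z (-2) * b ^z (- (1 + e1 * t)).
  by apply: (@gmul_injr _ b); rewrite -!gmulA e -gzpowSz -gzpowSzr.
have e' : a ^z 2 * b = b ^z (1 + e1 * t) * a ^z 2.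
  by have := congr1 (@ginv G) e; rewrite !ginvM -!gzpowN !opprK ginvK.
have := gzpow_semiconj (1 + e1 * t) e'; rewrite -rels4_r1 -gzpowM => e3.
by apply: rels4_kappa; rewrite gzpow1; apply: esym; apply: gmul_injr e3.
Qed.

(** Modulo 2t the number 1 + e1 t is its own inverse, so a^2 and a^-2 act alike on <b>. Inverting b
    and c exchanges the last two relations up to changing the exponents of b by 2 e2 t and those of
    c by 2t. *)
Lemma rels4_reflect :
  gpow b (2 * t) = 1 -> rels4 beta e1 e2 (a * b ^z 2) (b^-1) (c^-1).
Proof.
have [s [ts s0]] := rels4_t8.
move=> b2t.
have a'b : a * b ^z 2 * b^-1 = a * b.
  by rewrite -gzpowN1 -gmulA -gzpowD gzpow1.
split; [split | split; split].
- rewrite rels4_reflect_a -gzpow_gpow; apply: (@gmul_inj _ b).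
  rewrite (@gzpow_semiconj _ _ _ (a^-1)); last by rewrite -gmulA gVK.
  by rewrite zpowV gzpowN gzpow_gpow rels4_a8 ginv1 gmul1 gmul1r.
- by rewrite rels4_4t -gzpow_gpow zpowV gzpowN gzpow_gpow rels4_b4t ginv1.
- by rewrite rels4_2t -gzpow_gpow zpowV gzpowN gzpow_gpow rels4_c2t ginv1.
- by rewrite a'b; case: R4 => [_ [[]]].
- by rewrite -rels4_cb gpow2 {2}rels4_cb -gmulA (gmulA b) gmulVr gmul1 gmulVr.
- have abab : (a * b) * (a * b) = 1 by rewrite -gpow2; case: R4 => [_ [[]]].
  by rewrite a'b gpow2 {1}rels4_abcV -gmulA (gmulA (a * b)) abab gmul1 gmulVr.
- have kk : b ^z ((1 + e1 * t) * (1 + e1 * t)) = b.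
    rewrite -[RHS]gzpow1; apply: (gzpow_mod b2t); apply/dvdzP.
    by exists (e1 + 4 * Posz s * e1 * e1)%R; rewrite ts !PoszM; ring.
  have e : a ^z 2 * b = b ^z (1 + e1 * t) * a ^z 2.
    by rewrite -{1}kk gzpowM (gzpow_semiconj _ (esym rels4_r1)).
  have := congr1 (@ginv G) e; rewrite !ginvM -!gzpowN => {}e.
  rewrite -(gzpow_gpow _ 2) rels4_t zpowE.
  rewrite rels4_reflect_a2 zpowV -!gmulA; congr (_ * _).
  by rewrite gmulA e -!gmulA; congr (_ * _); rewrite -gzpowSzr -gzpowSz addrC.
- rewrite rels4_t !zpowE !zpowV ginvK rels4_r3.
  congr (_ * _); [apply: (gzpow_mod b2t) | apply: (gzpow_mod rels4_c2t)]; apply/dvdzP.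
    by exists e2; rewrite PoszM; ring.
  by exists 1%R; rewrite PoszM; ring.
- rewrite rels4_t !zpowE !zpowV !ginvK rels4_r2.
  congr (_ * _); [apply: (gzpow_mod b2t) | apply: (gzpow_mod rels4_c2t)]; apply/dvdzP.
    by exists e2; rewrite PoszM; ring.
  by exists 1%R; rewrite PoszM; ring.
Qed.

End Rels4.

(** * Tight quotients are determined by the orders of the generators *)

Definition grpOf (gT : finGroupType) : grp :=
  @Grp gT (fun x y => (x * y)%g) (fun x => (x^-1)%g) 1%g
       (@mulgA _) (@mul1g _) (@mulVg _).

Lemma gpowE (gT : finGroupType) (x : gT) n : @gpow (grpOf gT) x n = (x ^+ n)%g.
Proof. by elim: n => //= n ->; rewrite expgS. Qed.

Lemma gpow_permE (F : finType) (x : {perm F}) n : @gpow (permGrp F) x n = (x ^+ n)%g.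
Proof. exact: (@gpowE {perm F}). Qed.

(** A relation in place of a map covers homomorphisms, inverses of embeddings and the correspondence
    of automorphisms under a covering, which is known only on some pairs. Single-valuedness is what
    carries equations across. *)
Lemma rels4_transfer (G H : grp) (R : G -> H -> Prop) beta e1 e2 a b c a' b' c' :
  R (gone G) (gone H) ->
  (forall x y x' y', R x x' -> R y y' -> R (gmul x y) (gmul x' y')) ->
  (forall x x', R x x' -> R (ginv x) (ginv x')) ->
  (forall x y y', R x y -> R x y' -> y = y') ->
  R a a' -> R b b' -> R c c' ->
  rels4 beta e1 e2 a b c -> rels4 beta e1 e2 a' b' c'.
Proof.
move=> R1 RM RV Rf Ra Rb Rc.
have RX n x x' : R x x' -> R (gpow x n) (gpow x' n).
  by move=> Rx; elim: n => //= n IH; apply: RM.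
have RZ n x x' : R x x' -> R (gzpow x n) (gzpow x' n).
  by move=> Rx; case: n => n; rewrite /gzpow; [apply: RX | apply/RV/RX].
have Rab := RM _ _ _ _ Ra Rb; have Rbc := RM _ _ _ _ Rb Rc.
have Rabc := RM _ _ _ _ Rab Rc.
have E x y x' y' : R x x' -> R y y' -> x = y -> x' = y'.
  by move=> Rx Ry e; apply: Rf Rx _; rewrite e.
move=> [[p1 p2 p3] [[q1 q2 q3] [r1 r2 r3]]].
split; [split | split; split].
- exact: (E _ _ _ _ (RX 8 _ _ Ra) R1).
- exact: (E _ _ _ _ (RX _ _ _ Rb) R1).
- exact: (E _ _ _ _ (RX _ _ _ Rc) R1).
- exact: (E _ _ _ _ (RX 2 _ _ Rab) R1).
- exact: (E _ _ _ _ (RX 2 _ _ Rbc) R1).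
- exact: (E _ _ _ _ (RX 2 _ _ Rabc) R1).
- exact: (E _ _ _ _ (RM _ _ _ _ Rb (RX 2 _ _ Ra)) (RM _ _ _ _ (RX 2 _ _ Ra) (RZ _ _ _ Rb)) r1).
- exact: (E _ _ _ _ (RM _ _ _ _ (RV _ _ Rc) Rb) (RM _ _ _ _ (RZ _ _ _ Rb) (RZ _ _ _ Rc)) r2).
- exact: (E _ _ _ _ (RM _ _ _ _ Rc (RV _ _ Rb)) (RM _ _ _ _ (RZ _ _ _ Rb) (RZ _ _ _ Rc)) r3).
Qed.

Section ProdGrp.
Variables G H : grp.

Definition prodGrp : grp.
Proof.
refine (@Grp (G * H) (fun x y => (gmul x.1 y.1, gmul x.2 y.2))
   (fun x => (ginv x.1, ginv x.2)) (gone G, gone H) _ _ _).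
- by move=> x y z; rewrite /= !gmulA.
- by case=> x y; rewrite /= !gmul1.
- by case=> x y; rewrite /= !gmulV.
Defined.

Lemma gpow_pair (x : G) (y : H) n : @gpow prodGrp (x, y) n = (gpow x n, gpow y n).
Proof. by elim: n => //= n ->. Qed.

Lemma gzpow_pair (x : G) (y : H) n : @gzpow prodGrp (x, y) n = (gzpow x n, gzpow y n).
Proof. by case: n => n; rewrite /gzpow gpow_pair. Qed.

Lemma rels4_prod beta e1 e2 a b c a' b' c' :
  rels4 beta e1 e2 a b c -> rels4 beta e1 e2 a' b' c' ->
  @rels4 prodGrp beta e1 e2 (a, a') (b, b') (c, c').
Proof.
move=> [[p1 p2 p3] [[q1 q2 q3] [r1 r2 r3]]] [[p1' p2' p3'] [[q1' q2' q3'] [r1' r2' r3']]].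
split; [split | split; split].
- by rewrite gpow_pair p1 p1'.
- by rewrite gpow_pair p2 p2'.
- by rewrite gpow_pair p3 p3'.
- by rewrite gpow_pair q1 q1'.
- by rewrite gpow_pair q2 q2'.
- by rewrite gpow_pair q3 q3'.
- by rewrite gpow_pair gzpow_pair; congr (_, _).
- by rewrite !gzpow_pair; congr (_, _).
- by rewrite !gzpow_pair; congr (_, _).
Qed.

End ProdGrp.

(** * Uniqueness of exponents in a tight product of cyclic groups *)

Section TightNormalForm.
Variables (gT : finGroupType) (a b c : gT).
Local Open Scope group_scope.
Definition nform (i j k : nat) : gT := a ^+ i * (b ^+ j * c ^+ k).

Lemma nform_setP x :
  reflect (exists i j k, x = nform i j k) (x \in <[a]> * (<[b]> * <[c]>)).
Proof.
apply: (iffP mulsgP) => [[_ _ /cycleP[i ->] /mulsgP[_ _ /cycleP[j ->] /cycleP[k ->] ->] ->]|].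
  by exists i, j, k.
move=> [i [j [k ->]]]; exists (a ^+ i) (b ^+ j * c ^+ k) => //; first exact: mem_cycle.
by apply: mem_mulg; apply: mem_cycle.
Qed.

Definition nform_ord (u : 'I_#[a] * 'I_#[b] * 'I_#[c]) := nform u.1.1 u.1.2 u.2.

Lemma nform_mod i j k : nform i j k = nform (i %% #[a]) (j %% #[b]) (k %% #[c]).
Proof. by rewrite /nform !expg_mod_order. Qed.

Lemma nform_ord_image : nform_ord @: setT = <[a]> * (<[b]> * <[c]>).
Proof.
apply/setP => x; apply/imsetP/nform_setP => [[u _ ->]|[i [j [k ->]]]].
  by exists u.1.1, u.1.2, u.2.
pose i' := Ordinal (ltn_pmod i (order_gt0 a)).
pose j' := Ordinal (ltn_pmod j (order_gt0 b)).
pose k' := Ordinal (ltn_pmod k (order_gt0 c)).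
by exists (i', j', k') => //; rewrite nform_mod.
Qed.

Lemma card_nform_le : #|<[a]> * (<[b]> * <[c]>)| <= #[a] * #[b] * #[c].
Proof.
rewrite -nform_ord_image; apply: leq_trans (leq_imset_card _ _) _.
by rewrite cardsT !card_prod !card_ord.
Qed.

Hypothesis tight : #|<[a]> * (<[b]> * <[c]>)| = (#[a] * #[b] * #[c])%N.

(** The map from triples of residues onto the product set is a surjection between finite sets of
    equal size. *)
Lemma nform_inj i j k i' j' k' : nform i j k = nform i' j' k' ->
  [/\ i = i' %[mod #[a]], j = j' %[mod #[b]] & k = k' %[mod #[c]]].
Proof.
rewrite nform_mod [RHS]nform_mod => e.
pose q x y z : 'I_#[a] * 'I_#[b] * 'I_#[c] :=
  (Ordinal (ltn_pmod x (order_gt0 a)), Ordinal (ltn_pmod y (order_gt0 b)),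
   Ordinal (ltn_pmod z (order_gt0 c))).
have /imset_injP inj : #|nform_ord @: setT| == #|[set: 'I_#[a] * 'I_#[b] * 'I_#[c]]|.
  by rewrite nform_ord_image tight cardsT !card_prod !card_ord.
have /(inj _ _ (in_setT _) (in_setT _)) : nform_ord (q i j k) = nform_ord (q i' j' k') by [].
by case.
Qed.

Lemma nform_eq1 i j k : nform i j k = 1 -> [/\ a ^+ i = 1, b ^+ j = 1 & c ^+ k = 1].
Proof.
move=> e; have : nform i j k = nform 0 0 0 by rewrite e /nform !mulg1.
by move=> /nform_inj[ei ej ek]; split; apply/eqP; rewrite -order_dvdn; apply/eqP;
  rewrite ?ei ?ej ?ek mod0n.
Qed.

End TightNormalForm.

(** By the normal form the product set is closed under multiplication, which in a finite group
    already makes it a subgroup. *)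
Lemma rels4_nform (gT : finGroupType) (a b c : gT) beta e1 e2 :
  5 <= beta -> is_sign e1 -> is_sign e2 ->
  @rels4 (grpOf gT) beta e1 e2 a b c ->
  <<[set a; b; c]>>%g = (<[a]> * (<[b]> * <[c]>))%g.
Proof.
move=> b5 s1 s2 R4.
have gS : group_set (<[a]> * (<[b]> * <[c]>))%g.
  apply/group_setP; split.
    by apply/nform_setP; exists 0, 0, 0; rewrite /nform !mulg1.
  move=> x y /nform_setP[i [j [k ex]]] /nform_setP[i' [j' [k' ey]]].
  have nfP i1 j1 k1 : @nf3 (grpOf gT) a b c (nform a b c i1 j1 k1).
    by exists i1, j1, k1; rewrite !gzpow_gpow !gpowE.
  have [i2 [j2 [k2 e]]] := nf3_nat b5 R4 (nf3_mul b5 s1 s2 R4 (nfP i j k) (nfP i' j' k')).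
  by apply/nform_setP; exists i2, j2, k2; rewrite ex ey [LHS]e !gpowE.
apply/eqP; rewrite eqEsubset; apply/andP; split.
  suff : [set a; b; c] \subset Group gS by rewrite -gen_subG.
  apply/subsetP => x Sx; suff : x \in (<[a]> * (<[b]> * <[c]>))%g by [].
  move: Sx; rewrite !inE -orbA => /or3P[]/eqP->; apply/nform_setP.
  - by exists 1, 0, 0; rewrite /nform !mulg1.
  - by exists 0, 1, 0; rewrite /nform mulg1 mul1g.
  - by exists 0, 0, 1; rewrite /nform !mul1g.
apply/subsetP => x /nform_setP[i [j [k ->]]].
by rewrite !groupM // groupX // mem_gen // !inE eqxx ?orbT.
Qed.

(* The pairs (x, f x) form the subgroup of K x H generated by the pairs of
   generators; the normal form in that product makes it a graph. *)
Lemma rels4_hom (gT : finGroupType) (a b c : gT) (H : grp) (h1 h2 h3 : H) beta e1 e2 :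
  5 <= beta -> is_sign e1 -> is_sign e2 ->
  @rels4 (grpOf gT) beta e1 e2 a b c ->
  #|<<[set a; b; c]>>%g| = (#[a]%g * #[b]%g * #[c]%g)%N ->
  rels4 beta e1 e2 h1 h2 h3 ->
  gpow h1 #[a]%g = gone H -> gpow h2 #[b]%g = gone H -> gpow h3 #[c]%g = gone H ->
  exists f : gT -> H,
    [/\ {in <<[set a; b; c]>>%g &, forall x y, f (x * y)%g = gmul (f x) (f y)},
        f a = h1, f b = h2 & f c = h3].
Proof.
move=> b5 s1 s2 R4 tight R4h o1 o2 o3.
rewrite (rels4_nform b5 s1 s2 R4) in tight *.
pose hf i j k := gmul (gpow h1 i) (gmul (gpow h2 j) (gpow h3 k)).
have hmod (h : H) n i : gpow h n = gone H -> gpow h (i %% n) = gpow h i.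
  by move=> e; rewrite {2}(divn_eq i n) gpowD mulnC gpowM e gpow1n gmul1.
(* Off the product set the value is the dummy 1. On it, the exponents are unique modulo the orders
   of a, b, c, and [o1], [o2], [o3] make [hf] periodic with the same periods. *)
pose f (x : gT) := if [pick u : 'I_#[a]%g * 'I_#[b]%g * 'I_#[c]%g | x == nform_ord u] is Some u then hf u.1.1 u.1.2 u.2 else gone H.
have fE i j k : f (nform a b c i j k) = hf i j k.
  rewrite /f; case: pickP => [u /eqP|].
    move=> /(nform_inj tight)[ei ej ek].
    by rewrite /hf -(hmod _ _ _ o1) -(hmod _ _ _ o2) -(hmod _ _ _ o3) -ei -ej -ek !hmod.
  pose u : 'I_#[a]%g * 'I_#[b]%g * 'I_#[c]%g := (Ordinal (ltn_pmod i (order_gt0 a)),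
    Ordinal (ltn_pmod j (order_gt0 b)), Ordinal (ltn_pmod k (order_gt0 c))).
  by move=> /(_ u); rewrite nform_mod eqxx.
have R4p := rels4_prod R4 R4h.
exists f; split.
- move=> x y /nform_setP[i [j [k ex]]] /nform_setP[i' [j' [k' ey]]].
  have nfP i1 j1 k1 : @nf3 (prodGrp (grpOf gT) H) (a, h1) (b, h2) (c, h3) (nform a b c i1 j1 k1, hf i1 j1 k1).
    by exists i1, j1, k1; rewrite !gzpow_gpow !gpow_pair !gpowE.
  (* One triple of exponents serves both coordinates: the first identifies the product x y, the
     second evaluates the product of the images. *)
  have [i2 [j2 [k2 e]]] := nf3_nat b5 R4p (nf3_mul b5 s1 s2 R4p (nfP i j k) (nfP i' j' k')).
  move: e; rewrite !gpow_pair !gpowE /= => -[e3 e4].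
  rewrite ex ey !fE [X in f X](e3 : _ = nform a b c i2 j2 k2) fE.
  exact: esym e4.
- by rewrite (_ : a = nform a b c 1 0 0) ?fE /nform ?mulg1 // /hf /= !gmul1r.
- by rewrite (_ : b = nform a b c 0 1 0) ?fE /nform ?mulg1 ?mul1g // /hf /= gmul1 !gmul1r.
- by rewrite (_ : c = nform a b c 0 0 1) ?fE /nform ?mul1g // /hf /= !gmul1 gmul1r.
Qed.

(** * A faithful model of the group *)

Section OrdinalResidue.
Variables (n : nat) (n0 : 0 < n).

Let nz : Posz n != 0%R. Proof. by rewrite eqz_nat -lt0n. Qed.

Lemma ordz_proof (z : int) : `|(z %% n)%Z|%N < n.
Proof. by rewrite -ltz_nat gez0_abs ?modz_ge0 // ltz_pmod. Qed.

Definition ordz (z : int) : 'I_n := Ordinal (ordz_proof z).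

Lemma ordz_eq (z w : int) : (n %| (z - w)%R)%Z -> ordz z = ordz w.
Proof. by rewrite -eqz_mod_dvd => /eqP e; apply: val_inj; rewrite /= e. Qed.

Lemma ordzK (i : 'I_n) : ordz (Posz i) = i.
Proof. by apply: val_inj; rewrite /= modz_nat absz_nat modn_small. Qed.

Lemma ordz_dvd (z : int) : (n %| (Posz (ordz z) - z)%R)%Z.
Proof. by rewrite /= gez0_abs ?modz_ge0 // -eqz_mod_dvd modz_mod. Qed.

End OrdinalResidue.

(** * Polynomial certificates for the model *)

Lemma half_sq (j : int) : exists J : int, (j * j = j + 2 * J)%R.
Proof.
have [q [->|->]] : exists q : int, j = (2 * q)%R \/ j = (2 * q + 1)%R.
- by exists (j %/ 2)%Z; lia.
- by exists (q * (2 * q - 1))%R; ring.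
- by exists (q * (2 * q + 1))%R; ring.
Qed.

(** Equality under polynomial side conditions becomes an unconditional identity: U, V, W1, W2 are
    the cofactors of the four ideal generators. The condition d d = - d encodes d = 0 or d = -1,
    that is, a sign 1 + 2 d; J and K stand for binomials. *)
Lemma certify (j J k K d1 d2 D E : int) :
  (j * j = j + 2 * J -> k * k = k + 2 * K -> d1 * d1 = - d1 -> d2 * d2 = - d2 ->
  forall U V W1 W2 : int,
  D - E = (j * j - (j + 2 * J)) * U + (k * k - (k + 2 * K)) * V
        + (d1 * d1 + d1) * W1 + (d2 * d2 + d2) * W2 -> D = E)%R.
Proof.
move=> -> -> -> -> U V W1 W2 e; apply/eqP; rewrite -subr_eq0 e.
by rewrite !subrr !addNr !mul0r !addr0.
Qed.

Arguments certify [j J k K d1 d2 D E] _ _ _ _ U V W1 W2 _.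

(* The regular representation on the exponents of a^i b^j c^k, with t = 8 s and
   e_i = 1 + 2 d_i.  It comes from the identities, valid in any group with the
   defining relations, where C(x) = x (x - 1) / 2 :
     b^j a = a^(1-2j) b^(-j + e1 t C(j)),
     c^k b = b^(1-2k + e2 t C(k)) c^(-k + t C(k)),
     c^k a = a b^(2k + e2 t C(k)) c^(k + t C(k)). *)
Section Model.
Variables (s d1 d2 : int).
Hypotheses (s0 : (0 < s)%R) (dd1 : (d1 * d1 = - d1)%R) (dd2 : (d2 * d2 = - d2)%R).
Let e1 := (1 + 2 * d1)%R.
Let e2 := (1 + 2 * d2)%R.
Local Open Scope ring_scope.
Implicit Types (v w : int * int * int) (i j k m n x y z : int).

Definition mA v := let: (i, j, k) := v in
  (i + 1 - 2 * j, - j + 4 * e1 * s * (j * (j - 1)) + 2 * k + 4 * e2 * s * (k * (k - 1)),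
   k + 4 * s * (k * (k - 1))).
Definition mB v := let: (i, j, k) := v in
  (i, j + 1 - 2 * k + 4 * e2 * s * (k * (k - 1)), - k + 4 * s * (k * (k - 1))).
Definition mC n v := let: (i, j, k) := v in (i, j, k + n).
(** This and the next three maps are the composites a^2, a^4, (b^2)^m and a b after reduction modulo
    the periods. Reducing before composing again keeps the degrees in the certificates small. *)
Definition mA2 v := let: (i, j, k) := v in
  (i + 2 - 4 * k, j + 8 * e1 * s * (j + 2 * k * k - k - 2 * k * j) + 8 * s * (k * k - k), k).
Definition mA4 v := let: (i, j, k) := v in (i + 4, j + 16 * s * (j - k), k).
Definition mB2 m v := let: (i, j, k) := v in
  (i, j + 2 * m + 8 * e2 * s * m * k, k + 8 * s * m * k).
Definition mAB v := let: (i, j, k) := v in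
  (i + 1 - 2 * j, 1 - j + 4 * e1 * s * (j * (j - 1)), - k).

(** With t = 8 s, the moduli 32 s and 16 s are 4t and 2t, the intended orders of b and c. *)
Definition cong v w := [&& (8 %| v.1.1 - w.1.1)%Z, ((32 * s)%R %| v.1.2 - w.1.2)%Z
                         & ((16 * s)%R %| v.2 - w.2)%Z].

(* Certificates: quotients and cofactors of the congruences modulo the ideal
   (j^2 - j - 2 J, k^2 - k - 2 K, d1^2 + d1, d2^2 + d2). *)
Lemma cert_A2 v : cong (mA (mA v)) (mA2 v).
Proof.
case: v => [[i j] k]; have [J HJ] := half_sq j; have [K HK] := half_sq k.
apply/and3P; split; apply/dvdzP.
- exists (- 4 * J * s * d1 - 2 * J * s - 4 * K * s * d2 - 2 * K * s)%R; refine (certify HJ HK dd1 dd2 (- 16 *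
    s * d1 - 8 * s)%R (- 16 * s * d2 - 8 * s)%R (0)%R (0)%R _).
  by rewrite /= ?/e1 ?/e2; ring.
- exists (- 2 * j * J * s - 8 * j * K * s * d1 * d2 - 4 * j * K * s * d1 - 4 * j * K * s * d2 - 2 * j * K * s
    + 4 * k * J * s + 16 * k * K * s * d1 * d2 + 8 * k * K * s * d1 + 12 * k * K * s * d2 + 6 * k * K * s + 16
    * J * J * s * s * d1 + 8 * J * J * s * s + 32 * J * K * s * s * d2 + 16 * J * K * s * s - J * s + 16 * K *
    K * s * s * d1 + 16 * K * K * s * s * d2 + 16 * K * K * s * s - 4 * K * s * d1 * d2 - 2 * K * s * d1 - 4 *
    K * s * d2 - 2 * K * s)%R; refine (certify HJ HK dd1 dd2 (512 * j * j * s * s * s * d1 * d1 * d1 + 768 * j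
    * j * s * s * s * d1 * d1 + 384 * j * j * s * s * s * d1 + 64 * j * j * s * s * s - 512 * j * s * s * s *
    d1 * d1 * d1 - 768 * j * s * s * s * d1 * d1 - 384 * j * s * s * s * d1 - 64 * j * s * s * s - 128 * j * s
    * s * d1 * d1 - 128 * j * s * s * d1 - 32 * j * s * s + 1024 * k * k * s * s * s * d1 * d1 * d2 + 512 * k
    * k * s * s * s * d1 * d1 + 1024 * k * k * s * s * s * d1 * d2 + 512 * k * k * s * s * s * d1 + 256 * k *
    k * s * s * s * d2 + 128 * k * k * s * s * s - 1024 * k * s * s * s * d1 * d1 * d2 - 512 * k * s * s * s *
    d1 * d1 - 1024 * k * s * s * s * d1 * d2 - 512 * k * s * s * s * d1 - 256 * k * s * s * s * d2 - 128 * k *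
    s * s * s + 256 * k * s * s * d1 * d1 + 256 * k * s * s * d1 + 64 * k * s * s + 1024 * J * s * s * s * d1
    * d1 * d1 + 1536 * J * s * s * s * d1 * d1 + 768 * J * s * s * s * d1 + 128 * J * s * s * s - 64 * s * s *
    d1 * d1 - 64 * s * s * d1 - 16 * s * s)%R (- 128 * j * s * s * d1 * d2 - 64 * j * s * s * d1 - 64 * j * s
    * s * d2 - 32 * j * s * s + 512 * k * k * s * s * s * d1 * d2 * d2 + 512 * k * k * s * s * s * d1 * d2 +
    128 * k * k * s * s * s * d1 + 256 * k * k * s * s * s * d2 * d2 + 384 * k * k * s * s * s * d2 + 128 * k
    * k * s * s * s - 512 * k * s * s * s * d1 * d2 * d2 - 512 * k * s * s * s * d1 * d2 - 128 * k * s * s * s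
    * d1 - 256 * k * s * s * s * d2 * d2 - 384 * k * s * s * s * d2 - 128 * k * s * s * s + 256 * k * s * s *
    d1 * d2 + 128 * k * s * s * d1 + 192 * k * s * s * d2 + 96 * k * s * s + 2048 * J * s * s * s * d1 * d1 *
    d2 + 1024 * J * s * s * s * d1 * d1 + 2048 * J * s * s * s * d1 * d2 + 1024 * J * s * s * s * d1 + 512 * J
    * s * s * s * d2 + 256 * J * s * s * s + 1024 * K * s * s * s * d1 * d2 * d2 + 1024 * K * s * s * s * d1 *
    d2 + 256 * K * s * s * s * d1 + 512 * K * s * s * s * d2 * d2 + 768 * K * s * s * s * d2 + 256 * K * s * s
    * s - 64 * s * s * d1 * d2 - 32 * s * s * d1 - 64 * s * s * d2 - 32 * s * s)%R (- 256 * j * J * s * s +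
    512 * k * J * s * s + 2048 * J * J * s * s * s * d1 + 1024 * J * J * s * s * s + 4096 * J * K * s * s * s
    * d2 + 2048 * J * K * s * s * s - 128 * J * s * s)%R (2048 * K * K * s * s * s * d1 + 1024 * K * K * s * s
    * s)%R _).
  by rewrite /= ?/e1 ?/e2; ring.
- exists (4 * k * K * s + 16 * K * K * s * s - 2 * K * s + K)%R; refine (certify HJ HK dd1 dd2 (0)%R (64 * k *
    k * s * s * s - 64 * k * s * s * s + 32 * k * s * s + 128 * K * s * s * s - 16 * s * s + 8 * s)%R (0)%R
    (0)%R _).
  by rewrite /= ?/e1 ?/e2; ring.
Qed.

Lemma cert_A4 v : cong (mA2 (mA2 v)) (mA4 v).
Proof.
case: v => [[i j] k]; have [J HJ] := half_sq j; have [K HK] := half_sq k.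
apply/and3P; split; apply/dvdzP.
- exists (- k)%R; refine (certify HJ HK dd1 dd2 (0)%R (0)%R (0)%R (0)%R _).
  by rewrite /= ?/e1 ?/e2; ring.
- exists (- 2 * j * k * d1 - j * k + 16 * j * K * s + 2 * j * s + j * d1 - 16 * k * K * s * d1 - 24 * k * K *
    s - 2 * k * s + k * d1 + k + 8 * K * s * d1 + 4 * K * s + 4 * K * d1 + 3 * K)%R; refine (certify HJ HK dd1
    dd2 (0)%R (1024 * j * s * s * d1 * d1 + 1024 * j * s * s * d1 + 256 * j * s * s - 1024 * k * s * s * d1 *
    d1 - 1280 * k * s * s * d1 - 384 * k * s * s + 128 * s * s * d1 + 64 * s * s + 64 * s * d1 + 48 * s)%R
    (2048 * j * K * s * s + 256 * j * s * s - 2048 * k * K * s * s - 256 * k * s * s)%R (0)%R _).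
  by rewrite /= ?/e1 ?/e2; ring.
- exists (0)%R; refine (certify HJ HK dd1 dd2 (0)%R (0)%R (0)%R (0)%R _).
  by rewrite /= ?/e1 ?/e2; ring.
Qed.

Lemma cert_A8 v : cong (mA4 (mA4 v)) (v).
Proof.
case: v => [[i j] k]; have [J HJ] := half_sq j; have [K HK] := half_sq k.
apply/and3P; split; apply/dvdzP.
- exists (1)%R; refine (certify HJ HK dd1 dd2 (0)%R (0)%R (0)%R (0)%R _).
  by rewrite /= ?/e1 ?/e2; ring.
- exists (8 * j * s + j - 8 * k * s - k)%R; refine (certify HJ HK dd1 dd2 (0)%R (0)%R (0)%R (0)%R _).
  by rewrite /= ?/e1 ?/e2; ring.
- exists (0)%R; refine (certify HJ HK dd1 dd2 (0)%R (0)%R (0)%R (0)%R _).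
  by rewrite /= ?/e1 ?/e2; ring.
Qed.

Lemma cert_B2 v : cong (mB (mB v)) (mB2 1 v).
Proof.
case: v => [[i j] k]; have [J HJ] := half_sq j; have [K HK] := half_sq k.
apply/and3P; split; apply/dvdzP.
- exists (0)%R; refine (certify HJ HK dd1 dd2 (0)%R (0)%R (0)%R (0)%R _).
  by rewrite /= ?/e1 ?/e2; ring.
- exists (- 4 * k * K * s * d2 - 2 * k * K * s + 16 * K * K * s * s * d2 + 8 * K * K * s * s - 2 * K * s * d2
    - K * s + K * d2)%R; refine (certify HJ HK dd1 dd2 (0)%R (128 * k * k * s * s * s * d2 + 64 * k * k * s *
    s * s - 128 * k * s * s * s * d2 - 64 * k * s * s * s - 64 * k * s * s * d2 - 32 * k * s * s + 256 * K * s
    * s * s * d2 + 128 * K * s * s * s - 32 * s * s * d2 - 16 * s * s + 16 * s * d2)%R (0)%R (0)%R _).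
  by rewrite /= ?/e1 ?/e2; ring.
- exists (- 4 * k * K * s + 16 * K * K * s * s - 2 * K * s)%R; refine (certify HJ HK dd1 dd2 (0)%R (64 * k * k
    * s * s * s - 64 * k * s * s * s - 32 * k * s * s + 128 * K * s * s * s - 16 * s * s)%R (0)%R (0)%R _).
  by rewrite /= ?/e1 ?/e2; ring.
Qed.

Lemma cert_B2m m n v : cong (mB2 n (mB2 m v)) (mB2 (m + n) v).
Proof.
case: v => [[i j] k]; have [J HJ] := half_sq j; have [K HK] := half_sq k.
apply/and3P; split; apply/dvdzP.
- exists (0)%R; refine (certify HJ HK dd1 dd2 (0)%R (0)%R (0)%R (0)%R _).
  by rewrite /= ?/e1 ?/e2; ring.
- exists (4 * k * s * d2 * m * n + 2 * k * s * m * n)%R; refine (certify HJ HK dd1 dd2 (0)%R (0)%R (0)%R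
    (0)%R _).
  by rewrite /= ?/e1 ?/e2; ring.
- exists (4 * k * s * m * n)%R; refine (certify HJ HK dd1 dd2 (0)%R (0)%R (0)%R (0)%R _).
  by rewrite /= ?/e1 ?/e2; ring.
Qed.

Lemma cert_AB v : cong (mB (mA v)) (mAB v).
Proof.
case: v => [[i j] k]; have [J HJ] := half_sq j; have [K HK] := half_sq k.
apply/and3P; split; apply/dvdzP.
- exists (0)%R; refine (certify HJ HK dd1 dd2 (0)%R (0)%R (0)%R (0)%R _).
  by rewrite /= ?/e1 ?/e2; ring.
- exists (4 * k * K * s * d2 + 2 * k * K * s + 16 * K * K * s * s * d2 + 8 * K * K * s * s - 2 * K * s * d2 -
    K * s + K * d2)%R; refine (certify HJ HK dd1 dd2 (0)%R (128 * k * k * s * s * s * d2 + 64 * k * k * s * s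
    * s - 128 * k * s * s * s * d2 - 64 * k * s * s * s + 64 * k * s * s * d2 + 32 * k * s * s + 256 * K * s *
    s * s * d2 + 128 * K * s * s * s - 32 * s * s * d2 - 16 * s * s + 16 * s * d2)%R (0)%R (0)%R _).
  by rewrite /= ?/e1 ?/e2; ring.
- exists (4 * k * K * s + 16 * K * K * s * s - 2 * K * s)%R; refine (certify HJ HK dd1 dd2 (0)%R (64 * k * k *
    s * s * s - 64 * k * s * s * s + 32 * k * s * s + 128 * K * s * s * s - 16 * s * s)%R (0)%R (0)%R _).
  by rewrite /= ?/e1 ?/e2; ring.
Qed.

Lemma cert_AB2 v : cong (mAB (mAB v)) (v).
Proof.
case: v => [[i j] k]; have [J HJ] := half_sq j; have [K HK] := half_sq k.
apply/and3P; split; apply/dvdzP.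
- exists (- 4 * J * s * d1 - 2 * J * s)%R; refine (certify HJ HK dd1 dd2 (- 16 * s * d1 - 8 * s)%R (0)%R (0)%R
    (0)%R _).
  by rewrite /= ?/e1 ?/e2; ring.
- exists (- 2 * j * J * s + 16 * J * J * s * s * d1 + 8 * J * J * s * s + J * s)%R; refine (certify HJ HK dd1
    dd2 (512 * j * j * s * s * s * d1 * d1 * d1 + 768 * j * j * s * s * s * d1 * d1 + 384 * j * j * s * s * s
    * d1 + 64 * j * j * s * s * s - 512 * j * s * s * s * d1 * d1 * d1 - 768 * j * s * s * s * d1 * d1 - 384 *
    j * s * s * s * d1 - 64 * j * s * s * s - 128 * j * s * s * d1 * d1 - 128 * j * s * s * d1 - 32 * j * s *
    s + 1024 * J * s * s * s * d1 * d1 * d1 + 1536 * J * s * s * s * d1 * d1 + 768 * J * s * s * s * d1 + 128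
    * J * s * s * s + 64 * s * s * d1 * d1 + 64 * s * s * d1 + 16 * s * s)%R (0)%R (- 256 * j * J * s * s +
    2048 * J * J * s * s * s * d1 + 1024 * J * J * s * s * s + 128 * J * s * s)%R (0)%R _).
  by rewrite /= ?/e1 ?/e2; ring.
- exists (0)%R; refine (certify HJ HK dd1 dd2 (0)%R (0)%R (0)%R (0)%R _).
  by rewrite /= ?/e1 ?/e2; ring.
Qed.

Lemma cert_ABC2 v : cong (mC 1 (mAB (mC 1 (mAB v)))) (v).
Proof.
case: v => [[i j] k]; have [J HJ] := half_sq j; have [K HK] := half_sq k.
apply/and3P; split; apply/dvdzP.
- exists (- 4 * J * s * d1 - 2 * J * s)%R; refine (certify HJ HK dd1 dd2 (- 16 * s * d1 - 8 * s)%R (0)%R (0)%R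
    (0)%R _).
  by rewrite /= ?/e1 ?/e2; ring.
- exists (- 2 * j * J * s + 16 * J * J * s * s * d1 + 8 * J * J * s * s + J * s)%R; refine (certify HJ HK dd1
    dd2 (512 * j * j * s * s * s * d1 * d1 * d1 + 768 * j * j * s * s * s * d1 * d1 + 384 * j * j * s * s * s
    * d1 + 64 * j * j * s * s * s - 512 * j * s * s * s * d1 * d1 * d1 - 768 * j * s * s * s * d1 * d1 - 384 *
    j * s * s * s * d1 - 64 * j * s * s * s - 128 * j * s * s * d1 * d1 - 128 * j * s * s * d1 - 32 * j * s *
    s + 1024 * J * s * s * s * d1 * d1 * d1 + 1536 * J * s * s * s * d1 * d1 + 768 * J * s * s * s * d1 + 128
    * J * s * s * s + 64 * s * s * d1 * d1 + 64 * s * s * d1 + 16 * s * s)%R (0)%R (- 256 * j * J * s * s +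
    2048 * J * J * s * s * s * d1 + 1024 * J * J * s * s * s + 128 * J * s * s)%R (0)%R _).
  by rewrite /= ?/e1 ?/e2; ring.
- exists (0)%R; refine (certify HJ HK dd1 dd2 (0)%R (0)%R (0)%R (0)%R _).
  by rewrite /= ?/e1 ?/e2; ring.
Qed.

Lemma cert_BC2 v : cong (mC 1 (mB (mC 1 (mB v)))) (v).
Proof.
case: v => [[i j] k]; have [J HJ] := half_sq j; have [K HK] := half_sq k.
apply/and3P; split; apply/dvdzP.
- exists (0)%R; refine (certify HJ HK dd1 dd2 (0)%R (0)%R (0)%R (0)%R _).
  by rewrite /= ?/e1 ?/e2; ring.
- exists (- 4 * k * K * s * d2 - 2 * k * K * s + 16 * K * K * s * s * d2 + 8 * K * K * s * s + 2 * K * s * d2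
    + K * s + K * d2)%R; refine (certify HJ HK dd1 dd2 (0)%R (128 * k * k * s * s * s * d2 + 64 * k * k * s *
    s * s - 128 * k * s * s * s * d2 - 64 * k * s * s * s - 64 * k * s * s * d2 - 32 * k * s * s + 256 * K * s
    * s * s * d2 + 128 * K * s * s * s + 32 * s * s * d2 + 16 * s * s + 16 * s * d2)%R (0)%R (0)%R _).
  by rewrite /= ?/e1 ?/e2; ring.
- exists (- 4 * k * K * s + 16 * K * K * s * s + 2 * K * s)%R; refine (certify HJ HK dd1 dd2 (0)%R (64 * k * k
    * s * s * s - 64 * k * s * s * s - 32 * k * s * s + 128 * K * s * s * s + 16 * s * s)%R (0)%R (0)%R _).
  by rewrite /= ?/e1 ?/e2; ring.
Qed.

Lemma cert_R1 v : cong (mA2 (mB v)) (mB2 (4 * s * e1) (mB (mA2 v))).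
Proof.
case: v => [[i j] k]; have [J HJ] := half_sq j; have [K HK] := half_sq k.
apply/and3P; split; apply/dvdzP.
- exists (k - 4 * K * s)%R; refine (certify HJ HK dd1 dd2 (0)%R (- 16 * s)%R (0)%R (0)%R _).
  by rewrite /= ?/e1 ?/e2; ring.
- exists (2 * j * k * d1 + j * k - 8 * j * K * s * d1 - 4 * j * K * s + 16 * k * K * s * d1 * d2 + 8 * k * K *
    s * d1 + 8 * k * K * s * d2 + 4 * k * s * d1 * d2 + 2 * k * s * d1 + 2 * k * s * d2 + k * s - k * d1 - 128
    * K * K * s * s * d1 * d2 - 64 * K * K * s * s * d2 + 16 * K * K * s * s - 32 * K * s * s * d1 * d2 - 16 *
    K * s * s * d1 - 16 * K * s * s * d2 - 8 * K * s * s + 8 * K * s * d1 * d2 - 8 * K * s * d1 + 4 * K * s *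
    d2 - 6 * K * s - 4 * K * d1 - 2 * K)%R; refine (certify HJ HK dd1 dd2 (0)%R (- 128 * j * s * s * d1 - 64 *
    j * s * s - 1024 * k * k * s * s * s * d1 * d2 - 512 * k * k * s * s * s * d2 + 128 * k * k * s * s * s +
    1024 * k * s * s * s * d1 * d2 + 512 * k * s * s * s * d2 - 128 * k * s * s * s + 256 * k * s * s * d1 *
    d2 + 128 * k * s * s * d1 + 128 * k * s * s * d2 - 2048 * K * s * s * s * d1 * d2 - 1024 * K * s * s * s *
    d2 + 256 * K * s * s * s - 512 * s * s * s * d1 * d2 - 256 * s * s * s * d1 - 256 * s * s * s * d2 - 128 *
    s * s * s + 128 * s * s * d1 * d2 - 128 * s * s * d1 + 64 * s * s * d2 - 96 * s * s - 64 * s * d1 - 32 *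
    s)%R (0)%R (0)%R _).
  by rewrite /= ?/e1 ?/e2; ring.
- exists (4 * k * s * d1 + 2 * k * s - 32 * K * s * s * d1 - 16 * K * s * s)%R; refine (certify HJ HK dd1 dd2
    (0)%R (- 256 * s * s * s * d1 - 128 * s * s * s)%R (0)%R (0)%R _).
  by rewrite /= ?/e1 ?/e2; ring.
Qed.

Lemma cert_R2 v : cong (mB (mC (-1) v)) (mC (1 + 8 * s) (mB2 (1 + 4 * s * e2) (mB v))).
Proof.
case: v => [[i j] k]; have [J HJ] := half_sq j; have [K HK] := half_sq k.
apply/and3P; split; apply/dvdzP.
- exists (0)%R; refine (certify HJ HK dd1 dd2 (0)%R (0)%R (0)%R (0)%R _).
  by rewrite /= ?/e1 ?/e2; ring.
- exists (k * s - 8 * K * s * s - 4 * K * s * d2 - 2 * K * s)%R; refine (certify HJ HK dd1 dd2 (0)%R (- 512 *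
    s * s * s * d2 * d2 - 512 * s * s * s * d2 - 128 * s * s * s - 64 * s * s * d2 - 32 * s * s)%R (0)%R (128
    * k * s * s - 1024 * K * s * s * s)%R _).
  by rewrite /= ?/e1 ?/e2; ring.
- exists (4 * k * s * d2 + 2 * k * s - 32 * K * s * s * d2 - 16 * K * s * s - 4 * K * s)%R; refine (certify HJ
    HK dd1 dd2 (0)%R (- 256 * s * s * s * d2 - 128 * s * s * s - 32 * s * s)%R (0)%R (0)%R _).
  by rewrite /= ?/e1 ?/e2; ring.
Qed.

Lemma cert_R3 v : cong (mB2 (-1) (mB (mC 1 v))) (mC (-1 + 8 * s) (mB2 (-2 + 4 * s * e2) (mB v))).
Proof.
case: v => [[i j] k]; have [J HJ] := half_sq j; have [K HK] := half_sq k.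
apply/and3P; split; apply/dvdzP.
- exists (0)%R; refine (certify HJ HK dd1 dd2 (0)%R (0)%R (0)%R (0)%R _).
  by rewrite /= ?/e1 ?/e2; ring.
- exists (- 4 * k * s * d2 - k * s - 8 * K * s * s + 4 * K * s * d2 + 2 * K * s)%R; refine (certify HJ HK dd1
    dd2 (0)%R (- 512 * s * s * s * d2 * d2 - 512 * s * s * s * d2 - 128 * s * s * s + 64 * s * s * d2 + 32 * s
    * s)%R (0)%R (128 * k * s * s - 1024 * K * s * s * s)%R _).
  by rewrite /= ?/e1 ?/e2; ring.
- exists (4 * k * s * d2 - 2 * k * s - 32 * K * s * s * d2 - 16 * K * s * s + 4 * K * s)%R; refine (certify HJ
    HK dd1 dd2 (0)%R (- 256 * s * s * s * d2 - 128 * s * s * s + 32 * s * s)%R (0)%R (0)%R _).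
  by rewrite /= ?/e1 ?/e2; ring.
Qed.

(** This makes [mA] descend to residues. *)
Lemma cert_wA i j k x y z : cong (mA (i + 8 * x, j + 32 * s * y, k + 16 * s * z)) (mA (i, j, k)).
Proof.
have [J HJ] := half_sq j; have [K HK] := half_sq k.
apply/and3P; split; apply/dvdzP.
- exists (- 8 * s * y + x)%R; refine (certify HJ HK dd1 dd2 (0)%R (0)%R (0)%R (0)%R _).
  by rewrite /= ?/e1 ?/e2; ring.
- exists (16 * j * s * d1 * y + 8 * j * s * y + 8 * k * s * d2 * z + 4 * k * s * z + 256 * s * s * d1 * y * y
    + 64 * s * s * d2 * z * z + 128 * s * s * y * y + 32 * s * s * z * z - 8 * s * d1 * y - 4 * s * d2 * z - 4
    * s * y - 2 * s * z - y + z)%R; refine (certify HJ HK dd1 dd2 (0)%R (0)%R (0)%R (0)%R _).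
  by rewrite /= ?/e1 ?/e2; ring.
- exists (8 * k * s * z + 64 * s * s * z * z - 4 * s * z + z)%R; refine (certify HJ HK dd1 dd2 (0)%R (0)%R
    (0)%R (0)%R _).
  by rewrite /= ?/e1 ?/e2; ring.
Qed.

Lemma cert_wB i j k x y z : cong (mB (i + 8 * x, j + 32 * s * y, k + 16 * s * z)) (mB (i, j, k)).
Proof.
have [J HJ] := half_sq j; have [K HK] := half_sq k.
apply/and3P; split; apply/dvdzP.
- exists (x)%R; refine (certify HJ HK dd1 dd2 (0)%R (0)%R (0)%R (0)%R _).
  by rewrite /= ?/e1 ?/e2; ring.
- exists (8 * k * s * d2 * z + 4 * k * s * z + 64 * s * s * d2 * z * z + 32 * s * s * z * z - 4 * s * d2 * z -
    2 * s * z + y - z)%R; refine (certify HJ HK dd1 dd2 (0)%R (0)%R (0)%R (0)%R _).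
  by rewrite /= ?/e1 ?/e2; ring.
- exists (8 * k * s * z + 64 * s * s * z * z - 4 * s * z - z)%R; refine (certify HJ HK dd1 dd2 (0)%R (0)%R
    (0)%R (0)%R _).
  by rewrite /= ?/e1 ?/e2; ring.
Qed.


(** * Descent to residues and the permutation group *)

Lemma cong_refl v : cong v v.
Proof. by rewrite /cong !subrr !dvdz0. Qed.

Let n2 := `|(32 * s)%R|%N.
Let n3 := `|(16 * s)%R|%N.
Let n2_gt0 : (0 < n2)%N. Proof. by clear -s0; rewrite /n2; lia. Qed.
Let n3_gt0 : (0 < n3)%N. Proof. by clear -s0; rewrite /n3; lia. Qed.
Let n2E : Posz n2 = 32 * s. Proof. by clear -s0; rewrite /n2; lia. Qed.
Let n3E : Posz n3 = 16 * s. Proof. by clear -s0; rewrite /n3; lia. Qed.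

Definition mX : finType := ('I_8 * 'I_n2 * 'I_n3)%type.

Definition mpi v : mX := (@ordz 8 isT v.1.1, ordz n2_gt0 v.1.2, ordz n3_gt0 v.2).
Definition mio (u : mX) : int * int * int := (Posz u.1.1, Posz u.1.2, Posz u.2).

Lemma mpiK u : mpi (mio u) = u.
Proof. by case: u => [[i j] k]; rewrite /mpi /= !ordzK. Qed.

Lemma mpi_cong v w : cong v w -> mpi v = mpi w.
Proof.
case/and3P => h1 h2 h3; by congr (_, _, _); apply: ordz_eq.
Qed.

Definition lft (f : int * int * int -> int * int * int) (u : mX) := mpi (f (mio u)).

Lemma lftE f : (forall i j k x y z, cong (f (i + 8 * x, j + 32 * s * y, k + 16 * s * z)) (f (i, j, k))) ->
  forall v, lft f (mpi v) = mpi (f v).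
Proof.
move=> H [[i j] k]; apply: mpi_cong.
have /dvdzP[x ex] := @ordz_dvd 8 isT i.
have /dvdzP[y ey] := ordz_dvd n2_gt0 j.
have /dvdzP[z ez] := ordz_dvd n3_gt0 k.
rewrite n2E in ey; rewrite n3E in ez.
rewrite /mio /mpi [X in f X](_ : _ = (i + 8 * x, j + 32 * s * y, k + 16 * s * z)) //.
move/eqP: ex; move/eqP: ey; move/eqP: ez; rewrite !subr_eq => /eqP ez /eqP ey /eqP ex.
by rewrite /= ex ey ez; congr (_, _, _); ring.
Qed.

Lemma lftA v : lft mA (mpi v) = mpi (mA v).
Proof. by apply: lftE => *; apply: cert_wA. Qed.
Lemma lftB v : lft mB (mpi v) = mpi (mB v).
Proof. by apply: lftE => *; apply: cert_wB. Qed.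
Lemma lftC v : lft (mC 1) (mpi v) = mpi (mC 1 v).
Proof.
apply: lftE => i j k x y z; apply/and3P; split; apply/dvdzP.
- by exists x => /=; ring.
- by exists y => /=; ring.
- by exists z => /=; ring.
Qed.

(** Since (b c)^2 acts trivially, c b c is a left inverse of b; injectivity thus follows from a
    relation, with no separate formula for the inverse map. The map for a is treated likewise
    through (a b)^2. *)
Lemma lftB_inj : injective (lft mB).
Proof.
apply: (can_inj (g := fun u => lft (mC 1) (lft mB (lft (mC 1) u)))) => u.
by rewrite -(mpiK u) lftB lftC lftB lftC; apply/mpi_cong/cert_BC2.
Qed.

Lemma lftA_inj : injective (lft mA).
Proof.
apply: (can_inj (g := fun u => lft mB (lft mA (lft mB u)))) => u.
rewrite -(mpiK u) lftA lftB (mpi_cong (cert_AB _)) lftA lftB (mpi_cong (cert_AB _)).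
exact/mpi_cong/cert_AB2.
Qed.

Lemma lftC_inj : injective (lft (mC 1)).
Proof.
apply: (can_inj (g := fun u => lft mB (lft (mC 1) (lft mB u)))) => u.
(* The certificate for (b c)^2 begins with the action of b, so u is first written as the image of
   some point under b. *)
have [g Bg gB] := injF_bij lftB_inj.
rewrite -{1}(gB u) -[RHS]gB; congr (lft mB _).
rewrite -(mpiK (g u)) lftB lftC lftB lftC; exact/mpi_cong/cert_BC2.
Qed.

Definition ma : {perm mX} := perm lftA_inj.
Definition mb : {perm mX} := perm lftB_inj.
Definition mc : {perm mX} := perm lftC_inj.

Definition acts (x : {perm mX}) f := forall v, x (mpi v) = mpi (f v).

Lemma actsM (x y : {perm mX}) f g : acts x f -> acts y g -> acts (x * y)%g (fun v => g (f v)).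
Proof. by move=> hx hy v; rewrite permM hx hy. Qed.

Lemma acts_cong (x : {perm mX}) f g : acts x f -> (forall v, cong (f v) (g v)) -> acts x g.
Proof. by move=> hx e v; rewrite hx; apply: mpi_cong. Qed.

Lemma acts_eq (x y : {perm mX}) f g : acts x f -> acts y g -> (forall v, cong (f v) (g v)) -> x = y.
Proof. by move=> hx hy e; apply/permP => u; rewrite -(mpiK u) hx hy; apply: mpi_cong. Qed.

Lemma acts1 : acts 1%g id.
Proof. by move=> v; rewrite perm1. Qed.

Lemma acts_a : acts ma mA. Proof. by move=> v; rewrite permE lftA. Qed.
Lemma acts_b : acts mb mB. Proof. by move=> v; rewrite permE lftB. Qed.
Lemma acts_c : acts mc (mC 1). Proof. by move=> v; rewrite permE lftC. Qed.

Lemma acts_a2 : acts (ma ^+ 2)%g mA2.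
Proof. by apply: acts_cong (actsM acts_a acts_a) cert_A2. Qed.

Let G := grpOf {perm mX}.

Lemma actsZ (x : G) (f : int -> int * int * int -> int * int * int) m :
  (forall v, cong (f 0 v) v) -> (forall m n v, cong (f n (f m v)) (f (m + n) v)) ->
  acts x (f 1) -> acts (zpow x m) (f m).
Proof.
move=> f0 fD hx.
have hV : acts (ginv x) (f (-1)).
  move=> v; apply: (canLR (permK _)); rewrite hx.
  by rewrite (mpi_cong (fD _ _ _)) addNr (mpi_cong (f0 _)).
elim/int_rect: m => [|m IH|m IH].
- by rewrite gzpow0 => v; rewrite perm1; apply/esym/mpi_cong.
- rewrite -addn1 PoszD gzpowSzr.
  by apply: acts_cong (actsM IH hx) _ => v; apply: fD.
- rewrite -addn1 PoszD opprD gzpowD gzpowN1.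
  by apply: acts_cong (actsM IH hV) _ => v; apply: fD.
Qed.

Lemma acts_bb m : acts (@zpow G (mb * mb)%g m) (mB2 m).
Proof.
apply: actsZ.
- by move=> [[i j] k]; rewrite /cong /mB2 /= !mulr0 !mul0r !addr0 !subrr !dvdz0.
- exact: cert_B2m.
- by apply: acts_cong (actsM acts_b acts_b) cert_B2.
Qed.

Lemma acts_cz m : acts (@zpow G mc m) (mC m).
Proof.
apply: actsZ acts_c.
- by move=> [[i j] k]; rewrite /= addr0; apply: cong_refl.
- by move=> m' n [[i j] k]; rewrite /= addrA; apply: cong_refl.
Qed.

(** The exponents of b in the three extra relations are odd, so one application of b and a power of
    b^2 give them all. *)
Lemma acts_bodd m : acts (@zpow G mb (1 + 2 * m)) (fun v => mB2 m (mB v)).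
Proof.
rewrite gzpowD gzpow1 gzpowM (gzpowD _ 1 1) gzpow1.
exact: actsM acts_b (acts_bb m).
Qed.

Lemma model_rels4 beta : (5 <= beta)%N -> (2 ^ (beta - 2))%N = 8 * s :> int ->
  @rels4 G beta e1 e2 ma mb mc.
Proof.
move=> b5 ts.
have ts' : 2%:Z ^+ (beta - 2) = 8 * s by rewrite pow2_int.
split; [split | split; split].
- rewrite gpowE -[8%N]/(2 * 4)%N expgnA -[4%N]/(2 * 2)%N expgnA.
  have h4 : acts ((ma ^+ 2) ^+ 2)%g mA4 by apply: acts_cong (actsM acts_a2 acts_a2) cert_A4.
  exact: acts_eq (actsM h4 h4) acts1 cert_A8.
- have -> : (2 ^ beta)%N = (2 * `|(16 * s)%R|)%N by rewrite pow2_4t //; lia.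
  rewrite gpowM gpow2 -gzpow_gpow.
  apply: acts_eq (acts_bb _) acts1 _ => -[[i j] k]; apply/and3P; split; apply/dvdzP.
  + by exists 0; rewrite /= mul0r subrr.
  + by exists (1 + 4 * e2 * s * k); rewrite /= n3E; ring.
  + by exists (8 * s * k); rewrite /= n3E; ring.
- have -> : (2 ^ beta.-1)%N = n3 by rewrite pow2_2t // /n3; lia.
  rewrite -gzpow_gpow; apply: acts_eq (acts_cz _) acts1 _ => -[[i j] k].
  apply/and3P; split; apply/dvdzP; [exists 0 | exists 0 | exists 1] => /=; rewrite ?n3E; ring.
- rewrite gpow2; have h : acts (ma * mb)%g mAB := acts_cong (actsM acts_a acts_b) cert_AB.
  exact: acts_eq (actsM h h) acts1 cert_AB2.
- rewrite gpow2; have h := actsM acts_b acts_c.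
  exact: acts_eq (actsM h h) acts1 cert_BC2.
- rewrite gpow2; have h : acts (ma * mb)%g mAB := acts_cong (actsM acts_a acts_b) cert_AB.
  have h' := actsM h acts_c.
  exact: acts_eq (actsM h' h') acts1 cert_ABC2.
- rewrite ts' !zpowE gpowE.
  apply: (acts_eq (actsM acts_b acts_a2) (actsM acts_a2 _) cert_R1).
  rewrite (_ : 1 + e1 * (8 * s) = 1 + 2 * (4 * s * e1)); last by ring.
  exact: acts_bodd.
- rewrite ts' !zpowE -gzpowN1.
  rewrite (_ : 3 + e2 * (8 * s) = 1 + 2 * (1 + 4 * s * e2)); last by ring.
  exact: acts_eq (actsM (acts_cz _) acts_b) (actsM (acts_bodd _) (acts_cz _)) cert_R2.
- rewrite ts' !zpowE.
  have -> : @ginv G mb = @zpow G mb (1 + 2 * -1) by rewrite -gzpowN1.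
  rewrite (_ : -3 + e2 * (8 * s) = 1 + 2 * (-2 + 4 * s * e2)); last by ring.
  exact: acts_eq (actsM acts_c (acts_bodd _)) (actsM (acts_bodd _) (acts_cz _)) cert_R3.
Qed.

(** Starting at the origin, the correction terms of [mA] and [mB] vanish as long as the later
    coordinates are 0, so a^i b^j c^k leads to (i, j, k). The orbit of the origin is therefore
    everything, which bounds the order from below. *)
Lemma model_transitive (u : mX) : exists i j k : nat, (nform ma mb mc i j k) (mpi (0, 0, 0)) = u.
Proof.
exists u.1.1, u.1.2, u.2; rewrite -[RHS]mpiK /nform !permM.
have -> (i : nat) : (ma ^+ i)%g (mpi (0, 0, 0)) = mpi (Posz i, 0, 0).
  elim: i => [|i IH]; first by rewrite perm1.
  rewrite expgSr permM IH acts_a; congr mpi.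
  by rewrite -addn1 PoszD; congr (_, _, _); ring.
have -> i (j : nat) : (mb ^+ j)%g (mpi (i, 0, 0)) = mpi (i, Posz j, 0).
  elim: j => [|j IH]; first by rewrite perm1.
  rewrite expgSr permM IH acts_b; congr mpi.
  by rewrite -addn1 PoszD; congr (_, _, _); ring.
have -> i j (k : nat) : (mc ^+ k)%g (mpi (i, j, 0)) = mpi (i, j, Posz k).
  elim: k => [|k IH]; first by rewrite perm1.
  rewrite expgSr permM IH acts_c; congr mpi.
  by rewrite -addn1 PoszD.
by [].
Qed.

Lemma card_mX : #|mX| = (8 * n2 * n3)%N.
Proof. by rewrite !card_prod !card_ord. Qed.

End Model.

Lemma order_le_gpow (gT : finGroupType) (x : gT) n :
  0 < n -> @gpow (grpOf gT) x n = 1%g -> #[x]%g <= n.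
Proof. by move=> n0; rewrite gpowE => /eqP; rewrite -order_dvdn; apply: dvdn_leq. Qed.

Lemma order_rels4_le (gT : finGroupType) (a b c : gT) beta e1 e2 :
  @rels4 (grpOf gT) beta e1 e2 a b c ->
  [/\ #[a]%g <= 8, #[b]%g <= 2 ^ beta & #[c]%g <= 2 ^ beta.-1].
Proof. by move=> [[h1 h2 h3] _]; split; apply: order_le_gpow; rewrite ?expn_gt0. Qed.

Lemma leq_mul3_eq (p q r p' q' r' : nat) : 0 < p -> 0 < q -> 0 < r ->
  p <= p' -> q <= q' -> r <= r' -> p' * q' * r' <= p * q * r -> [/\ p = p', q = q' & r = r'].
Proof.
move=> p0 q0 r0 pp qq rr le; have p0' := leq_trans p0 pp; have q0' := leq_trans q0 qq.
have r0' := leq_trans r0 rr; split; apply/eqP; rewrite eqn_leq ?pp ?qq ?rr /=.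
- have := leq_trans le (leq_mul (leq_mul (leqnn p) qq) rr).
  by rewrite !leq_pmul2r.
- have := leq_trans le (leq_mul (leq_mul pp (leqnn q)) rr).
  by rewrite leq_pmul2r // leq_pmul2l.
- have := leq_trans le (leq_mul (leq_mul pp qq) (leqnn r)).
  by rewrite leq_pmul2l // muln_gt0 p0'.
Qed.

(** The orbit of the origin bounds the order from below by 8 * 4t * 2t, the normal form bounds it
    from above by the product of the orders of the generators, and those are at most 8, 4t and 2t.
    Hence equality holds throughout. *)
Lemma model_exists beta e1 e2 : 5 <= beta -> is_sign e1 -> is_sign e2 ->
  exists (gT : finGroupType) (a b c : gT),
    [/\ @rels4 (grpOf gT) beta e1 e2 a b c, [set: gT] = <<[set a; b; c]>>%g
      & [/\ #[a]%g = 8, #[b]%g = 2 ^ beta, #[c]%g = 2 ^ beta.-1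
          & #|gT| = 8 * 2 ^ beta * 2 ^ beta.-1]].
Proof.
move=> b5 s1 s2.
have [s [ts s0]] := pow2_8s b5.
have [d1 [dd1 E1]] : exists d : int, (d * d = - d /\ e1 = 1 + 2 * d)%R.
  by case/orP: s1 => /eqP ->; [exists 0%R | exists (-1)%R].
have [d2 [dd2 E2]] : exists d : int, (d * d = - d /\ e2 = 1 + 2 * d)%R.
  by case/orP: s2 => /eqP ->; [exists 0%R | exists (-1)%R].
have sp : (0 < Posz s)%R by [].
pose X := mX (Posz s); pose a : {perm X} := ma sp dd1 dd2; pose b : {perm X} := mb sp dd1 dd2; pose c : {perm X} := mc sp dd1 dd2.
have R4 : @rels4 (grpOf {perm X}) beta e1 e2 a b c.
  by rewrite E1 E2; apply: model_rels4 => //; rewrite ts PoszM.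
pose K := <<[set a; b; c]>>%G.
have KE := rels4_nform b5 s1 s2 R4.
have cardX : #|{: X}| = 8 * 2 ^ beta * 2 ^ beta.-1.
  rewrite card_mX pow2_4t // pow2_2t // ts; congr (_ * _ * _); lia.
have le1 : 8 * 2 ^ beta * 2 ^ beta.-1 <= #|K|.
  rewrite -cardX -cardsT; pose u0 : X := mpi sp (0, 0, 0)%R.
  have <- : [set (x : {perm X}) u0 | x in K] = [set: X].
    apply/setP => u; rewrite inE; apply/imsetP.
    have [i [j [k e]]] := model_transitive sp dd1 dd2 u.
    exists (nform a b c i j k); last by rewrite e.
    by rewrite /K /= KE; apply/nform_setP; exists i, j, k.
  exact: leq_imset_card.
have Ka : a \in K by rewrite mem_gen // !inE eqxx.
have Kb : b \in K by rewrite mem_gen // !inE eqxx orbT.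
have Kc : c \in K by rewrite mem_gen // !inE eqxx orbT.
(* The generated subgroup is turned into a group type of its own, so that the generators generate
   the whole type. *)
pose a' := subg K a; pose b' := subg K b; pose c' := subg K c.
have R4' : @rels4 (grpOf (subg_of K)) beta e1 e2 a' b' c'.
  pose R (x : grpOf {perm X}) (y : grpOf (subg_of K)) := sgval y = x.
  apply: (@rels4_transfer _ _ R _ _ _ a b c) R4; rewrite /R ?subgK //.
  - by move=> x y x' y' <- <-.
  - by move=> x x' <-.
  - by move=> x y y' <- e; apply: val_inj.
have gen : [set: subg_of K] = <<[set a'; b'; c']>>%g.
  apply/esym/eqP; rewrite -subTset (rels4_nform b5 s1 s2 R4'); apply/subsetP => y _.
  have : sgval y \in K by apply: subgP.
  rewrite /K /= KE => /nform_setP[i [j [k e]]].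
  have sX (x : {perm X}) n : x \in K -> sgval (subg K x ^+ n)%g = (x ^+ n)%g.
    move=> Kx; elim: n => // n IH; rewrite !expgS.
    transitivity (sgval (subg K x) * sgval (subg K x ^+ n))%g => //.
    by rewrite subgK // IH.
  apply/nform_setP; exists i, j, k; apply: val_inj.
  by rewrite [LHS]e /nform -!sX.
have [oa ob oc] := order_rels4_le R4'.
have le2 := card_nform_le a' b' c'; rewrite -(rels4_nform b5 s1 s2 R4') -gen in le2.
have cK : #|[set: subg_of K]| = #|K| by rewrite cardsT card_sub; apply: eq_card.
rewrite cK in le2.
have [ea eb ec] := leq_mul3_eq (order_gt0 a') (order_gt0 b') (order_gt0 c') oa ob oc (leq_trans le1 le2).
exists (subg_of K), a', b', c'; split => //; split => //.
rewrite -cardsT cK; apply/eqP; rewrite eqn_leq le1 andbT.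
by apply: leq_trans le2 _; rewrite ea eb ec.
Qed.

(** * Flags and automorphisms of 4-polytopes *)

Lemma imset_permM (T : finType) (x y : {perm T}) (A : {set T}) :
  (x * y)%g @: A = y @: (x @: A).
Proof. by rewrite -imset_comp; apply: eq_imset => z; rewrite permM. Qed.

Lemma imset_perm1 (T : finType) (A : {set T}) : (1%g : {perm T}) @: A = A.
Proof. by rewrite -[RHS]imset_id; apply: eq_imset => z; rewrite perm1. Qed.

Lemma imset_permK (T : finType) (x : {perm T}) (A : {set T}) : (x^-1)%g @: (x @: A) = A.
Proof. by rewrite -imset_permM mulgV imset_perm1. Qed.

Lemma imset_permKV (T : finType) (x : {perm T}) (A : {set T}) : x @: ((x^-1)%g @: A) = A.
Proof. by rewrite -imset_permM mulVg imset_perm1. Qed.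

Section Polytope4.
Variables (F : finType) (P : pstruct F).
Hypothesis HP : is_polytope P 4.
Local Notation r := (rk P).
Local Notation le := (ple P).
Implicit Types (A B C : {set F}) (x y z : F) (g : {perm F}) (i j : nat).

Lemma pt_refl x : le x x.
Proof. by case: HP => [[]]. Qed.

Lemma pt_anti x y : le x y -> le y x -> x = y.
Proof. by case: HP => [[_ h _] _]; apply: h. Qed.

Lemma pt_trans y x z : le x y -> le y z -> le x z.
Proof. by case: HP => [[_ _ h] _]; apply: h. Qed.

Lemma pt_rk x y : plt P x y -> r x < r y.
Proof. by case: HP => [_ [[_ _ h] _]]; apply: h. Qed.

Lemma pt_bot : exists2 m, r m = 0 & forall x, le m x.
Proof. by case: HP => [_ [[[m [h1 h2]] _ _] _]]; exists m. Qed.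

Lemma pt_top : exists2 m, r m = 5 & forall x, le x m.
Proof. by case: HP => [_ [[_ [m [h1 h2]] _] _]]; exists m. Qed.

Lemma pt_card A : is_flag P A -> #|A| = 6.
Proof. by case: HP => [_ [_ [h _ _]]]; apply: h. Qed.

Lemma pt_rk5 x : r x <= 5.
Proof.
have [m <- hm] := pt_top; have [->//|ne] := eqVneq x m.
by apply/ltnW/pt_rk; rewrite /plt hm.
Qed.

Lemma chainP A : reflect {in A &, forall x y, le x y || le y x} (is_chain P A).
Proof.
apply: (iffP forall_inP) => h x; first by move=> y /h/forall_inP; apply.
by move=> hx; apply/forall_inP => y; apply: h.
Qed.

Lemma chain_le A x y : is_chain P A -> x \in A -> y \in A -> r x <= r y -> le x y.
Proof.
move=> /chainP h hx hy hr; case/orP: (h _ _ hx hy) => // hyx.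
have [->|ne] := eqVneq y x; first exact: pt_refl.
by have := pt_rk (_ : plt P y x); rewrite /plt hyx ne ltnNge hr => /(_ isT).
Qed.

Lemma chain_rk_inj A : is_chain P A -> {in A &, injective r}.
Proof.
by move=> h x y hx hy e; apply: pt_anti; apply: (chain_le h); rewrite ?e.
Qed.

Lemma flag_chain A : is_flag P A -> is_chain P A.
Proof. by case/andP. Qed.

Lemma flag_rk_inj A : is_flag P A -> {in A &, injective r}.
Proof. by move/flag_chain/chain_rk_inj. Qed.

Let rkI x : 'I_6 := inord (r x).
Let rkIE x : rkI x = r x :> nat. Proof. by rewrite inordK // ltnS pt_rk5. Qed.

Lemma chain_card A : is_chain P A -> #|A| <= 6.
Proof.
move=> h; rewrite -(card_ord 6) -(card_in_imset (f := rkI)) ?max_card //.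
by move=> x y hx hy /(congr1 val); rewrite /= !rkIE; apply: (chain_rk_inj h).
Qed.

Lemma chain_flag A : is_chain P A -> #|A| = 6 -> is_flag P A.
Proof.
move=> h c; apply/andP; split=> //; apply/forallP => B; apply/implyP => /andP[hB sAB].
by rewrite eq_sym eqEcard sAB c chain_card.
Qed.

Lemma flag_rk A i : is_flag P A -> i < 6 -> exists2 x, x \in A & r x = i.
Proof.
move=> h hi; have : rkI @: A = setT.
  apply/eqP; rewrite eqEcard subsetT cardsT card_ord card_in_imset ?pt_card //.
  by move=> x y hx hy /(congr1 val); rewrite /= !rkIE; apply: (flag_rk_inj h).
move/setP => /(_ (Ordinal hi)); rewrite inE => /imsetP[x hx e]; exists x => //.
by rewrite -rkIE -e.
Qed.

Lemma flag_ext x y : le x y -> exists A, [/\ is_flag P A, x \in A & y \in A].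
Proof.
move=> hxy; pose S B := is_chain P B && ([set x; y] \subset B).
have h0 : S [set x; y].
  rewrite /S subxx andbT; apply/chainP => u v; rewrite !inE.
  by move=> /orP[]/eqP-> /orP[]/eqP->; rewrite ?pt_refl ?hxy ?orbT.
have [A /andP[hA sA] maxA] := arg_maxnP (fun B => #|B|) h0.
exists A; split; last first.
- by apply: (subsetP sA); rewrite !inE eqxx orbT.
- by apply: (subsetP sA); rewrite !inE eqxx.
rewrite /is_flag hA; apply/forallP => B; apply/implyP => /andP[hB sAB].
rewrite eq_sym eqEcard sAB; apply: maxA.
by rewrite /S hB (subset_trans sA).
Qed.

Lemma flag_of x : exists2 A, is_flag P A & x \in A.
Proof. by have [A []] := flag_ext (pt_refl x); exists A. Qed.

Lemma flag_exists : exists A, is_flag P A.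
Proof. by have [m _ _] := pt_bot; have [A] := flag_of m; exists A. Qed.

Lemma flag_max A x : is_flag P A -> {in A, forall y, le x y || le y x} -> x \in A.
Proof.
move=> /andP[hA /forallP/(_ (x |: A))/implyP h] hx.
have /eqP <- : x |: A == A; last by rewrite !inE eqxx.
apply: h; rewrite subsetUr andbT; apply/chainP => u v; rewrite !inE.
case/predU1P => [->|hu]; case/predU1P => [->|hv]; rewrite ?pt_refl //.
- exact: hx.
- by rewrite orbC; apply: hx.
- by move/chainP: hA; apply.
Qed.

Lemma adjflag_setD j A B : adjflag P j A B ->
  exists2 z, A :\: B = [set z] & r z = j.+1 /\ z \in A /\ z \notin B.
Proof.
case/and4P => _ _ /cards1P[z e] /forall_inP h; exists z => //.
have hz : z \in A :\: B by rewrite e inE.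
by move: (hz); rewrite inE => /andP[-> ->]; split=> //; apply/eqP/h.
Qed.

Lemma adjflag_flagl j A B : adjflag P j A B -> is_flag P A. Proof. by case/and4P. Qed.
Lemma adjflag_flagr j A B : adjflag P j A B -> is_flag P B. Proof. by case/and4P. Qed.

(** For j = 4 the exchanged face would be the greatest one, which lies in every flag. *)
Lemma adjflag_lt4 j A B : adjflag P j A B -> j < 4.
Proof.
move=> h; have [z _ [rz [hzA hzB]]] := adjflag_setD h.
have := pt_rk5 z; rewrite rz ltnS leq_eqVlt => /predU1P[e|//].
have [m rm hm] := pt_top; case/negP: hzB.
apply: flag_max (adjflag_flagr h) _ => y _.
by rewrite (flag_rk_inj (adjflag_flagl h) (y := m) hzA) ?hm ?orbT ?rz ?e ?rm //;
  apply: flag_max (adjflag_flagl h) _ => u _; rewrite hm orbT.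
Qed.

Lemma adjflag_mem j A B x : adjflag P j A B -> x \in A -> (x \in B) = (r x != j.+1).
Proof.
move=> h hx; have [z e [rz [hzA hzB]]] := adjflag_setD h.
have -> : (x \in B) = (x != z) by move/setP: e => /(_ x); rewrite !inE hx andbT => <-; rewrite negbK.
congr (~~ _); apply/eqP/eqP => [->//|e']; apply: (flag_rk_inj (adjflag_flagl h)) => //.
by rewrite e'.
Qed.

Lemma adjflag_sym j A B : adjflag P j A B -> adjflag P j B A.
Proof.
move=> h; have [fA fB] := (adjflag_flagl h, adjflag_flagr h).
have [z e [rz [hzA hzB]]] := adjflag_setD h.
have [w hw rw] : exists2 w, w \in B & r w = j.+1.
  by apply: flag_rk => //; have := adjflag_lt4 h; lia.
have eBA : B :\: A = [set w].
  apply/eqP; rewrite eq_sym eqEcard cards1 sub1set inE hw andbT; apply/andP; split.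
    by apply/negP => hwA; move: hw; rewrite (adjflag_mem h hwA) rw eqxx.
  have := cardsID A B; have := cardsID B A; rewrite setIC e cards1 (pt_card fA) (pt_card fB); lia.
by rewrite /adjflag fA fB eBA cards1 eqxx /=; apply/forall_inP => x /set1P ->; rewrite rw.
Qed.

Lemma flag_triple A j : is_flag P A -> j < 4 -> exists x y z,
  [/\ x \in A, y \in A & z \in A] /\ [/\ r x = j, r z = j.+1 & r y = j.+2] /\
  [/\ plt P x z, plt P z y & le x y].
Proof.
move=> fA j4; have [||x hx rx] := @flag_rk A j => //; first lia.
have [||z hz rz] := @flag_rk A j.+1 => //; first lia.
have [||y hy ry] := @flag_rk A j.+2 => //; exists x, y, z; split=> //; split=> //.
have cA := flag_chain fA; rewrite /plt.
have ne u v : r u < r v -> u != v by apply: contraTneq => ->; rewrite ltnn.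
by split; rewrite ?(chain_le cA) ?ne ?rx ?ry ?rz //; lia.
Qed.

(** Two different replacements for the face z of A would, together with z, be three faces strictly
    between two faces of a diamond. *)
Lemma adjflag_eq j A B B' : adjflag P j A B -> adjflag P j A B' -> B = B'.
Proof.
move=> h h'; have [fA fB] := (adjflag_flagl h, adjflag_flagr h).
have fB' := adjflag_flagr h'; have j4 := adjflag_lt4 h.
have [x [y [z [[hx hy hz] [[rx rz ry] [xz zy xy]]]]]] := flag_triple fA j4.
have dia : #|[set z | plt P x z && plt P z y]| = 2.
  by case: HP => [_ [_ [_ d _]]]; apply: d => //; rewrite ry rx.
have btw C : adjflag P j A C -> exists2 w, w \in C & [/\ r w = j.+1, w != z & plt P x w && plt P w y].
  move=> hC; have fC := adjflag_flagr hC; have [|w hw rw] := @flag_rk C j.+1 fC; first by clear -j4; lia.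
  exists w => //; split=> //.
    by apply: contraTneq hw => ->; rewrite (adjflag_mem hC hz) rz eqxx.
  have hxC : x \in C by rewrite (adjflag_mem hC hx) rx; clear; lia.
  have hyC : y \in C by rewrite (adjflag_mem hC hy) ry; clear; lia.
  have ne u v : r u < r v -> u != v by apply: contraTneq => ->; rewrite ltnn.
  by rewrite /plt !(chain_le (flag_chain fC)) ?ne ?rx ?ry ?rw //; clear; lia.
have [w hw [rw wz wb]] := btw _ h; have [w' hw' [rw' wz' wb']] := btw _ h'.
have ew : w = w'.
  apply/eqP; apply: contraT => ww'.
  have : z |: [set w; w'] \subset [set z | plt P x z && plt P z y].
    by apply/subsetP => u; rewrite !inE => /or3P[]/eqP-> //; rewrite xz.
  move/subset_leq_card; rewrite dia cardsU1 cards2 !inE.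
  by rewrite [z == w]eq_sym [z == w']eq_sym (negPf wz) (negPf wz') /= ww'.
suff sub C C' w1 : adjflag P j A C -> adjflag P j A C' -> w1 \in C -> w1 \in C' -> r w1 = j.+1 -> C \subset C'.
  by apply/eqP; rewrite eqEsubset (sub _ _ w) ?(sub _ _ w) // ew.
move=> hC hC' h1 h1' rw1; apply/subsetP => u hu.
have [ru|ru] := eqVneq (r u) j.+1.
  by rewrite (flag_rk_inj (adjflag_flagr hC) hu h1) // ru.
have huA : u \in A by rewrite (adjflag_mem (adjflag_sym hC) hu).
by rewrite (adjflag_mem hC' huA).
Qed.

Lemma adjflag_exists j A : is_flag P A -> j < 4 -> exists B, adjflag P j A B.
Proof.
move=> fA j4; have cA := flag_chain fA.
have [x [y [z [[hx hy hz] [[rx rz ry] [xz zy xy]]]]]] := flag_triple fA j4.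
have dia : #|[set z | plt P x z && plt P z y]| = 2.
  by case: HP => [_ [_ [_ d _]]]; apply: d => //; rewrite ry rx.
have /card_gt0P[w] : 0 < #|[set z | plt P x z && plt P z y] :\ z|.
  by have := cardsD1 z [set z | plt P x z && plt P z y]; rewrite dia inE xz zy; lia.
rewrite !inE => /and3P[wz xw wy].
have rw : r w = j.+1 by have := pt_rk xw; have := pt_rk wy; rewrite rx ry; clear; lia.
have wA : w \notin A by apply: contra wz => hw; apply/eqP/(flag_rk_inj fA); rewrite ?rw.
exists (w |: (A :\ z)); rewrite /adjflag fA /=.
have eD : A :\: (w |: A :\ z) = [set z].
  apply/setP => u; rewrite !inE; have [->|] := eqVneq u z; first by rewrite eq_sym (negPf wz) hz.
  by case: (u \in A); rewrite ?andbF ?orbT.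
rewrite eD cards1 eqxx /=; apply/andP; split; last by apply/forall_inP => u /set1P ->; rewrite rz.
apply: chain_flag; last first.
  by rewrite cardsU1 !inE (negPf wA) andbF /=; have := cardsD1 z A; rewrite hz pt_card //; lia.
have cmp u : u \in A -> u != z -> le u w || le w u.
  move=> hu uz; have : r u != j.+1 by apply: contra uz => /eqP e; apply/eqP/(flag_rk_inj fA); rewrite ?e.
  rewrite neq_ltn => /orP[ru|ru].
    have ux : le u x by apply: (chain_le cA) => //; rewrite rx.
    by rewrite (pt_trans ux) //; case/andP: xw.
  have yu : le y u by apply: (chain_le cA) => //; rewrite ry.
  by rewrite orbC (pt_trans _ yu) //; case/andP: wy.
apply/chainP => u v; rewrite !inE.
case/predU1P => [->|/andP[uz hu]]; case/predU1P => [->|/andP[vz hv]]; rewrite ?pt_refl //.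
- by rewrite orbC; apply: cmp.
- exact: cmp.
- by move/chainP: cA; apply.
Qed.

(** The flag written with superscript j in the definition of standard generators. The default [A] is
    not reached when [A] is a flag and j < 4. *)
Definition nb j A : {set F} := odflt A [pick B : {set F} | adjflag P j A B].

Lemma nbP j A : is_flag P A -> j < 4 -> adjflag P j A (nb j A).
Proof.
move=> fA j4; rewrite /nb; case: pickP => // h.
by have [B] := adjflag_exists fA j4; rewrite h.
Qed.

Lemma nb_eq j A B : adjflag P j A B -> B = nb j A.
Proof. by move=> h; apply: adjflag_eq h (nbP (adjflag_flagl h) (adjflag_lt4 h)). Qed.

Lemma nb_flag j A : is_flag P A -> j < 4 -> is_flag P (nb j A).
Proof. by move=> fA /(nbP fA)/adjflag_flagr. Qed.

Lemma nbK j A : is_flag P A -> j < 4 -> nb j (nb j A) = A.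
Proof. by move=> fA j4; apply/esym/nb_eq/adjflag_sym/nbP. Qed.

Lemma nb_mem j A x : is_flag P A -> j < 4 -> x \in A -> (x \in nb j A) = (r x != j.+1).
Proof. by move=> fA j4; apply: adjflag_mem; apply: nbP. Qed.

Lemma flag_bot A m : is_flag P A -> (forall x, le m x) -> m \in A.
Proof. by move=> fA hm; apply: flag_max fA _ => y _; rewrite hm. Qed.

Lemma adj_in_nb C A B : adj_in P C A B -> exists2 j, j < 4 & B = nb j A.
Proof.
case/and5P => fA fB _ _ c1; case/cards1P: (c1) => z ez.
have : z \in A :\: B by rewrite ez inE.
rewrite inE => /andP[zB zA].
have rz : 0 < r z.
  rewrite lt0n; apply/negP => /eqP e; have [m rm hm] := pt_bot; case/negP: zB.
  by rewrite (flag_rk_inj fA zA (flag_bot fA hm)) ?rm ?e // (flag_bot fB hm).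
have h : adjflag P (r z).-1 A B.
  rewrite /adjflag fA fB c1; apply/forall_inP => x; rewrite ez => /set1P ->.
  by rewrite prednK.
by exists (r z).-1; [exact: adjflag_lt4 h | exact: nb_eq].
Qed.

(** Strong flag connectedness as an induction principle. Every flag of a path from A to B contains
    the intersection of A and B, hence C; taking C to be a single face gives induction over the
    flags through that face. *)
Lemma flag_ind C (Q : {set F} -> Prop) A :
  is_flag P A -> C \subset A ->
  (forall B j, is_flag P B -> j < 4 -> C \subset B -> C \subset nb j B -> Q B -> Q (nb j B)) ->
  Q A -> forall B, is_flag P B -> C \subset B -> Q B.
Proof.
move=> fA sA step QA B fB sB.
have : connect (adj_in P (A :&: B)) A B by case: HP => [_ [_ [_ _ h]]]; apply: h.
have : C \subset A :&: B by rewrite subsetI sA.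
move: (A :&: B) => E sC /connectP[p].
elim: p A fA {sA} QA => [|D p IH] A fA QA /=; first by move=> _ ->.
case/andP => hAD pD eB; have [j j4 eD] := adj_in_nb hAD.
case/and5P: hAD => _ fD sEA sED _.
apply: (IH D) => //; rewrite eD; apply: step => //; first exact: subset_trans sEA.
by rewrite -eD; apply: subset_trans sED.
Qed.

Lemma flag_ind0 (Q : {set F} -> Prop) A :
  is_flag P A -> (forall B j, is_flag P B -> j < 4 -> Q B -> Q (nb j B)) ->
  Q A -> forall B, is_flag P B -> Q B.
Proof.
move=> fA step QA B fB; apply: (@flag_ind set0 Q A) => //; rewrite ?sub0set //.
by move=> D j fD j4 _ _; apply: step.
Qed.

Lemma PAutP g : reflect (forall x y, le (g x) (g y) = le x y) (g \in PAut P).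
Proof.
rewrite inE; apply: (iffP forallP) => h x; first by move=> y; have /forallP/(_ y)/eqP := h x.
by apply/forallP => y; rewrite h.
Qed.

Lemma PAut_group_set : group_set (PAut P).
Proof.
apply/group_setP; split; first by apply/PAutP => x y; rewrite !perm1.
by move=> g h /PAutP hg /PAutP hh; apply/PAutP => x y; rewrite !permM hh hg.
Qed.

Canonical PAut_group := Group PAut_group_set.

(** Members of [PAut] are only required to preserve the order. Climbing a flag shows that the rank
    cannot decrease, and the inverse gives the other inequality. *)
Lemma aut_rk g x : g \in PAut P -> r (g x) = r x.
Proof.
have key h y : h \in PAut P -> r y <= r (h y).
  move=> /PAutP hh; have [n] := ubnP (r y); elim: n y => // n IH y.
  case e : (r y) => [//|i] hi.
  have [A fA hy] := flag_of y.
  have [|x' hx' rx'] := @flag_rk A i fA; first by have := pt_rk5 y; rewrite e; apply: leqW.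
  have : plt P (h x') (h y).
    rewrite /plt hh (chain_le (flag_chain fA)) ?rx' ?e // (inj_eq perm_inj).
    by apply: contra_eq_neq e => <-; rewrite rx'; lia.
  by move/pt_rk; apply: leq_ltn_trans; rewrite -rx'; apply: IH; rewrite rx'.
move=> hg; apply/eqP; rewrite eqn_leq key // andbT.
by rewrite -{2}(permK g x); apply: key; rewrite groupV.
Qed.

Lemma aut_flag g A : g \in PAut P -> is_flag P A -> is_flag P (g @: A).
Proof.
move=> /PAutP hg fA; apply: chain_flag; last by rewrite card_imset ?pt_card //; apply: perm_inj.
apply/chainP => _ _ /imsetP[x hx ->] /imsetP[y hy ->]; rewrite !hg.
by move/chainP: (flag_chain fA); apply.
Qed.

Lemma aut_adj g j A B : g \in PAut P -> adjflag P j A B -> adjflag P j (g @: A) (g @: B).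
Proof.
move=> hg h; have [z e [rz _]] := adjflag_setD h.
have eD : g @: A :\: g @: B = [set g z].
  rewrite -imset_set1 -e; apply/setP => y; rewrite -(permKV g y) !inE.
  by rewrite !(mem_imset _ _ (@perm_inj _ g)) !inE.
rewrite /adjflag !aut_flag ?(adjflag_flagl h) ?(adjflag_flagr h) // eD cards1 eqxx.
by apply/forall_inP => x /set1P ->; rewrite aut_rk // rz.
Qed.

Lemma aut_nb g j A : g \in PAut P -> is_flag P A -> j < 4 -> g @: nb j A = nb j (g @: A).
Proof. by move=> hg fA j4; apply: nb_eq; apply: aut_adj => //; apply: nbP. Qed.

(** Automorphisms commute with adjacency, so a fixed flag makes all flags fixed; within a fixed flag
    the ranks single out the faces. *)
Lemma aut_free g A : g \in PAut P -> is_flag P A -> g @: A = A -> g = 1%g.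
Proof.
move=> hg fA eA; apply/permP => y; rewrite perm1.
have [B fB hy] := flag_of y.
have eB : g @: B = B.
  by apply: (@flag_ind0 (fun D => g @: D = D) A fA _ eA _ fB) => D j fD j4 eD; rewrite aut_nb // eD.
by apply: (flag_rk_inj fB) => //; [rewrite -eB imset_f | apply: aut_rk].
Qed.

Lemma aut_free2 g h A : g \in PAut P -> h \in PAut P -> is_flag P A -> g @: A = h @: A -> g = h.
Proof.
move=> hg hh fA e; apply/eqP; rewrite -(can_eq (mulgK (h^-1)%g)) mulgV; apply/eqP.
by apply: (@aut_free _ A) => //; rewrite ?groupM ?groupV // imset_permM e imset_permK.
Qed.

(** The image of a face y is the face of the same rank in [h A], for any flag A through y.
    Connectedness of the flags through y shows that the choice of A does not matter. *)
Lemma flag_map_aut (h : {set F} -> {set F}) :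
  (forall A, is_flag P A -> is_flag P (h A)) ->
  (forall A j, is_flag P A -> j < 4 -> h (nb j A) = nb j (h A)) ->
  exists2 g, g \in PAut P & forall A, is_flag P A -> g @: A = h A.
Proof.
move=> hf hn.
pose f y := odflt y [pick w | [exists A, [&& is_flag P A, y \in A, w \in h A & r w == r y]]].
have fE y A : is_flag P A -> y \in A -> f y \in h A /\ r (f y) = r y.
  move=> fA hy; rewrite /f; case: pickP => [w /existsP[A0 /and4P[fA0 hy0 hw /eqP rw]]|h0] /=; last first.
    have [|w hw rw] := @flag_rk (h A) (r y) (hf _ fA); first exact: pt_rk5.
    by have /existsP[] := negbT (h0 w); exists A; rewrite fA hy hw rw eqxx.
  split=> //; have sub B : y \in B -> [set y] \subset B by rewrite sub1set.
  apply: (@flag_ind [set y] (fun B => w \in h B) A0 fA0 (sub _ hy0) _ hw _ fA (sub _ hy)) => B j fB j4 yB yB' hB.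
  rewrite hn // nb_mem // ?hf // rw -(nb_mem fB j4) -?sub1set //.
have fA_eq A : is_flag P A -> f @: A = h A.
  move=> fA; apply/eqP; rewrite eqEcard; apply/andP; split.
    by apply/subsetP => _ /imsetP[y hy ->]; have [] := fE _ _ fA hy.
  rewrite card_in_imset ?pt_card ?hf // => x y hx hy e.
  apply: (flag_rk_inj fA) => //.
  by have [_ <-] := fE _ _ fA hx; have [_ <-] := fE _ _ fA hy; rewrite e.
have fle x y : le x y -> le (f x) (f y).
  move=> hxy; have [A [fA hx hy]] := flag_ext hxy.
  have [hfx rx] := fE _ _ fA hx; have [hfy ry] := fE _ _ fA hy.
  apply: (chain_le (flag_chain (hf _ fA))) => //; rewrite rx ry.
  by have [->//|ne] := eqVneq x y; apply/ltnW/pt_rk; rewrite /plt hxy.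
have f_surj : f @: setT = setT.
  apply/setP => y; rewrite inE; have [B fB hy] := flag_of y.
  have [A0 fA0] := flag_exists.
  have [A fA eA] : exists2 A, is_flag P A & h A = B.
    apply: (@flag_ind0 (fun B => exists2 A, is_flag P A & h A = B) _ (hf _ fA0) _ _ _ fB); last by exists A0.
    by move=> D j fD j4 [A fA <-]; exists (nb j A); rewrite ?nb_flag ?hn.
  by move: hy; rewrite -eA -fA_eq // => /imsetP[x _ ->]; apply: imset_f; rewrite inE.
have f_inj : injective f.
  have /imset_injP inj : #|f @: setT| == #|[set: F]| by rewrite f_surj.
  by move=> x y; apply: inj.
pose g := perm f_inj; exists g; last first.
  by move=> A fA; rewrite -fA_eq //; apply: eq_imset => x; rewrite permE.
apply/PAutP => x y; apply/idP/idP; last by rewrite !permE; apply: fle.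
(* The inverse of a permutation of finite order is one of its powers, so a permutation preserving
   the order also reflects it. *)
have gX n u v : le u v -> le ((g ^+ n)%g u) ((g ^+ n)%g v).
  elim: n u v => [|n IH] u v; first by rewrite !perm1.
  by move=> huv; rewrite !expgS !permM; apply: IH; rewrite !permE; apply: fle.
by move/(gX #[g]%g.-1); rewrite -!permM -expgS prednK ?order_gt0 // expg_order !perm1.
Qed.

End Polytope4.

(** * Standard generators and chirality *)

(** The index 1 represents all four: by [std_nb] below, standard generators carry the 1-adjacent
    flag of [Phi] to every other adjacent one. *)
Definition reflexible (F : finType) (P : pstruct F) (Phi : {set F}) : Prop :=
  exists2 g, g \in PAut P & g @: Phi = nb P 1 Phi.

Lemma same_orbitP (F : finType) (P : pstruct F) (A B : {set F}) : reflect (exists2 g, g \in PAut P & g @: A = B) (same_orbit P A B).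
Proof.
by apply: (iffP exists_inP) => -[g hg]; [move/eqP | move/eqP]; exists g.
Qed.

Section StandardGenerators.
Variables (F : finType) (P : pstruct F).
Hypothesis HP : is_polytope P 4.
Local Notation r := (rk P).
Local Notation le := (ple P).
Local Notation nb := (nb P).
Variables (Phi : {set F}) (s1 s2 s3 : {perm F}).
Hypotheses (fPhi : is_flag P Phi) (std : std_gens P Phi s1 s2 s3).

Let K := <<[set s1; s2; s3]>>%G.

Lemma std_aut : [/\ s1 \in PAut P, s2 \in PAut P & s3 \in PAut P].
Proof. by case: std. Qed.

Lemma std_s1 : s1 @: Phi = nb 0 (nb 1 Phi).
Proof. by case: std => _ [[A /andP[/(nb_eq HP) <- /(nb_eq HP)]]]. Qed.
Lemma std_s2 : s2 @: Phi = nb 1 (nb 2 Phi).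
Proof. by case: std => _ [_ [A /andP[/(nb_eq HP) <- /(nb_eq HP)]]]. Qed.
Lemma std_s3 : s3 @: Phi = nb 2 (nb 3 Phi).
Proof. by case: std => _ [_ _ [A /andP[/(nb_eq HP) <- /(nb_eq HP)]]]. Qed.

(** In the regular case, with reflections r0, ..., r3, this element is r1 r_j. It carries the
    1-adjacent flag to the j-adjacent one, which lets all j be treated uniformly. *)
Definition std_g (j : nat) : {perm F} := nth 1%g [:: (s1^-1)%g; 1%g; s2; (s2 * s3)%g] j.

Lemma std_gK j : std_g j \in K.
Proof.
have h1 : s1 \in K by rewrite mem_gen // !inE eqxx.
have h2 : s2 \in K by rewrite mem_gen // !inE eqxx orbT.
have h3 : s3 \in K by rewrite mem_gen // !inE eqxx orbT.
by case: j => [|[|[|[|j]]]]; rewrite /std_g /= ?groupV ?group1 ?groupM // nth_nil group1.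
Qed.

Lemma std_K_aut : K \subset PAut P.
Proof.
have [h1 h2 h3] := std_aut.
rewrite -[PAut P]/(gval (PAut_group P)) gen_subG; apply/subsetP => x.
by rewrite !inE -orbA => /or3P[]/eqP->; move: h1 h2 h3; rewrite !inE.
Qed.

Let Kaut x : x \in K -> x \in PAut P. Proof. exact: (subsetP std_K_aut). Qed.

Lemma std_nb j : j < 4 -> nb j Phi = std_g j @: nb 1 Phi.
Proof.
have [h1 h2 h3] := std_aut.
have e2 : nb 2 Phi = s2 @: nb 1 Phi.
  by rewrite aut_nb // std_s2 nbK ?nb_flag.
case: j => [|[|[|[|//]]]] _.
- have h1' : (s1^-1)%g \in PAut P by rewrite groupV.
  rewrite /std_g /= aut_nb // -{1}(imset_permK s1 Phi) std_s1 !aut_nb ?nb_flag //.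
  by rewrite nbK ?nb_flag ?aut_flag.
- by rewrite imset_perm1.
- exact: e2.
- rewrite /std_g /= imset_permM -e2 aut_nb // std_s3 nbK ?nb_flag //.
Qed.

Lemma std_nb1 j : j < 4 -> nb j (nb 1 Phi) = (std_g j)^-1%g @: Phi.
Proof.
move=> j4; rewrite -{2}(nbK HP fPhi j4) (std_nb j4) -aut_nb ?nb_flag //; last exact/Kaut/std_gK.
by rewrite imset_permK.
Qed.

(** The two orbits are together closed under adjacency: each step multiplies by [std_g j] or its
    inverse and passes to the other orbit. *)
Lemma std_orbits B : is_flag P B ->
  exists2 x, x \in K & B = x @: Phi \/ B = x @: nb 1 Phi.
Proof.
apply: (@flag_ind0 _ _ HP (fun B => exists2 x, x \in K & B = x @: Phi \/ B = x @: nb 1 Phi) Phi) => //.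
  move=> {}B j fB j4 [x Kx [->|->]].
    exists (std_g j * x)%g; first by rewrite groupM ?std_gK.
    by right; rewrite -aut_nb ?Kaut // std_nb // imset_permM.
  exists ((std_g j)^-1 * x)%g; first by rewrite groupM ?groupV ?std_gK.
  by left; rewrite -aut_nb ?nb_flag ?Kaut // std_nb1 // imset_permM.
by exists 1%g; rewrite ?group1 // imset_perm1; left.
Qed.

(** Both sides send [Phi] to the same flag, and automorphisms are determined by the image of one
    flag. *)
Lemma std_reflect g j : g \in PAut P -> g @: Phi = nb 1 Phi -> j < 4 ->
  (std_g j ^ g = (std_g j)^-1)%g.
Proof.
move=> hg eg j4; have Kj := Kaut (std_gK j).
apply: (aut_free2 HP (A := Phi)) => //; rewrite ?groupV ?groupJ //.
have eg' : (g^-1)%g @: Phi = nb 1 Phi.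
  by rewrite -{1}(nbK HP fPhi (isT : 1 < 4)) -eg aut_nb ?aut_flag ?groupV // imset_permK.
by rewrite /conjg !imset_permM eg' -std_nb // aut_nb // eg std_nb1.
Qed.

Hypothesis nrefl : ~ reflexible P Phi.

Lemma std_full : PAut P = K.
Proof.
apply/eqP; rewrite eqEsubset std_K_aut andbT; apply/subsetP => g hg.
have [x Kx [e|e]] := std_orbits (aut_flag HP hg fPhi).
  by rewrite (aut_free2 HP hg (Kaut Kx) fPhi e).
case: nrefl; exists (g * x^-1)%g; first by rewrite groupM ?groupV // Kaut.
by rewrite imset_permM e imset_permK.
Qed.

Lemma std_not_nb j x : j < 4 -> x \in PAut P -> x @: Phi <> nb j Phi.
Proof.
move=> j4 hx e; apply: nrefl; exists (x * (std_g j)^-1)%g.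
  by rewrite groupM ?groupV // Kaut ?std_gK.
by rewrite imset_permM e std_nb // imset_permK.
Qed.

Lemma std_chiral : chiral P.
Proof.
split.
  exists Phi, (nb 1 Phi); split; rewrite ?nb_flag // => C /std_orbits[x Kx [->|->]].
    by left; apply/same_orbitP; exists x => //; apply: Kaut.
  by right; apply/same_orbitP; exists x => //; apply: Kaut.
move=> j A B hAB; have j4 := adjflag_lt4 HP hAB.
have [fA eB] := (adjflag_flagl hAB, nb_eq HP hAB); apply/same_orbitP => -[g hg eg].
have [x Kx [e|e]] := std_orbits fA; move: eg; rewrite eB e -aut_nb ?nb_flag ?Kaut // => eg.
  apply: (@std_not_nb j (x * g * x^-1)%g) => //; first by rewrite !groupM ?groupV // Kaut.
  by rewrite !imset_permM eg imset_permK.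
have e' : (x * g * x^-1)%g @: nb 1 Phi = (std_g j)^-1%g @: Phi.
  by rewrite !imset_permM eg imset_permK std_nb1.
apply: (@std_not_nb 1 (((x * g * x^-1) * std_g j)^-1)%g) => //.
  by rewrite groupV !groupM ?groupV // Kaut // std_gK.
have e'' : (x * g * x^-1 * std_g j)%g @: nb 1 Phi = Phi.
  by rewrite imset_permM e' imset_permKV.
by rewrite -[in LHS]e'' imset_permK.
Qed.

Lemma std_card_flags : #|flags P| = 2 * #|PAut P|.
Proof.
pose f (u : {perm F} * bool) := u.1 @: (if u.2 then Phi else nb 1 Phi).
have -> : flags P = f @: setX (PAut P) [set: bool].
  apply/setP => B; rewrite inE; apply/idP/imsetP.
    move=> /std_orbits[x Kx [->|->]].
      by exists (x, true) => //; rewrite in_setX in_setT andbT; apply: Kaut.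
    by exists (x, false) => //; rewrite in_setX in_setT andbT; apply: Kaut.
  move=> [[x [|]]]; rewrite in_setX in_setT andbT /= => hx ->; apply: aut_flag => //.
  by rewrite nb_flag.
rewrite card_in_imset; first by rewrite cardsX cardsT card_bool mulnC.
have no x y : x \in PAut P -> y \in PAut P -> x @: Phi = y @: nb 1 Phi -> False.
  move=> hx hy e; apply: (@std_not_nb 1 (x * y^-1)%g) => //; first by rewrite groupM ?groupV.
  by rewrite imset_permM e imset_permK.
move=> [x u] [y v]; rewrite !in_setX !in_setT !andbT /= => hx' hy'.
case: u; case: v; rewrite /f /= => e.
- by rewrite (aut_free2 HP hx' hy' fPhi e).
- by case: (no _ _ hx' hy' e).
- by case: (no _ _ hy' hx' (esym e)).
- by rewrite (aut_free2 HP hx' hy' _ e) // nb_flag.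
Qed.

(** The powers of s send the face z of [Phi] to distinct faces of a p-gon: a power fixing z fixes
    all but one face of [Phi], hence maps [Phi] to itself or to an adjacent flag, and the latter is
    excluded. *)
Lemma std_order j s p : 1 <= j <= 3 -> s \in PAut P -> s @: Phi = nb j.-1 (nb j Phi) ->
  (forall x y, le x y -> r x = j.-1 -> r y = j + 2 ->
     #|[set z | [&& plt P x z, plt P z y & r z == j.+1]]| = p) -> #[s]%g <= p.
Proof.
case: j => // j /andP[_ j3] /= hs es type.
have cPhi := flag_chain fPhi.
have [j3' j4] : j.+1 < 4 /\ j < 4 by split=> //; apply: leqW.
have [|u hu ru] := @flag_rk _ _ HP Phi j fPhi; first by clear -j3; lia.
have [|v hv rv] := @flag_rk _ _ HP Phi j.+3 fPhi; first by clear -j3; lia.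
have [|z hz rz] := @flag_rk _ _ HP Phi j.+2 fPhi; first by clear -j3; lia.
have ne a b : r a < r b -> a != b by apply: contraTneq => ->; rewrite ltnn.
have fixs x : x \in Phi -> r x != j.+1 -> r x != j.+2 -> s x = x.
  move=> hx n1 n2; apply: (@flag_rk_inj _ _ HP (s @: Phi)); rewrite ?aut_flag ?aut_rk ?imset_f //.
  by rewrite es nb_mem ?nb_flag // nb_mem.
have fixX n x : x \in Phi -> r x != j.+1 -> r x != j.+2 -> (s ^+ n)%g x = x.
  by move=> hx n1 n2; elim: n => [|n IH]; rewrite ?perm1 // expgSr permM IH fixs.
have su : r u != j.+1 /\ r u != j.+2 by rewrite ru; clear; lia.
have sv : r v != j.+1 /\ r v != j.+2 by rewrite rv; clear; lia.
have le_uv : le u v by apply: (chain_le HP cPhi) => //; rewrite ru rv; clear; lia.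
have <- := type u v le_uv ru (etrans rv _); last by rewrite addnC.
have inj : {in <[s]>%g &, injective (fun x : {perm F} => x z)}.
  move=> x y /cycleP[n ->] /cycleP[m ->] e.
  have [w [sw ew wz]] : exists w : {perm F}, [/\ w \in <[s]>%g, (w * s ^+ m = s ^+ n)%g & w z = z].
    exists (s ^+ n * (s ^+ m)^-1)%g; split; rewrite ?mulgKV ?groupM ?groupV ?mem_cycle //.
    by rewrite permM e permK.
  rewrite -ew; suff -> : w = 1%g by rewrite mul1g.
  have /cycleP[k ek] := sw.
  have hw : w \in PAut P by rewrite ek groupX.
  have fw x' : x' \in Phi -> r x' != j.+1 -> w x' = x'.
    move=> hx' n1; have [e2|n2] := eqVneq (r x') j.+2; last by rewrite ek fixX.
    by rewrite (flag_rk_inj HP fPhi hx' hz) // e2 rz.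
  have [eq|neq] := eqVneq (w @: Phi) Phi; first exact: (aut_free HP hw fPhi eq).
  case: (@std_not_nb j w) => //; apply: (nb_eq HP); rewrite /adjflag fPhi aut_flag //=.
  have [|t ht rt] := @flag_rk _ _ HP Phi j.+1 fPhi; first by clear -j3; lia.
  have sub : Phi :\: w @: Phi \subset [set t].
    apply/subsetP => x'; rewrite !inE => /andP[nx hx']; apply/eqP/(flag_rk_inj HP fPhi) => //.
    by rewrite rt; apply/eqP; apply: contraNT nx => n1; rewrite -(fw _ hx' n1) imset_f.
  have -> : Phi :\: w @: Phi = [set t].
    apply/eqP; rewrite eqEcard sub cards1 lt0n cards_eq0 setD_eq0.
    by apply: contra neq => sP; rewrite eq_sym eqEcard sP (pt_card HP fPhi) (pt_card HP (aut_flag HP hw fPhi)).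
  by rewrite cards1 eqxx; apply/forall_inP => x' /set1P ->; rewrite rt.
rewrite /order -(card_in_imset inj); apply/subset_leq_card/subsetP => _ /imsetP[x /cycleP[n ->] ->].
have hX : (s ^+ n)%g \in PAut P by rewrite groupX.
rewrite inE aut_rk // rz eqxx andbT /plt.
rewrite -{1 2}(fixX n u hu su.1 su.2) -{1 2}(fixX n v hv sv.1 sv.2).
have /PAutP hX' := hX; rewrite !hX' !(inj_eq perm_inj) !ne ?ru ?rv ?rz //.
have -> : le u z by apply: (chain_le HP cPhi) => //; rewrite ru rz; clear; lia.
by have -> : le z v by apply: (chain_le HP cPhi) => //; rewrite rz rv.
Qed.

End StandardGenerators.

Section ChiralStandard.
Variables (F : finType) (P : pstruct F).
Hypotheses (HP : is_polytope P 4) (ch : chiral P).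

Lemma chiral_not_reflexible A : is_flag P A -> ~ reflexible P A.
Proof.
move=> fA [g hg e]; case: ch => _ /(_ 1 A (nb P 1 A) (nbP HP fA (isT : 1 < 4)))/negP; apply.
by apply/same_orbitP; exists g.
Qed.

Lemma chiral_even j i A : is_flag P A -> j < 4 -> i < 4 ->
  exists2 g, g \in PAut P & g @: A = nb P i (nb P j A).
Proof.
move=> fA j4 i4; case: ch => [[A0 [B0 [_ _ orb]]] na].
have fB := nb_flag HP fA j4; have fC := nb_flag HP fB i4.
have n1 := na _ _ _ (nbP HP fA j4); have n2 := na _ _ _ (nbP HP fB i4).
apply/same_orbitP; move: fB fC n1 n2; set B := nb P j A; set C := nb P i B => fB fC n1 n2.
have tr X Y Z : same_orbit P X Y -> same_orbit P X Z -> same_orbit P Y Z.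
  move=> /same_orbitP[g hg <-] /same_orbitP[h hh <-]; apply/same_orbitP.
  by exists (g^-1 * h)%g; rewrite ?groupM ?groupV // imset_permM imset_permK.
have [oA|oA] := orb _ fA; have [oB|oB] := orb _ fB; have [oC|oC] := orb _ fC;
  do [exact: tr oA oC | by rewrite (tr _ _ _ oA oB) in n1 | by rewrite (tr _ _ _ oB oC) in n2].
Qed.

Lemma chiral_std_gens A : is_flag P A -> exists s1 s2 s3, std_gens P A s1 s2 s3.
Proof.
move=> fA.
have [s1 h1 e1] := @chiral_even 1 0 A fA isT isT.
have [s2 h2 e2] := @chiral_even 2 1 A fA isT isT.
have [s3 h3 e3] := @chiral_even 3 2 A fA isT isT.
exists s1, s2, s3; split=> //; split.
- by exists (nb P 1 A); rewrite e1 !nbP ?nb_flag.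
- by exists (nb P 2 A); rewrite e2 !nbP ?nb_flag.
- by exists (nb P 3 A); rewrite e3 !nbP ?nb_flag.
Qed.

End ChiralStandard.

(** * Tight posets *)

Section TightPoset.
Variables (F : finType) (rk : F -> nat) (inc : rel F) (deg : nat -> nat).
Implicit Types (x y w v e f c : F) (A B D : {set F}) (i j k : nat).

(** The section is the cycle z' 0, z 0, z' 1, z 1, ... with natural indices read modulo [deg j],
    which spares a separate clause for closing the cycle. *)
Definition polygon j x y (z z' : nat -> F) :=
  [/\ forall i, [/\ rk (z i) = j, inc x (z i), rk (z' i) = j.+1 & inc (z' i) y],
      forall w, rk w = j -> inc x w -> exists i, w = z i,
      forall w, rk w = j.+1 -> inc w y -> exists i, w = z' i &
      [/\ forall i k, inc (z i) (z' k) <-> k = i %[mod deg j] \/ k = i.+1 %[mod deg j],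
          forall i k, z i = z k <-> i = k %[mod deg j] &
          forall i k, z' i = z' k <-> i = k %[mod deg j]]].

Variables bot top : F.
Hypotheses (rk_bot : forall x, rk x = 0 <-> x = bot)
  (rk_top : forall x, rk x = 5 <-> x = top) (rk_le5 : forall x, rk x <= 5).
Hypotheses (inc_bot : forall x, rk x = 1 -> inc bot x)
  (inc_top : forall x, rk x = 4 -> inc x top).
Hypothesis rk_ex : forall i, i <= 5 -> exists x, rk x = i.
Hypothesis inc_down : forall y i, rk y = i.+1 -> exists2 x, rk x = i & inc x y.
Hypothesis inc_up : forall x i, i < 5 -> rk x = i -> exists2 y, rk y = i.+1 & inc x y.
Hypothesis deg_gt1 : forall j, 0 < j < 4 -> 1 < deg j.
Hypothesis polyP : forall j x y, 0 < j < 4 -> rk x = j.-1 -> rk y = j.+2 ->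
  exists z z', polygon j x y z z'.

(* In a tight polytope any two faces whose ranks differ by at least two are
   incident, so the order is determined by consecutive ranks. *)
Definition tle x y := (x == y) || (rk x < rk y) && (((rk x).+1 < rk y) || inc x y).

Definition tight_pstruct : pstruct F := PStruct rk tle.
Local Notation P := tight_pstruct.

Lemma tltE x y : plt P x y = (rk x < rk y) && (((rk x).+1 < rk y) || inc x y).
Proof.
by rewrite /plt /= /tle; have [->|] := eqVneq x y; rewrite ?ltnn ?andbF ?andbT.
Qed.

Lemma tle_lt x y : (rk x).+1 < rk y -> tle x y.
Proof. by move=> h; rewrite /tle h (ltnW h) orbT. Qed.

Lemma tle_inc x y : rk y = (rk x).+1 -> tle x y = inc x y.
Proof.
move=> h; rewrite /tle h ltnSn ltnn /=; have [e|//] := eqVneq x y.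
by move: h; rewrite e => /eqP; rewrite (ltn_eqF (ltnSn _)).
Qed.

Lemma tlt_inc x y : rk y = (rk x).+1 -> plt P x y = inc x y.
Proof. by move=> h; rewrite tltE h ltnSn ltnn. Qed.

Lemma tlt_lt x y : (rk x).+1 < rk y -> plt P x y.
Proof. by move=> h; rewrite tltE h (ltnW h). Qed.

Lemma tle_rk x y : tle x y -> x = y \/ rk x < rk y.
Proof. by case/orP => [/eqP|/andP[]]; [left | right]. Qed.

Lemma tle_trans x y (z : F) : tle x y -> tle y z -> tle x z.
Proof.
move=> /[dup] hxy /tle_rk[->//|h1] /[dup] hyz /tle_rk[<-//|h2].
by apply: tle_lt; apply: leq_ltn_trans h1 h2.
Qed.

Lemma tle_anti x y : tle x y -> tle y x -> x = y.
Proof.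
move=> /tle_rk[//|h1] /tle_rk[//|h2].
by have := ltn_trans h1 h2; rewrite ltnn.
Qed.

Lemma tle_bot x : tle bot x.
Proof.
have rb : rk bot = 0 by apply/rk_bot.
case e : (rk x) => [|[|i]].
- by move/rk_bot: e => ->; rewrite /tle eqxx.
- by rewrite tle_inc ?rb //; apply: inc_bot.
- by apply: tle_lt; rewrite rb e.
Qed.

Lemma tle_top x : tle x top.
Proof.
have rt : rk top = 5 by apply/rk_top.
have := rk_le5 x; rewrite leq_eqVlt => /predU1P[/rk_top ->|]; first by rewrite /tle eqxx.
rewrite ltnS leq_eqVlt => /predU1P[e|e]; first by rewrite tle_inc ?rt ?e //; apply: inc_top.
by apply: tle_lt; rewrite rt.
Qed.

Lemma polygon_lower j x y z z' w' : 0 < j < 4 -> polygon j x y z z' ->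
  rk w' = j.+1 -> inc w' y ->
  exists w1 w2, [/\ rk w1 = j, rk w2 = j & w1 != w2] /\ forall w, rk w = j ->
    inc x w && inc w w' = (w == w1) || (w == w2).
Proof.
move=> hj [h1 h2 h3 [h4 h5 h6]] rw iw; have [k ek] := h3 _ rw iw.
have d1 := deg_gt1 hj.
have dE : (deg j).-1.+1 = deg j by rewrite prednK // (ltn_trans _ d1).
(* The second index stands for k - 1 modulo [deg j]. *)
exists (z k), (z (k + (deg j).-1)); split.
  split; [by have [] := h1 k | by have [] := h1 (k + (deg j).-1) |].
  apply/eqP => /h5/eqP; rewrite -{1}(addn0 k) eqn_modDl mod0n modn_small; last by rewrite dE.
  by move: d1; case: (deg j) => [|[]].
move=> w rw'; apply/andP/orP.
  move=> [ix iww]; have [i ei] := h2 _ rw' ix.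
  move: iww; rewrite ei ek => /h4[e|e]; [left | right]; apply/eqP/h5 => //.
  rewrite -modnDml e modnDml addSn -addnS dE modnDr //.
case=> /eqP ->; have [_ hx _ _] := h1 k; have [_ hx' _ _] := h1 (k + (deg j).-1).
  by split=> //; rewrite ek; apply/h4; left.
by split=> //; rewrite ek; apply/h4; right; rewrite -addnS dE modnDr.
Qed.

Lemma polygon_upper j x y z z' w : 0 < j < 4 -> polygon j x y z z' ->
  rk w = j -> inc x w ->
  exists w1 w2, [/\ rk w1 = j.+1, rk w2 = j.+1 & w1 != w2] /\ forall w', rk w' = j.+1 ->
    inc w w' && inc w' y = (w' == w1) || (w' == w2).
Proof.
move=> hj [h1 h2 h3 [h4 h5 h6]] rw iw; have [k ek] := h2 _ rw iw.
have d1 := deg_gt1 hj.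
exists (z' k), (z' k.+1); split.
  split; [by have [] := h1 k | by have [] := h1 k.+1 |].
  apply/eqP => /h6/eqP; rewrite -{1}(addn0 k) -addn1 eqn_modDl mod0n modn_small //.
move=> w' rw'; apply/andP/orP.
  move=> [iww iy]; have [i ei] := h3 _ rw' iy.
  by move: iww; rewrite ei ek => /h4[e|e]; [left | right]; apply/eqP/h6.
case=> /eqP ->; have [_ _ _ hy] := h1 k; have [_ _ _ hy'] := h1 k.+1.
  by split=> //; rewrite ek; apply/h4; left.
by split=> //; rewrite ek; apply/h4; right.
Qed.

(** Extending the interval by one rank, downwards or upwards, gives a polygon; the two middle faces
    are the neighbours of one of its vertices or edges. *)
Lemma tight_diamond i x y : 0 < i < 5 -> rk x = i.-1 -> rk y = i.+1 ->
  exists w1 w2, [/\ rk w1 = i, rk w2 = i & w1 != w2] /\ forall w, rk w = i ->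
    inc x w && inc w y = (w == w1) || (w == w2).
Proof.
case: i => [|[|[|[|[|//]]]]] // _ /= rx ry.
- have [f rf yf] := inc_up (isT : 2 < 5) ry.
  have [z [z' hp]] := @polyP 1 x f isT rx rf.
  exact: (polygon_lower (isT : 0 < 1 < 4) hp ry yf).
- have rb : rk bot = 0 by apply/rk_bot.
  have [z [z' hp]] := @polyP 1 bot y isT rb ry.
  exact: (polygon_upper (isT : 0 < 1 < 4) hp rx (inc_bot rx)).
- have rt : rk top = 5 by apply/rk_top.
  have [z [z' hp]] := @polyP 3 x top isT rx rt.
  exact: (polygon_lower (isT : 0 < 3 < 4) hp ry (inc_top ry)).
- have [e re ex] := inc_down rx.
  have [z [z' hp]] := @polyP 3 e y isT re ry.
  exact: (polygon_upper (isT : 0 < 3 < 4) hp rx ex).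
Qed.

Lemma tight_between i x y : 0 < i < 5 -> rk x = i.-1 -> rk y = i.+1 ->
  exists w, [/\ rk w = i, inc x w & inc w y].
Proof.
case: i => [|[|[|[|[|//]]]]] // _ /= rx ry.
- have [w rw wy] := inc_down ry; exists w; split=> //.
  by move/rk_bot: rx => ->; apply: inc_bot.
- have rb : rk bot = 0 by apply/rk_bot.
  have [z [z' [h1 h2 h3 [h4 _ _]]]] := @polyP 1 bot y isT rb ry.
  have [k ek] := h2 _ rx (inc_bot rx); have [_ _ r' iy] := h1 k.
  by exists (z' k); split=> //; rewrite ek; apply/h4; left.
- have rt : rk top = 5 by apply/rk_top.
  have [z [z' [h1 h2 h3 [h4 _ _]]]] := @polyP 3 x top isT rx rt.
  have [k ek] := h3 _ ry (inc_top ry); have [r' ix _ _] := h1 k.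
  by exists (z k); split=> //; rewrite ek; apply/h4; left.
- have [w rw xw] := inc_up (isT : 3 < 5) rx; exists w; split=> //.
  by move/rk_top: ry => ->; apply: inc_top.
Qed.

Lemma tight_diamond_card x y : tle x y -> rk y = (rk x).+2 ->
  #|[set z | plt P x z && plt P z y]| = 2.
Proof.
move=> _ ry; have hi : 0 < (rk x).+1 < 5 by have := rk_le5 y; rewrite ry.
have [w1 [w2 [[r1 r2 ne] h]]] := @tight_diamond (rk x).+1 x y hi erefl ry.
suff -> : [set z | plt P x z && plt P z y] = [set w1; w2] by rewrite cards2 ne.
apply/setP => w; rewrite !inE; have [rw|nr] := eqVneq (rk w) (rk x).+1.
  by rewrite !tlt_inc ?rw // h.
transitivity false.
  apply: contraNF nr; rewrite !tltE ry => /andP[/andP[h1 _] /andP[h2 _]].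
  by rewrite eqn_leq h1 -ltnS h2.
by apply/esym; apply: contraNF nr => /orP[]/eqP->; apply/eqP.
Qed.

Lemma tight_chain_rk A : is_chain P A -> {in A &, injective rk}.
Proof.
move=> /forall_inP hA x y hx hy e; have /forall_inP/(_ y hy) := hA x hx.
by case/orP => /tle_rk[//|]; rewrite e ltnn.
Qed.

Lemma tight_flag_max A x : is_flag P A -> {in A, forall y, tle x y || tle y x} -> x \in A.
Proof.
move=> /andP[hA /forallP/(_ (x |: A))/implyP h] hx.
have /eqP <- : x |: A == A; last by rewrite !inE eqxx.
apply: h; rewrite subsetUr andbT; apply/forall_inP => u hu; apply/forall_inP => v hv.
move: hu hv; rewrite !inE.
case/predU1P => [->|hu]; case/predU1P => [->|hv]; rewrite /= ?[tle x x]/tle ?eqxx //.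
- exact: hx.
- by rewrite orbC; apply: hx.
- by move/forall_inP: hA => /(_ u hu)/forall_inP/(_ v hv).
Qed.

(** If rank i were missing, a face of rank i between the members of ranks i - 1 and i + 1 would be
    comparable with all of A, against maximality. Where such a member is missing too, any face of
    its rank serves. *)
Lemma tight_flag_rk A i : is_flag P A -> i <= 5 -> exists2 x, x \in A & rk x = i.
Proof.
move=> fA hi; have [/exists_inP[x hx /eqP e]|] := boolP [exists x in A, rk x == i]; first by exists x.
rewrite negb_exists_in => /forall_inP no.
have cA : is_chain P A by case/andP: fA.
have [e0|i0] := posnP i.
  exists bot; last by rewrite e0; apply/rk_bot.
  by apply: (tight_flag_max fA) => y _; rewrite tle_bot.
have [e5|i5] := eqVneq i 5.
  exists top; last by rewrite e5; apply/rk_top.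
  by apply: (tight_flag_max fA) => y _; rewrite tle_top orbT.
have {}i5 : i < 5 by rewrite ltn_neqAle i5.
have pick k : k <= 5 -> exists2 x, rk x = k & forall u, u \in A -> rk u = k -> u = x.
  move=> hk; have [/exists_inP[x hx /eqP e]|] := boolP [exists x in A, rk x == k].
    by exists x => // u hu eu; apply: (tight_chain_rk cA) => //; rewrite e.
  rewrite negb_exists_in => /forall_inP nk; have [x rx] := rk_ex hk; exists x => // u hu eu.
  by have := nk u hu; rewrite eu eqxx.
have [|x rx hx] := pick i.-1; first by apply: leq_trans (leq_pred _) _; apply: ltnW.
have [|y ry hy] := pick i.+1 => //.
have [|w [rw xw wy]] := @tight_between i x y _ rx ry; first by rewrite i0.
exists w => //; apply: (tight_flag_max fA) => u hu.
have := no u hu; rewrite neq_ltn => /orP[ui|ui]; apply/orP; [right | left].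
  have [e|ne] := eqVneq (rk u) i.-1.
    by rewrite (hx u hu e) tle_inc // rw rx prednK.
  by apply: tle_lt; rewrite rw; move: ui ne i0; clear; lia.
have [e|ne] := eqVneq (rk u) i.+1.
  by rewrite (hy u hu e) tle_inc // rw ry.
by apply: tle_lt; rewrite rw; move: ui ne i0; clear; lia.
Qed.

Definition tight_flag v e f c : {set F} := [set bot; v; e; f; c; top].

Definition tight_quad v e f c :=
  [/\ rk v = 1, rk e = 2, rk f = 3 & rk c = 4] /\ [/\ inc v e, inc e f & inc f c].

Lemma tight_flagP A : is_flag P A ->
  exists v e f c, tight_quad v e f c /\ A = tight_flag v e f c.
Proof.
move=> fA; have cA : is_chain P A by case/andP: fA.
have le x y : x \in A -> y \in A -> rk y = (rk x).+1 -> inc x y.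
  move=> hx hy e; have /forall_inP/(_ x hx)/forall_inP/(_ y hy) := cA.
  by rewrite -tle_inc // => /orP[//|/tle_rk[->|]] /=; rewrite ?/tle ?eqxx // e ltnNge leqnSn.
have [v hv rv] := tight_flag_rk fA (isT : 1 <= 5).
have [e he re] := tight_flag_rk fA (isT : 2 <= 5).
have [f hf rf] := tight_flag_rk fA (isT : 3 <= 5).
have [c hc rc] := tight_flag_rk fA (isT : 4 <= 5).
exists v, e, f, c; split.
  by split=> //; split; apply: le; rewrite ?rv ?re ?rf ?rc.
have hb : bot \in A by apply: (tight_flag_max fA) => y _; rewrite tle_bot.
have ht : top \in A by apply: (tight_flag_max fA) => y _; rewrite tle_top orbT.
apply/setP => x; rewrite !inE; apply/idP/idP; last first.
  by move=> /orP[/orP[/orP[/orP[/orP[]|]|]|]|]/eqP->.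
move=> hx; have inj := tight_chain_rk cA.
have := rk_le5 x; case E : (rk x) => [|[|[|[|[|[|//]]]]]] _.
- by rewrite (iffLR (rk_bot x) E) eqxx.
- by rewrite (inj x v) ?eqxx ?orbT // E rv.
- by rewrite (inj x e) ?eqxx ?orbT // E re.
- by rewrite (inj x f) ?eqxx ?orbT // E rf.
- by rewrite (inj x c) ?eqxx ?orbT // E rc.
- by rewrite (iffLR (rk_top x) E) eqxx ?orbT.
Qed.

Lemma tight_quad_flag v e f c : tight_quad v e f c -> is_flag P (tight_flag v e f c).
Proof.
move=> [[rv re rf rc] [ve ef fc]].
have [rb rt] : rk bot = 0 /\ rk top = 5 by split; [apply/rk_bot | apply/rk_top].
apply/andP; split.
  apply/forall_inP => x hx; apply/forall_inP => y hy; rewrite [ple P]/=.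
  have [->|xb] := eqVneq x bot; first by rewrite tle_bot.
  have [->|xt] := eqVneq x top; first by rewrite tle_top orbT.
  have [->|yb] := eqVneq y bot; first by rewrite tle_bot orbT.
  have [->|yt] := eqVneq y top; first by rewrite tle_top.
  move: hx hy; rewrite !inE (negPf xb) (negPf xt) (negPf yb) (negPf yt) !orbF /=.
  move=> /orP[/orP[/orP[]|]|]/eqP-> /orP[/orP[/orP[]|]|]/eqP->;
    by rewrite /tle ?eqxx ?rv ?re ?rf ?rc ?ve ?ef ?fc ?orbT.
apply/forallP => B; apply/implyP => /andP[cB sAB]; rewrite eqEsubset sAB andbT.
apply/subsetP => x hx; have inj := tight_chain_rk cB.
have mem u : u \in tight_flag v e f c -> rk u = rk x -> x \in tight_flag v e f c.
  by move=> hu eu; rewrite -(inj u x) // (subsetP sAB).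
have := rk_le5 x; case E : (rk x) => [|[|[|[|[|[|//]]]]]] _.
- by apply: (mem bot); rewrite ?E // !inE eqxx.
- by apply: (mem v); rewrite ?E // !inE eqxx ?orbT.
- by apply: (mem e); rewrite ?E // !inE eqxx ?orbT.
- by apply: (mem f); rewrite ?E // !inE eqxx ?orbT.
- by apply: (mem c); rewrite ?E // !inE eqxx ?orbT.
- by apply: (mem top); rewrite ?E // !inE eqxx ?orbT.
Qed.

(* Walking around the polygon in the direction of increasing indices reaches
   every flag of the section. *)
Lemma polygon_connect j x y (R : F -> F -> F -> F -> Prop) :
  0 < j < 4 -> rk x = j.-1 -> rk y = j.+2 ->
  let pair w w' := [/\ rk w = j, rk w' = j.+1, inc x w, inc w w' & inc w' y] in
  (forall w w' u u' v v', R w w' u u' -> R u u' v v' -> R w w' v v') ->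
  (forall w u w', pair w w' -> pair u w' -> R w w' u w') ->
  (forall w w' u', pair w w' -> pair w u' -> R w w' w u') ->
  forall w w' u u', pair w w' -> pair u u' -> R w w' u u'.
Proof.
move=> hj rx ry pair Rt R1 R2; have [z [z' [h1 h2 h3 [h4 h5 h6]]]] := polyP hj rx ry.
have d0 : 0 < deg j by apply: ltn_trans (deg_gt1 hj).
have pz i : pair (z i) (z' i).
  by have [? ? ? ?] := h1 i; split=> //; apply/h4; left.
have pz1 i : pair (z i) (z' i.+1).
  by have [? ? _ _] := h1 i; have [_ _ ? ?] := h1 i.+1; split=> //; apply/h4; right.
have chain i l : R (z i) (z' i) (z (i + l)) (z' (i + l)).
  elim: l => [|l IH]; first by rewrite addn0; apply: R1.
  rewrite addnS; apply: (Rt _ _ _ _ _ _ IH); apply: (Rt _ _ _ _ _ _ (R2 _ _ _ (pz _) (pz1 _))).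
  exact: (R1 _ _ _ (pz1 _) (pz _)).
move=> w w' u u' pw pu.
have [i ei] : exists i, w = z i by case: pw => rw _ xw _ _; apply: h2.
have [k ek] : exists k, u = z k by case: pu => ru _ xu _ _; apply: h2.
rewrite ei ek in pw pu *.
(* Walks only increase the index, so k - i is replaced by the congruent nonnegative number k + (deg
   j - 1) i. *)
have e : i + (k + (deg j).-1 * i) = k %[mod deg j].
  by rewrite addnCA -mulSn prednK // mulnC addnC modnMDl.
apply: (Rt _ _ _ _ _ _ (R2 _ _ _ pw (pz i))).
apply: (Rt _ _ _ _ _ _ (chain i (k + (deg j).-1 * i))).
by rewrite (iffRL (h5 _ _) e) (iffRL (h6 _ _) e); apply: R2.
Qed.

(** * Connectedness of the flags containing a given set of faces *)

Section Connected.
Variable D : {set F}.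
(** When this holds, the face of rank i may be exchanged without leaving the flags that contain
    D. *)
Let noD i := forall x, x \in D -> rk x != i.

Lemma tight_step A B x : is_flag P A -> is_flag P B -> D \subset A -> D \subset B ->
  A :\: B \subset [set x] -> connect (adj_in P D) A B.
Proof.
move=> fA fB sA sB sub; have [e|ne] := eqVneq #|A :\: B| 0.
  move/eqP: e; rewrite cards_eq0 setD_eq0 => sAB.
  case/andP: fA => _ /forallP/(_ B)/implyP; case/andP: fB => cB _.
  by rewrite cB sAB => /(_ isT)/eqP ->; apply: connect0.
apply: connect1; rewrite /adj_in fA fB sA sB /= eqn_leq lt0n ne andbT.
by rewrite -(cards1 x); apply: subset_leq_card.
Qed.

Let sub4 v e f c v1 e1 f1 c1 : tight_quad v e f c -> D \subset tight_flag v e f c ->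
  (v = v1 \/ noD 1) -> (e = e1 \/ noD 2) -> (f = f1 \/ noD 3) -> (c = c1 \/ noD 4) ->
  D \subset tight_flag v1 e1 f1 c1.
Proof.
move=> [[rv re rf rc] _] /subsetP sD h1 h2 h3 h4; apply/subsetP => x hx.
move: (sD x hx); rewrite !inE => /orP[/orP[/orP[/orP[/orP[]|]|]|]|]/eqP ex.
- by rewrite ex eqxx.
- by case: h1 => [<-|/(_ x hx)]; [rewrite ex eqxx ?orbT | rewrite ex rv].
- by case: h2 => [<-|/(_ x hx)]; [rewrite ex eqxx ?orbT | rewrite ex re].
- by case: h3 => [<-|/(_ x hx)]; [rewrite ex eqxx ?orbT | rewrite ex rf].
- by case: h4 => [<-|/(_ x hx)]; [rewrite ex eqxx ?orbT | rewrite ex rc].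
- by rewrite ex eqxx ?orbT.
Qed.

Let conn v e f c v1 e1 f1 c1 :=
  connect (adj_in P D) (tight_flag v e f c) (tight_flag v1 e1 f1 c1).

Let step_v v1 v e f c : D \subset tight_flag v e f c -> noD 1 ->
  tight_quad v e f c -> tight_quad v1 e f c -> conn v e f c v1 e f c.
Proof.
move=> sD n q q1; apply: (@tight_step _ _ v); rewrite ?tight_quad_flag //.
  by apply: (sub4 q sD); by [left | right].
by apply/subsetP => x; rewrite !inE; do ?[case: (x == _) => //=].
Qed.

Let step_e e1 v e f c : D \subset tight_flag v e f c -> noD 2 ->
  tight_quad v e f c -> tight_quad v e1 f c -> conn v e f c v e1 f c.
Proof.
move=> sD n q q1; apply: (@tight_step _ _ e); rewrite ?tight_quad_flag //.
  by apply: (sub4 q sD); by [left | right].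
by apply/subsetP => x; rewrite !inE; do ?[case: (x == _) => //=].
Qed.

Let step_f f1 v e f c : D \subset tight_flag v e f c -> noD 3 ->
  tight_quad v e f c -> tight_quad v e f1 c -> conn v e f c v e f1 c.
Proof.
move=> sD n q q1; apply: (@tight_step _ _ f); rewrite ?tight_quad_flag //.
  by apply: (sub4 q sD); by [left | right].
by apply/subsetP => x; rewrite !inE; do ?[case: (x == _) => //=].
Qed.

Let step_c c1 v e f c : D \subset tight_flag v e f c -> noD 4 ->
  tight_quad v e f c -> tight_quad v e f c1 -> conn v e f c v e f c1.
Proof.
move=> sD n q q1; apply: (@tight_step _ _ c); rewrite ?tight_quad_flag //.
  by apply: (sub4 q sD); by [left | right].
by apply/subsetP => x; rewrite !inE; do ?[case: (x == _) => //=].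
Qed.

Let poly_ve v e v1 e1 f c : D \subset tight_flag v e f c -> noD 1 -> noD 2 ->
  tight_quad v e f c -> tight_quad v1 e1 f c -> conn v e f c v1 e1 f c.
Proof.
move=> sD n1 n2 q q1; have [[rv re rf rc] [ve ef fc]] := q; have [[rv1 re1 _ _] [ve1 ef1 _]] := q1.
have rb : rk bot = 0 by apply/rk_bot.
have S w w' : D \subset tight_flag w w' f c by apply: (sub4 q sD); by [left | right].
apply: (@polygon_connect 1 bot f (fun w w' u u' => conn w w' f c u u' f c)) => //.
- by move=> w w' u u' x x'; apply: connect_trans.
- by move=> w u w' [? ? _ ? ?] [? ? _ ? ?]; apply: step_v.
- by move=> w w' u' [? ? _ ? ?] [? ? _ ? ?]; apply: step_e.
- by split=> //; apply: inc_bot.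
- by split=> //; apply: inc_bot.
Qed.

Let poly_ef v e f e1 f1 c : D \subset tight_flag v e f c -> noD 2 -> noD 3 ->
  tight_quad v e f c -> tight_quad v e1 f1 c -> conn v e f c v e1 f1 c.
Proof.
move=> sD n1 n2 q q1; have [[rv re rf rc] [ve ef fc]] := q; have [[_ re1 rf1 _] [ve1 ef1 fc1]] := q1.
have S w w' : D \subset tight_flag v w w' c by apply: (sub4 q sD); by [left | right].
apply: (@polygon_connect 2 v c (fun w w' u u' => conn v w w' c v u u' c)) => //.
- by move=> w w' u u' x x'; apply: connect_trans.
- by move=> w u w' [? ? ? ? ?] [? ? ? ? ?]; apply: step_e.
- by move=> w w' u' [? ? ? ? ?] [? ? ? ? ?]; apply: step_f.
Qed.

Let poly_fc v e f c f1 c1 : D \subset tight_flag v e f c -> noD 3 -> noD 4 ->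
  tight_quad v e f c -> tight_quad v e f1 c1 -> conn v e f c v e f1 c1.
Proof.
move=> sD n1 n2 q q1; have [[rv re rf rc] [ve ef fc]] := q; have [[_ _ rf1 rc1] [_ ef1 fc1]] := q1.
have rt : rk top = 5 by apply/rk_top.
have S w w' : D \subset tight_flag v e w w' by apply: (sub4 q sD); by [left | right].
apply: (@polygon_connect 3 e top (fun w w' u u' => conn v e w w' v e u u')) => //.
- by move=> w w' u u' x x'; apply: connect_trans.
- by move=> w u w' [? ? ? ? _] [? ? ? ? _]; apply: step_f.
- by move=> w w' u' [? ? ? ? _] [? ? ? ? _]; apply: step_c.
- by split=> //; apply: inc_top.
- by split=> //; apply: inc_top.
Qed.

(* Incidence of faces two ranks apart lets the missing ranks be corrected one
   polygon at a time. *)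
Lemma tight_connect4 v e f c v1 e1 f1 c1 :
  tight_quad v e f c -> tight_quad v1 e1 f1 c1 -> D \subset tight_flag v e f c ->
  (v = v1 \/ noD 1) -> (e = e1 \/ noD 2) -> (f = f1 \/ noD 3) -> (c = c1 \/ noD 4) ->
  conn v e f c v1 e1 f1 c1.
Proof.
move=> q q1 sD; have [[rv re rf rc] [ve ef fc]] := q.
have [[rv1 re1 rf1 rc1] [ve1 ef1 fc1]] := q1.
have tr a1 a2 a3 a4 b1 b2 b3 b4 d1 d2 d3 d4 : conn a1 a2 a3 a4 b1 b2 b3 b4 ->
    conn b1 b2 b3 b4 d1 d2 d3 d4 -> conn a1 a2 a3 a4 d1 d2 d3 d4 by apply: connect_trans.
have S w1 w2 w3 w4 := @sub4 v e f c w1 w2 w3 w4 q sD.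
have vef : noD 1 -> noD 2 -> noD 3 -> forall v' e' f', tight_quad v' e' f' c -> conn v e f c v' e' f' c.
  move=> n1 n2 n3 v' e' f' q'; have [[rv' re' rf' _] [ve' ef' fc']] := q'.
  (* The old vertex and the new 2-face are two ranks apart, so some edge [e2] joins them; the pair
     (e, f) is then changed under the old vertex, and the pair (v, e) under the new 2-face. *)
  have [|e2 [re2 ve2 ef2]] := @tight_between 2 v f' _ rv rf' => //.
  apply: (@tr _ _ _ _ v e2 f' c); first by apply: poly_ef.
  by apply: poly_ve => //; apply: S; by [left | right].
case=> [ev|n1]; case=> [ee|n2]; case=> [eff|n3]; case=> [ec|n4]; subst=> //.
- exact: connect0.
- exact: step_c.
- exact: step_f.
- exact: poly_fc.
- exact: step_e.
- apply: (@tr _ _ _ _ v1 e1 f1 c); first by apply: step_e.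
  by apply: step_c => //; apply: S; by [left | right].
- exact: poly_ef.
- have [|f2 [rf2 ef2 fc2]] := @tight_between 3 e1 c _ re1 rc => //.
  apply: (@tr _ _ _ _ v1 e1 f2 c); first by apply: poly_ef.
  by apply: poly_fc => //; apply: S; by [left | right].
- exact: step_v.
- apply: (@tr _ _ _ _ v1 e1 f1 c); first by apply: step_v.
  by apply: step_c => //; apply: S; by [left | right].
- apply: (@tr _ _ _ _ v1 e1 f c1); first by apply: step_v.
  by apply: step_f => //; apply: S; by [left | right].
- apply: (@tr _ _ _ _ v1 e1 f c); first by apply: step_v.
  by apply: poly_fc => //; apply: S; by [left | right].
- exact: poly_ve.
- apply: (@tr _ _ _ _ v1 e1 f1 c); first by apply: poly_ve.
  by apply: step_c => //; apply: S; by [left | right].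
- exact: vef.
- have [|f2 [rf2 ef2 fc2]] := @tight_between 3 e1 c _ re1 rc => //.
  apply: (@tr _ _ _ _ v1 e1 f2 c); first by apply: vef.
  by apply: poly_fc => //; apply: S; by [left | right].
Qed.

End Connected.

Lemma tight_connected A B : is_flag P A -> is_flag P B -> connect (adj_in P (A :&: B)) A B.
Proof.
move=> fA fB; have cA : is_chain P A by case/andP: fA.
have cB : is_chain P B by case/andP: fB.
have inA := tight_chain_rk cA; have inB := tight_chain_rk cB.
have [v [e [f [c [q eA]]]]] := tight_flagP fA.
have [v1 [e1 [f1 [c1 [q1 eB]]]]] := tight_flagP fB.
have key i x y : x \in A -> y \in B -> rk x = i -> rk y = i ->
    x = y \/ forall z, z \in A :&: B -> rk z != i.
  move=> hx hy rx ry; have [->|ne] := eqVneq x y; [by left | right=> z].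
  rewrite inE => /andP[zA zB]; apply: contra ne => /eqP rz; apply/eqP.
  by rewrite -(inA z x) ?rz ?rx // -(inB z y) ?rz ?ry.
have [[rv re rf rc] _] := q; have [[rv1 re1 rf1 rc1] _] := q1.
rewrite {2}eA {2}eB; apply: tight_connect4 => //.
- by rewrite -eA subsetIl.
- by apply: key; rewrite ?eA ?eB ?rv1 // !inE eqxx ?orbT.
- by apply: key; rewrite ?eA ?eB ?re1 // !inE eqxx ?orbT.
- by apply: key; rewrite ?eA ?eB ?rf1 // !inE eqxx ?orbT.
- by apply: key; rewrite ?eA ?eB ?rc1 // !inE eqxx ?orbT.
Qed.

Lemma tight_flag_card A : is_flag P A -> #|A| = 6.
Proof.
move=> fA; have cA : is_chain P A by case/andP: fA.
pose g x : 'I_6 := inord (rk x).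
have gE x : g x = rk x :> nat by rewrite inordK // ltnS.
rewrite -(card_in_imset (f := g)); last first.
  by move=> x y hx hy /(congr1 val); rewrite /= !gE; apply: (tight_chain_rk cA).
suff -> : g @: A = setT by rewrite cardsT card_ord.
apply/setP => i; rewrite inE.
have [x hx rx] := @tight_flag_rk A i fA (ltn_ord i).
by apply/imsetP; exists x => //; apply: val_inj; rewrite /= gE.
Qed.

Theorem tight_is_polytope : is_polytope P 4.
Proof.
split; [split | split; split].
- by move=> x; rewrite /= /tle eqxx.
- exact: tle_anti.
- exact: tle_trans.
- by exists bot; split; [apply/rk_bot | apply: tle_bot].
- by exists top; split; [apply/rk_top | apply: tle_top].
- by move=> x y; rewrite tltE => /andP[].
- exact: tight_flag_card.
- exact: tight_diamond_card.
- exact: tight_connected.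
Qed.

Theorem tight_has_type : has_type4 P (deg 1) (deg 2) (deg 3).
Proof.
move=> j x y /andP[j1 j3] _ /= rx ry; have hj : 0 < j < 4 by rewrite j1.
rewrite addn2 in ry.
have -> : nth 0 [:: deg 1; deg 2; deg 3] j.-1 = deg j.
  by case: j j1 j3 {rx ry hj} => [|[|[|[|]]]].
have [z [z' [h1 h2 h3 [h4 h5 h6]]]] := polyP hj rx ry.
have inj : injective (fun i : 'I_(deg j) => z' i).
  by move=> i k /h6; rewrite !modn_small // => /val_inj.
rewrite -[RHS]card_ord -(card_imset _ inj); apply: eq_card => w; rewrite inE.
apply/and3P/imsetP.
  move=> [_ wy /eqP rw]; move: wy; rewrite tlt_inc ?rw // => wy.
  have [i ei] := h3 _ rw wy; have d0 : 0 < deg j by apply: ltn_trans (deg_gt1 hj).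
  exists (Ordinal (ltn_pmod i d0)) => //; rewrite ei; apply/h6.
  by rewrite /= modn_mod.
move=> [i _ ->]; have [r1 i1 r2 i2] := h1 i; split; last by apply/eqP.
  by apply: tlt_lt; rewrite rx r2 prednK.
by rewrite tlt_inc ?r2.
Qed.

End TightPoset.

(** * Subgroups of a tight group *)

Section TightGroupFacts.
Variables (gT : finGroupType) (a b c : gT).
Local Open Scope group_scope.
Hypotheses (ab2 : a * b * (a * b) = 1) (bc2 : b * c * (b * c) = 1)
  (abc2 : a * b * c * (a * b * c) = 1).
Hypotheses (fullG : [set: gT] = <[a]> * (<[b]> * <[c]>))
  (tight : #|<[a]> * (<[b]> * <[c]>)| = (#[a] * #[b] * #[c])%N).
Hypotheses (b_ne1 : b != 1).
Hypotheses (a_ne1 : a != 1) (c_ne1 : c != 1).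
Hypotheses (cb_bc : <[c]> * <[b]> \subset <[b]> * <[c]>)
  (ba_ab : <[b]> * <[a]> \subset <[a]> * <[b]>).

Definition tgt_sub (i : nat) : {group gT} :=
  nth [set: gT]%G [:: [set: gT]%G; (<[b]> <*> <[c]>)%G; (<[a * b]> <*> <[c]>)%G;
     (<[a]> <*> <[b * c]>)%G; (<[a]> <*> <[b]>)%G; [set: gT]%G] i.
Local Notation K := tgt_sub.
Definition tgt_gen (j : nat) : gT := nth 1 [:: 1; a; b; c] j.

Let unique x y z : x \in <[a]> -> y \in <[b]> -> z \in <[c]> -> x * (y * z) = 1 ->
  [/\ x = 1, y = 1 & z = 1].
Proof.
move=> /cycleP[i ->] /cycleP[j ->] /cycleP[k ->] e.
exact: (nform_eq1 tight (e : nform a b c i j k = 1)).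
Qed.

Let abV : a * b = b^-1 * a^-1.
Proof. by rewrite -invMg; apply/esym/mulg1_eq. Qed.
Let bcV : b * c = c^-1 * b^-1.
Proof. by rewrite -invMg; apply/esym/mulg1_eq. Qed.

(** The two products are inverse to each other as sets, so they have the same size and inclusion is
    equality. *)
Let mulC_sub (x y : gT) : <[y]> * <[x]> \subset <[x]> * <[y]> -> commute <[x]> <[y]>.
Proof.
move=> sub; apply/esym/eqP; rewrite eqEcard sub -(card_invg (<[x]> * <[y]>)).
by rewrite invMg !invGid leqnn.
Qed.

Lemma K1E : K 1 = <[b]> * <[c]> :> {set gT}.
Proof. by rewrite /= comm_joingE //; apply: mulC_sub. Qed.
Lemma K1E' : K 1 = <[c]> * <[b]> :> {set gT}.
Proof. by rewrite K1E; apply: mulC_sub. Qed.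
Lemma K4E : K 4 = <[a]> * <[b]> :> {set gT}.
Proof. by rewrite /= comm_joingE //; apply: mulC_sub. Qed.

Let inv_norm (x y : gT) : y ^ x = y^-1 -> <[x]> \subset 'N(<[y]>).
Proof. by move=> e; rewrite cycle_subG inE -cycleJ e cycleV. Qed.

Let inv2_cycle (x y : gT) : x * x = 1 -> y \in <[x]> -> y = 1 \/ y = x.
Proof.
move=> x2 /cycleP[i ->]; rewrite -(odd_double_half i) expgnDr -muln2 mulnC expgnA.
rewrite (expgS x 1) expg1 x2 expg1n mulg1.
by case: (odd i); [right; rewrite expg1 | left].
Qed.

Let c_ab : c ^ (a * b) = c^-1.
Proof.
rewrite conjgE (mulg1_eq ab2); apply/esym; rewrite mulgA -[RHS]invgK; congr (_^-1).
by apply/esym/mulg1_eq; rewrite -[RHS]abc2 !mulgA.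
Qed.

Let a_bc : a ^ (b * c) = a^-1.
Proof.
rewrite conjgE (mulg1_eq bc2); apply/esym/mulg1_eq.
by rewrite -[RHS]abc2 !mulgA.
Qed.

(** The involution a b inverts c, so <c> has index at most two in K 2. Likewise b c inverts a, which
    gives the shape of K 3. *)
Lemma K2P x : x \in K 2 -> exists2 z, z \in <[c]> & x = z \/ x = z * (a * b).
Proof.
rewrite /= norm_joinEl ?inv_norm // (normC (inv_norm c_ab)) => /mulsgP[z u hz hu ->].
exists z => //; have [->|->] := inv2_cycle ab2 hu; first by left; rewrite mulg1.
by right.
Qed.

Lemma K2P' x : x \in K 2 -> exists2 z, z \in <[c]> & x = z \/ x = a * b * z.
Proof.
rewrite /= norm_joinEl ?inv_norm // => /mulsgP[u z hu hz ->].
exists z => //; have [->|->] := inv2_cycle ab2 hu; first by left; rewrite mul1g.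
by right.
Qed.

Lemma K3P x : x \in K 3 -> exists2 z, z \in <[a]> & x = z \/ x = z * (b * c).
Proof.
rewrite /= norm_joinEr ?inv_norm // => /mulsgP[z u hz hu ->].
exists z => //; have [->|->] := inv2_cycle bc2 hu; first by left; rewrite mulg1.
by right.
Qed.

Lemma K3P' x : x \in K 3 -> exists2 z, z \in <[a]> & x = z \/ x = b * c * z.
Proof.
rewrite /= norm_joinEr ?inv_norm // -(normC (inv_norm a_bc)) => /mulsgP[u z hu hz ->].
exists z => //; have [->|->] := inv2_cycle bc2 hu; first by left; rewrite mul1g.
by right.
Qed.

Let sub_join1 (x y z : gT) : z \in <[x]> -> z \in <[x]> <*> <[y]>.
Proof. by move=> h; apply: (subsetP (joing_subl _ _)). Qed.
Let sub_join2 (x y z : gT) : z \in <[y]> -> z \in <[x]> <*> <[y]>.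
Proof. by move=> h; apply: (subsetP (joing_subr _ _)). Qed.

Let bK1 y : y \in <[b]> -> y \in K 1. Proof. exact: sub_join1. Qed.
Let cK1 y : y \in <[c]> -> y \in K 1. Proof. exact: sub_join2. Qed.
Let cK2 y : y \in <[c]> -> y \in K 2. Proof. exact: sub_join2. Qed.
Let abK2 : a * b \in K 2. Proof. by apply: sub_join1; apply: cycle_id. Qed.
Let aK3 y : y \in <[a]> -> y \in K 3. Proof. exact: sub_join1. Qed.
Let bcK3 : b * c \in K 3. Proof. by apply: sub_join2; apply: cycle_id. Qed.
Let aK4 y : y \in <[a]> -> y \in K 4. Proof. exact: sub_join1. Qed.
Let bK4 y : y \in <[b]> -> y \in K 4. Proof. exact: sub_join2. Qed.

Let bcK1 v w : v \in <[b]> -> w \in <[c]> -> v * w \in K 1.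
Proof. by move=> /bK1 hv /cK1 hw; apply: groupM. Qed.
Let abK4 v w : v \in <[a]> -> w \in <[b]> -> v * w \in K 4.
Proof. by move=> /aK4 hv /bK4 hw; apply: groupM. Qed.

Lemma tgt_fullE x : exists u v w, [/\ u \in <[a]>, v \in <[b]>, w \in <[c]> & x = u * (v * w)].
Proof.
have : x \in [set: gT] by rewrite inE.
rewrite fullG => /mulsgP[u _ hu /mulsgP[v w hv hw ->] ->].
by exists u, v, w.
Qed.

Let aK1 x : x \in <[a]> -> x \in K 1 -> x = 1.
Proof.
rewrite -groupV => hx; rewrite K1E => /mulsgP[v w hv hw e].
by have [] := unique hx hv hw (_ : x^-1 * (v * w) = 1); rewrite -?e ?mulVg // => /eqP; rewrite invg_eq1 => /eqP.
Qed.

Let cK4 x : x \in <[c]> -> x \in K 4 -> x = 1.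
Proof.
rewrite -groupV => hx; rewrite K4E => /mulsgP[v w hv hw e].
by have [] := unique hv hw hx (_ : v * (w * x^-1) = 1); rewrite ?mulgA -?e ?mulgV // => _ _ /eqP; rewrite invg_eq1 => /eqP.
Qed.

Let bc_eq x y : x \in <[b]> -> y \in <[c]> -> x = y -> x = 1.
Proof.
move=> hx hy e; have hy' : y^-1 \in <[c]> by rewrite groupV.
by have [] := unique (group1 _) hx hy' (_ : 1 * (x * y^-1) = 1); rewrite ?mul1g ?e ?mulgV.
Qed.

Let ca : c \in <[c]>. Proof. exact: cycle_id. Qed.
Let aa : a \in <[a]>. Proof. exact: cycle_id. Qed.
Let bb : b \in <[b]>. Proof. exact: cycle_id. Qed.

Lemma tgt_gen_low j : 0 < j < 4 -> tgt_gen j \in K j.-1 /\ tgt_gen j \in K j.+2.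
Proof.
case: j => [|[|[|[|//]]]] // _; split; rewrite ?inE //.
- exact: aK3.
- exact: bK1.
- exact: bK4.
- exact: cK2.
Qed.

Lemma tgt_mul_full i x : 0 < i < 4 -> x \in K i.-1 * K i.+2.
Proof.
case: i => [|[|[|[|//]]]] // _.
- by apply/mulsgP; exists x 1; rewrite ?inE ?group1 ?mulg1.
- have [u [v [w [hu hv hw e]]]] := tgt_fullE x^-1.
  apply/mulsgP; exists ((v * w)^-1) u^-1; rewrite ?groupV.
  + exact: bcK1.
  + exact: aK4.
  + by rewrite -invMg -e invgK.
- by apply/mulsgP; exists 1 x; rewrite ?inE ?group1 ?mul1g.
Qed.

(** In the coset geometry this says that the faces of rank j incident with the base face of rank j -
    1 are translates of the base face by powers of the j-th generator. *)
Lemma tgt_lower j h : 0 < j < 4 -> h \in K j.-1 ->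
  exists2 y, y \in <[tgt_gen j]> & h * y^-1 \in K j.
Proof.
case: j => [|[|[|[|//]]]] // _ hh.
- have [u [v [w [hu hv hw e]]]] := tgt_fullE h^-1.
  exists u^-1; first by rewrite groupV.
  by rewrite invgK -[h]invgK e invMg mulgKV groupV bcK1.
- move: hh; rewrite /= -/(K 1) K1E' => /mulsgP[z y hz hy ->].
  by exists y => //; rewrite mulgK cK2.
- have [z hz [->|->]] := K2P' hh; first by exists z; rewrite ?mulgV ?group1.
  (* The choice comes from a b z = (a b c) (c^-1 z), with a b c in K 3. *)
  exists (c^-1 * z); first by rewrite groupM ?groupV.
  have -> : a * b * z * (c^-1 * z)^-1 = a * (b * c) by rewrite invMg invgK !mulgA mulgK.
  by apply: groupM; [exact: aK3 | exact: bcK3].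
Qed.

Lemma tgt_upper j h : 0 < j < 4 -> h \in K j.+2 ->
  exists2 y, y \in <[tgt_gen j]> & h * y^-1 \in K j.+1.
Proof.
case: j => [|[|[|[|//]]]] // _ hh.
- have [z hz [->|->]] := K3P' hh; first by exists z; rewrite ?mulgV ?group1.
  (* Since a b a = b^-1, the element b c z = c^-1 b^-1 z equals (c^-1 a b) (a z), with the first
     factor in K 2. *)
  exists (a * z); first by rewrite groupM.
  have -> : b * c * z * (a * z)^-1 = c^-1 * (a * b) by rewrite bcV abV invMg !mulgA mulgK.
  by apply: groupM; [rewrite groupV cK2 | exact: abK2].
- move: hh; rewrite /= -/(K 4) K4E => /mulsgP[z y hz hy ->].
  by exists y => //; rewrite mulgK aK3.
- have [u [v [w [hu hv hw e]]]] := tgt_fullE h.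
  by exists w => //; rewrite e !mulgA mulgK abK4.
Qed.

(** Distinct powers of the j-th generator thus give distinct vertices and distinct edges of the
    polygon. *)
Lemma tgt_triv j y : 0 < j < 4 -> y \in <[tgt_gen j]> ->
  (y \in K j -> y = 1) /\ (y \in K j.+1 -> y = 1).
Proof.
have a1 : a \notin K 1 by apply: contra a_ne1 => /(aK1 aa)/eqP.
case: j => [|[|[|[|//]]]] // _ hy; split => hK.
- exact: aK1.
- have [z hz [e|e]] := K2P' hK; first by apply: aK1 => //; rewrite e cK1.
  have h : y^-1 * a \in <[a]> by rewrite groupM ?groupV.
  have [] := unique h bb hz; first by rewrite -!mulgA (mulgA a) -e mulVg.
  by move=> _ /eqP; rewrite (negPf b_ne1).
- have [z hz [e|e]] := K2P' hK; first exact: bc_eq hz e.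
  case/negP: a1; rewrite (_ : a = y * z^-1 * b^-1); last by rewrite e mulgK mulgK.
  by apply: groupM; [apply: groupM; [exact: bK1 | rewrite groupV cK1] | rewrite groupV bK1].
- have [z hz [e|e]] := K3P hK; first by rewrite e; apply: aK1 => //; rewrite -e bK1.
  have z1 : z = 1.
    apply: aK1 => //; rewrite (_ : z = y * (b * c)^-1); last by rewrite e mulgK.
    by apply: groupM; [exact: bK1 | rewrite groupV bcK1].
  have e' : b^-1 * y = c by rewrite e z1 mul1g mulKg.
  have := @bc_eq (b^-1 * y) c _ ca e'; rewrite groupM ?groupV // e' => /(_ isT)/eqP.
  by rewrite (negPf c_ne1).
- have [z hz [e|e]] := K3P hK; first by apply: cK4 => //; rewrite e aK4.
  have h : c * y^-1 \in <[c]> by rewrite groupM ?groupV.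
  have [] := unique hz bb h; first by rewrite !mulgA -(mulgA z) -e mulgV.
  by move=> _ /eqP; rewrite (negPf b_ne1).
- exact: cK4.
Qed.

(** The product K j * K j.+1 records which vertices and edges of the polygon meet; the two solutions
    are the two edges at a vertex. *)
Lemma tgt_adj j y : 0 < j < 4 -> y \in <[tgt_gen j]> ->
  (y \in K j * K j.+1 <-> y = 1 \/ y = (tgt_gen j)^-1).
Proof.
have inv1 (x g : gT) : x * g = 1 -> x = g^-1 by move=> /mulg1_eq <-; rewrite invgK.
case: j => [|[|[|[|//]]]] // _ /= hy; split.
- move=> /mulsgP[h k hh hk e]; have [z hz [ek|ek]] := K2P hk; move: e; rewrite ek => e.
    by left; apply: aK1 => //; rewrite e groupM // cK1.
  right; apply: inv1; apply: aK1; first by rewrite groupM.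
  rewrite e abV !mulgA mulgKV; apply: groupM; last by rewrite groupV bK1.
  by apply: groupM => //; apply: cK1.
- case=> ->; apply/mulsgP; first by exists 1 1; rewrite ?group1 ?mulg1.
  by exists b (a * b); rewrite ?bK1 ?abK2 // abV mulVKg.
(* For j = 2 both factors range over two cosets, hence four cases. In each, an element of <a> is
   shown to lie in K 1 and so to be trivial, which leaves an equation between <b> and <c>. *)
- move=> /mulsgP[k h hk hh e].
  have [z hz ek] := K2P hk; have [x hx eh] := K3P hh; have hz' := cK1 hz; have b1 := bK1 bb; have hy' := bK1 hy.
  have bc1 : b * c \in K 1 by apply: bcK1.
  have ax : a^-1 * x \in <[a]> by rewrite groupM ?groupV.
  case: ek eh e => -> [] -> e.
  + have x1 : x = 1 by apply: aK1 => //; rewrite -(mulKg z x) -e groupM ?groupV.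
    by left; apply: (bc_eq hy hz); rewrite e x1 mulg1.
  + have x1 : x = 1.
      apply: aK1 => //; rewrite -(mulgK (b * c) x) -(mulKg z (x * _)) -e.
      by rewrite !groupM ?groupV.
    right; apply: inv1; apply: (bc_eq (y := z * c^-1)); rewrite ?groupM ?groupV //.
    by rewrite e x1 mul1g bcV !mulgA mulgKV.
  + have x1 : a^-1 * x = 1.
      apply: aK1 => //; rewrite (_ : _ * x = b * (z^-1 * y)); last first.
        by rewrite e abV -!mulgA mulKg mulVKg.
      by rewrite !groupM ?groupV.
    right; apply: inv1; apply: (bc_eq (y := z)); rewrite ?groupM //.
    by rewrite e abV -!mulgA (mulgA a^-1) x1 mul1g mulVg mulg1.
  + have x1 : a^-1 * x = 1.
      apply: aK1 => //; rewrite (_ : _ * x = b * (z^-1 * y * (b * c)^-1)); last first.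
        by rewrite e abV invMg -!mulgA mulKg !mulVKg mulgV mulg1.
      by rewrite !groupM ?groupV.
    left; apply: (bc_eq (y := z * c)); rewrite ?groupM //.
    by rewrite e abV -!mulgA (mulgA a^-1) x1 mul1g mulKg.
- case=> ->; apply/mulsgP; first by exists 1 1; rewrite ?group1 ?mulg1.
  by exists (a * b) a; rewrite ?abK2 ?aK3 // abV mulgKV.
- move=> /mulsgP[k h hk hh e]; have [x hx [ek|ek]] := K3P' hk; move: e; rewrite ek => e.
    by left; apply: cK4 => //; rewrite e groupM // aK4.
  right; apply: invg_inj; rewrite invgK; apply: (mulIg y); rewrite mulVg; apply/esym.
  apply: cK4; first by rewrite groupM.
  rewrite e bcV !mulgA mulgV mul1g; apply: groupM => //.
  by apply: groupM; [rewrite groupV bK4 | apply: aK4].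
- case=> ->; apply/mulsgP; first by exists 1 1; rewrite ?group1 ?mulg1.
  by exists (b * c) b; rewrite ?bcK3 ?bK4 // bcV mulgKV.
Qed.

End TightGroupFacts.

(** * The coset geometry *)

Section TightAdjacent.
Variables (F : finType) (rk : F -> nat) (inc : rel F) (bot top : F).
Local Notation P := (tight_pstruct rk inc).

Lemma adjflag_swap (A B : {set F}) x y j : is_flag P A -> is_flag P B ->
  x \in A -> rk x = j.+1 -> y \in B -> rk y = j.+1 -> x != y ->
  A :\: B \subset [set x] -> adjflag P j A B.
Proof.
move=> fA fB xA rx yB ry ne sub; rewrite /adjflag fA fB.
have -> : A :\: B = [set x].
  apply/eqP; rewrite eqEsubset sub sub1set inE xA andbT.
  by apply: contra ne => xB; apply/eqP/(tight_chain_rk (flag_chain fB)); rewrite ?rx.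
by rewrite cards1 eqxx; apply/forall_inP => z /set1P ->; apply/eqP.
Qed.

End TightAdjacent.

Section CosetGeometry.
Variables (gT : finGroupType) (K : nat -> {group gT}) (g : nat -> gT).
Local Open Scope group_scope.

(* Ranks are shifted by one: K 1, K 2, K 3, K 4 are the stabilisers of the base
   vertex, edge, 2-face and facet. *)
Hypotheses (K0 : K 0 = [set: gT]%G) (K5 : K 5 = [set: gT]%G).
Hypothesis gen_low : forall j, 0 < j < 4 -> g j \in K j.-1 /\ g j \in K j.+2.
Hypothesis mul_full : forall j x, 0 < j < 4 -> x \in K j.-1 * K j.+2.
Hypothesis lower : forall j h, 0 < j < 4 -> h \in K j.-1 ->
  exists2 y, y \in <[g j]> & h * y^-1 \in K j.
Hypothesis upper : forall j h, 0 < j < 4 -> h \in K j.+2 ->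
  exists2 y, y \in <[g j]> & h * y^-1 \in K j.+1.
Hypothesis triv : forall j y, 0 < j < 4 -> y \in <[g j]> ->
  (y \in K j -> y = 1) /\ (y \in K j.+1 -> y = 1).
Hypothesis adj : forall j y, 0 < j < 4 -> y \in <[g j]> ->
  (y \in K j * K j.+1 <-> y = 1 \/ y = (g j)^-1).
Hypothesis g_ne1 : forall j, 0 < j < 4 -> 1 < #[g j].

Definition cface : finType :=
  {x : 'I_6 * {set gT} | x.2 \in rcosets (K x.1) [set: gT]}.

Definition crk (x : cface) : nat := (val x).1.
Definition ccos (x : cface) : {set gT} := (val x).2.
Definition cinc : rel cface := fun x y => ~~ [disjoint ccos x & ccos y].

Lemma face_subproof (i : 'I_6) w : (i, K i :* w).2 \in rcosets (K (i, K i :* w).1) [set: gT].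
Proof. by apply/rcosetsP; exists w; rewrite ?inE. Qed.

Definition face (i : nat) (w : gT) : cface := exist _ (inord i, _) (face_subproof (inord i) w).

Lemma crk_face i w : i <= 5 -> crk (face i w) = i.
Proof. by move=> hi; rewrite /crk /= inordK. Qed.

Lemma ccos_face i w : i <= 5 -> ccos (face i w) = K i :* w.
Proof. by move=> hi; rewrite /ccos /= inordK. Qed.

Lemma crk_le5 x : crk x <= 5.
Proof. by rewrite -ltnS; apply: ltn_ord. Qed.

Lemma faceP x : exists w, x = face (crk x) w.
Proof.
case: x => -[i S] hS; have /rcosetsP[w _ /= eS] := hS; exists w.
apply: val_inj; rewrite /face /crk /= inord_val; congr (_, _); exact: eS.
Qed.

Lemma facePi x i : crk x = i -> exists w, x = face i w.
Proof. by move=> <-; apply: faceP. Qed.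

Lemma face_eq i x y : i <= 5 -> (face i x = face i y <-> x * y^-1 \in K i).
Proof.
move=> hi; rewrite -mem_rcoset; split.
  by move/(congr1 ccos); rewrite !ccos_face // => <-; apply: rcoset_refl.
move=> h; apply: val_inj; rewrite /=; congr (_, _); rewrite inordK //.
exact/rcoset_eqP.
Qed.

Lemma cincE i j x y : i <= 5 -> j <= 5 -> (cinc (face i x) (face j y) <-> x * y^-1 \in K i * K j).
Proof.
move=> hi hj; rewrite /cinc !ccos_face //; split.
  case/pred0Pn => z /= /andP[]; rewrite !mem_rcoset => h1 h2.
  apply/mulsgP; exists (x * z^-1) (z * y^-1) => //; last by rewrite mulgA mulgKV.
  by rewrite -groupV invMg invgK.
move=> /mulsgP[h k hh hk e]; apply/pred0Pn; exists (h^-1 * x) => /=.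
rewrite !mem_rcoset mulgK groupV hh /=.
by rewrite -mulgA e mulKg.
Qed.

Lemma cinc_same i j w : i <= 5 -> j <= 5 -> cinc (face i w) (face j w).
Proof. by move=> hi hj; apply/cincE => //; rewrite mulgV; apply/mulsgP; exists 1 1; rewrite ?mulg1. Qed.

Definition cbot := face 0 1.
Definition ctop := face 5 1.

Lemma crk_bot x : crk x = 0 <-> x = cbot.
Proof.
split=> [/facePi[w ->]|->]; last by rewrite crk_face.
by apply/face_eq => //; rewrite K0 inE.
Qed.

Lemma crk_top x : crk x = 5 <-> x = ctop.
Proof.
split=> [/facePi[w ->]|->]; last by rewrite crk_face.
by apply/face_eq => //; rewrite K5 inE.
Qed.

Lemma cinc_bot x : crk x = 1%N -> cinc cbot x.
Proof.
move/facePi => [w ->]; rewrite (_ : cbot = face 0 w) ?cinc_same //.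
by apply/face_eq => //; rewrite K0 inE.
Qed.

Lemma cinc_top x : crk x = 4 -> cinc x ctop.
Proof.
move/facePi => [w ->]; rewrite (_ : ctop = face 5 w) ?cinc_same //.
by apply/face_eq => //; rewrite K5 inE.
Qed.

Lemma crk_ex i : i <= 5 -> exists x, crk x = i.
Proof. by move=> hi; exists (face i 1); rewrite crk_face. Qed.

Lemma cinc_down y i : crk y = i.+1 -> exists2 x, crk x = i & cinc x y.
Proof.
move=> ry; have := crk_le5 y; rewrite ry => hi; have [w ->] := facePi ry.
by exists (face i w); rewrite ?crk_face ?cinc_same // ltnW.
Qed.

Lemma cinc_up x i : i < 5 -> crk x = i -> exists2 y, crk y = i.+1 & cinc x y.
Proof.
move=> hi /facePi[w ->]; exists (face i.+1 w); rewrite ?crk_face ?cinc_same //.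
exact: ltnW.
Qed.

Definition cdeg j := #[g j].

Lemma cpolygon j x y : 0 < j < 4 -> crk x = j.-1 -> crk y = j.+2 ->
  exists z z', polygon crk cinc cdeg j x y z z'.
Proof.
move=> hj rx ry; have [j0 j4] := andP hj.
have [h0 h1 h2 h3] : [/\ j.-1 <= 5, j <= 5, j.+1 <= 5 & j.+2 <= 5].
  by move: j4; clear; case: j => [|[|[|[|]]]].
have [u eu] := facePi rx; have [v ev] := facePi ry.
(* As the two stabilisers multiply to the whole group, the cosets of x and y share an element w, and
   the section between them is the translate by w of the base section. *)
have /mulsgP[h k hh hk e] := mul_full (u * v^-1) hj.
have [w wu wv] : exists2 w, face j.-1 w = face j.-1 u & face j.+2 w = face j.+2 v.
  exists (h^-1 * u); first by apply/face_eq; rewrite // mulgK groupV.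
  by apply/face_eq => //; rewrite -mulgA e mulKg.
have [gl gu] := gen_low hj.
have gX i : g j ^+ i \in <[g j]> by apply: mem_cycle.
have div i k' : g j ^+ i * w * (g j ^+ k' * w)^-1 = g j ^+ i * (g j ^+ k')^-1.
  by rewrite invMg !mulgA mulgK.
have gD i k' : g j ^+ i * (g j ^+ k')^-1 \in <[g j]> by rewrite groupM ?groupV.
have eqX i k' : g j ^+ i * (g j ^+ k')^-1 = 1 <-> i = k' %[mod cdeg j].
  split=> [/divg1_eq/eqP|/eqP]; rewrite ?eq_expg_mod_order; first by move/eqP.
  by rewrite -eq_expg_mod_order => /eqP ->; rewrite mulgV.
exists (fun i => face j (g j ^+ i * w)), (fun i => face j.+1 (g j ^+ i * w)).
rewrite eu ev -wu -wv; split.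
- move=> i; split; rewrite ?crk_face //.
    apply/cincE => //; rewrite invMg mulgA mulgV mul1g; apply/mulsgP.
    by exists (g j ^+ i)^-1 1; rewrite ?mulg1 // groupV groupX.
  apply/cincE => //; rewrite mulgK; apply/mulsgP.
  by exists 1 (g j ^+ i); rewrite ?mul1g // groupX.
- move=> _ /facePi[u' ->] /cincE => /(_ h0 h1)/mulsgP[h' k' hh' hk' e'].
  have [y' /cycleP[i ey] hy'] := lower hj (groupVr hh'); exists i; rewrite -ey.
  apply/face_eq => //.
  have ew : w = h' * k' * u' by rewrite -e' mulgKV.
  have -> : u' = k'^-1 * (h'^-1 * w) by rewrite ew -!mulgA !mulKg.
  by rewrite invMg !mulgA mulgK -mulgA groupM // groupV.
- move=> _ /facePi[u' ->] /cincE => /(_ h2 h3)/mulsgP[k' h' hk' hh' e'].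
  have [y' /cycleP[i ey] hy'] := upper hj hh'; exists i; rewrite -ey.
  apply/face_eq => //.
  have -> : u' = k' * h' * w by rewrite -e' mulgKV.
  by rewrite invMg !mulgA mulgK -mulgA groupM.
split.
- move=> i k'; split.
    move/cincE => /(_ h1 h2); rewrite div => /(adj hj (gD _ _))[/eqX ->|e2]; [by left | right].
    have e3 : g j ^+ i = (g j)^-1 * g j ^+ k' by rewrite -e2 mulgKV.
    by apply/eqX; rewrite expgS e3 mulVKg mulgV.
  move=> e2; apply/cincE => //; rewrite div; apply/adj => //.
  case: e2 => /eqX/divg1_eq ->; first by left; rewrite mulgV.
  by right; rewrite expgS invMg mulVKg.
- move=> i k'; split.
    by move/face_eq => /(_ h1); rewrite div => /(proj1 (triv hj (gD _ _)))/eqX.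
  by move=> e2; apply/face_eq => //; rewrite div (iffRL (eqX _ _) e2).
- move=> i k'; split.
    by move/face_eq => /(_ h2); rewrite div => /(proj2 (triv hj (gD _ _)))/eqX.
  by move=> e2; apply/face_eq => //; rewrite div (iffRL (eqX _ _) e2).
Qed.

Definition cpoly : pstruct cface := tight_pstruct crk cinc.

Theorem cpoly_polytope : is_polytope cpoly 4.
Proof.
apply: (tight_is_polytope crk_bot crk_top crk_le5 cinc_bot cinc_top crk_ex cinc_down cinc_up g_ne1).
exact: cpolygon.
Qed.

Theorem cpoly_type : has_type4 cpoly #[g 1] #[g 2] #[g 3].
Proof.
exact: (tight_has_type g_ne1 cpolygon).
Qed.

Definition cact_fun (h : gT) (x : cface) : cface := face (crk x) (repr (ccos x) * h).

Lemma cact_funE h i w : i <= 5 -> cact_fun h (face i w) = face i (w * h).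
Proof.
move=> hi; rewrite /cact_fun crk_face // ccos_face //; apply/face_eq => //.
rewrite invMg mulgA mulgK -mem_rcoset; exact: mem_repr_rcoset.
Qed.

Lemma cact_inj h : injective (cact_fun h).
Proof.
apply: (can_inj (g := cact_fun h^-1)) => x; have [w ->] := faceP x.
by rewrite !cact_funE ?crk_le5 // mulgK.
Qed.

Definition cact (h : gT) : {perm cface} := perm (@cact_inj h).

Lemma cactE h i w : i <= 5 -> cact h (face i w) = face i (w * h).
Proof. by rewrite permE; apply: cact_funE. Qed.

Lemma cactM h k : cact (h * k) = cact h * cact k.
Proof.
apply/permP => x; rewrite permM; have [w ->] := faceP x.
by rewrite !cactE ?crk_le5 // mulgA.
Qed.

Lemma cact_aut h : cact h \in PAut cpoly.
Proof.
apply/PAutP => x y; rewrite /= /tle (inj_eq perm_inj).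
have [v ev] := faceP x; have [w ew] := faceP y.
have rE z : crk (cact h z) = crk z.
  by have [u ez] := faceP z; rewrite {1}ez cactE ?crk_face ?crk_le5.
rewrite !rE; congr (_ || _ && (_ || _)).
rewrite ev ew !cactE ?crk_le5 //.
apply/idP/idP => /cincE => /(_ (crk_le5 _) (crk_le5 _)) H; apply/cincE; rewrite ?crk_le5 //.
  by move: H; rewrite invMg mulgA mulgK.
by rewrite invMg mulgA mulgK.
Qed.

Lemma cact_faithful h : cact h = 1 -> forall i, i <= 5 -> h \in K i.
Proof.
move=> e i hi; have : cact h (face i 1) = face i 1 by rewrite e perm1.
by rewrite cactE // mul1g => /face_eq => /(_ hi); rewrite invg1 mulg1.
Qed.

Definition cflag (w1 w2 w3 w4 : gT) : {set cface} :=
  tight_flag cbot ctop (face 1 w1) (face 2 w2) (face 3 w3) (face 4 w4).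

Definition cbase := cflag 1 1 1 1.

Lemma cflag_flag w1 w2 w3 w4 : cinc (face 1 w1) (face 2 w2) ->
  cinc (face 2 w2) (face 3 w3) -> cinc (face 3 w3) (face 4 w4) ->
  is_flag cpoly (cflag w1 w2 w3 w4).
Proof.
move=> h1 h2 h3.
apply: (tight_quad_flag crk_bot crk_top crk_le5 cinc_bot cinc_top).
by split; split; rewrite ?crk_face.
Qed.

Lemma cflag_act h w1 w2 w3 w4 :
  cact h @: cflag w1 w2 w3 w4 = cflag (w1 * h) (w2 * h) (w3 * h) (w4 * h).
Proof.
rewrite /cflag /tight_flag !imsetU !imset_set1 !cactE //.
have -> : face 0 (1 * h) = cbot by apply/face_eq => //; rewrite K0 inE.
by have -> : face 5 (1 * h) = ctop by apply/face_eq => //; rewrite K5 inE.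
Qed.

Lemma cinc_gen j : 0 < j < 4 -> cinc (face j 1) (face j.+1 (g j)).
Proof.
move=> hj; have [_ j4] := andP hj; apply/cincE; rewrite ?mul1g.
- by rewrite ltnW // ltnW.
- by rewrite ltnW.
- by apply/adj; rewrite ?groupV ?cycle_id //; right.
Qed.

Lemma face_gen j : 0 < j < 4 -> face j 1 != face j (g j) /\ face j.+1 1 != face j.+1 (g j).
Proof.
move=> hj; have [_ j4] := andP hj; have [h1 h2] : j <= 5 /\ j.+1 <= 5.
  by split; [rewrite ltnW // ltnW | rewrite ltnW].
have gV : (g j)^-1 \in <[g j]> by rewrite groupV cycle_id.
have g1 : (g j)^-1 <> 1 by move/eqP; rewrite invg_eq1 -order_eq1; have := g_ne1 hj; case: #[g j] => [|[]].
by split; apply/eqP => /face_eq; rewrite mul1g; [move/(_ h1) | move/(_ h2)] => h;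
  apply: g1; [apply: (proj1 (triv hj gV)) | apply: (proj2 (triv hj gV))].
Qed.

Hypotheses (g14 : g 1 \in K 4) (g31 : g 3 \in K 1).

Lemma cbase_flag : is_flag cpoly cbase.
Proof. by apply: cflag_flag; apply: cinc_same. Qed.

(** The j-th generator moves the base faces of ranks j and j + 1 only. Exchanging the upper one
    first and the lower one second gives the intermediate flag demanded of a standard generator. *)
Lemma cpoly_std : std_gens cpoly cbase (cact (g 1)) (cact (g 2)) (cact (g 3)).
Proof.
have fE i j : i <= 5 -> g j \in K i -> face i (g j) = face i 1.
  by move=> hi h; apply/face_eq => //; rewrite invg1 mulg1.
have [_ g13] := gen_low (isT : 0 < 1 < 4); have [g21 g24] := gen_low (isT : 0 < 2 < 4).
have [g32 _] := gen_low (isT : 0 < 3 < 4); rewrite /= in g13 g21 g24 g32.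
have [n11 n12] := face_gen (isT : 0 < 1 < 4); have [n22 n23] := face_gen (isT : 0 < 2 < 4).
have [n33 n34] := face_gen (isT : 0 < 3 < 4).
have i1 := cinc_gen (isT : 0 < 1 < 4); have i2 := cinc_gen (isT : 0 < 2 < 4).
have i3 := cinc_gen (isT : 0 < 3 < 4).
have sub (A B : {set cface}) x : (forall y, y \in A -> y \notin B -> y == x) -> A :\: B \subset [set x].
  by move=> h; apply/subsetP => y; rewrite !inE => /andP[h1 h2]; apply: h.
have m1 w1 w2 w3 w4 : face 1 w1 \in cflag w1 w2 w3 w4 by rewrite !inE eqxx ?orbT.
have m2 w1 w2 w3 w4 : face 2 w2 \in cflag w1 w2 w3 w4 by rewrite !inE eqxx ?orbT.
have m3 w1 w2 w3 w4 : face 3 w3 \in cflag w1 w2 w3 w4 by rewrite !inE eqxx ?orbT.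
have m4 w1 w2 w3 w4 : face 4 w4 \in cflag w1 w2 w3 w4 by rewrite !inE eqxx ?orbT.
split; first by split; apply: cact_aut.
have e1 : cflag (g 1) (g 1) (g 1) (g 1) = cflag (g 1) (g 1) 1 1 by rewrite /cflag (fE 3) ?(fE 4).
have e2 : cflag (g 2) (g 2) (g 2) (g 2) = cflag 1 (g 2) (g 2) 1 by rewrite /cflag (fE 1%N) ?(fE 4).
have e3 : cflag (g 3) (g 3) (g 3) (g 3) = cflag 1 1 (g 3) (g 3) by rewrite /cflag (fE 1%N) ?(fE 2).
rewrite !cflag_act !mul1g.
have f1 : is_flag cpoly (cflag 1 (g 1) 1 1).
  by apply: cflag_flag => //; rewrite ?cinc_same // -(fE 3 1%N) // cinc_same.
have f2 : is_flag cpoly (cflag 1 1 (g 2) 1).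
  by apply: cflag_flag => //; rewrite ?cinc_same // -(fE 4 2) // cinc_same.
have f3 : is_flag cpoly (cflag 1 1 1 (g 3)).
  by apply: cflag_flag => //; rewrite ?cinc_same.
have fg h : is_flag cpoly (cflag h h h h) by apply: cflag_flag; apply: cinc_same.
have f0 := cbase_flag; rewrite /cbase in f0 *.
split.
- exists (cflag 1 (g 1) 1 1); rewrite e1; apply/andP; split.
    apply: (@adjflag_swap _ _ _ _ _ (face 2 1) (face 2 (g 1))); rewrite ?crk_face //.
    by apply: sub => y; rewrite !inE; do ?[case: (y == _) => //=].
  apply: (@adjflag_swap _ _ _ _ _ (face 1 1) (face 1 (g 1))); rewrite ?crk_face // -?e1 //.
  by rewrite e1; apply: sub => y; rewrite !inE; do ?[case: (y == _) => //=].
- exists (cflag 1 1 (g 2) 1); rewrite e2; apply/andP; split.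
    apply: (@adjflag_swap _ _ _ _ _ (face 3 1) (face 3 (g 2))); rewrite ?crk_face //.
    by apply: sub => y; rewrite !inE; do ?[case: (y == _) => //=].
  apply: (@adjflag_swap _ _ _ _ _ (face 2 1) (face 2 (g 2))); rewrite ?crk_face // -?e2 //.
  by rewrite e2; apply: sub => y; rewrite !inE; do ?[case: (y == _) => //=].
- exists (cflag 1 1 1 (g 3)); rewrite e3; apply/andP; split.
    apply: (@adjflag_swap _ _ _ _ _ (face 4 1) (face 4 (g 3))); rewrite ?crk_face //.
    by apply: sub => y; rewrite !inE; do ?[case: (y == _) => //=].
  apply: (@adjflag_swap _ _ _ _ _ (face 3 1) (face 3 (g 3))); rewrite ?crk_face // -?e3 //.
  by rewrite e3; apply: sub => y; rewrite !inE; do ?[case: (y == _) => //=].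
Qed.

End CosetGeometry.

(** * Coverings and atomicity *)

Section NoFlip.
Variables (F : finType) (P : pstruct F).
Hypothesis HP : is_polytope P 4.
Local Notation nb := (nb P).
Variables (Phi : {set F}) (s1 s2 s3 : {perm F}).
Hypotheses (fPhi : is_flag P Phi) (std : std_gens P Phi s1 s2 s3).
Hypothesis nrefl : ~ reflexible P Phi.
Let K := <<[set s1; s2; s3]>>%g.
Local Notation sg := (std_g s1 s2 s3).

(* An endomorphism inverting the elements std_g j acts on flags compatibly with
   adjacency, hence comes from a reflection. *)
Lemma std_no_flip (f : {perm F} -> {perm F}) :
  {in K &, {morph f : x y / (x * y)%g}} -> (forall x, x \in K -> f x \in K) ->
  (forall j, j < 4 -> f (sg j) = (sg j)^-1%g) -> False.
Proof.
move=> fM fK fg.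
have KA x : x \in K -> x \in PAut P by rewrite (std_full HP fPhi std nrefl).
have gK j : sg j \in K by apply: std_gK.
have f1 : f 1%g = 1%g by apply: (mulgI (f 1%g)); rewrite -fM ?group1 // !mulg1.
have fV x : x \in K -> f (x^-1)%g = (f x)^-1%g.
  by move=> Kx; apply: (mulgI (f x)); rewrite -fM ?groupV // !mulgV f1.
(* The map exchanges the two flag orbits, which are disjoint because no reflection exists; the last
   default concerns sets that are not flags. *)
pose h (B : {set F}) : {set F} :=
  if [pick x in K | B == x @: Phi] is Some x then f x @: nb 1 Phi else
  if [pick x in K | B == x @: nb 1 Phi] is Some x then f x @: Phi else B.
have fN := nb_flag HP fPhi (isT : 1 < 4).
have hE1 x : x \in K -> h (x @: Phi) = f x @: nb 1 Phi.
  move=> Kx; rewrite /h; case: pickP => [y /andP[Ky /eqP e]|/(_ x)]; last by rewrite Kx eqxx.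
  by rewrite (aut_free2 HP (KA _ Kx) (KA _ Ky) fPhi e).
have hE2 x : x \in K -> h (x @: nb 1 Phi) = f x @: Phi.
  move=> Kx; rewrite /h; case: pickP => [y /andP[Ky /eqP e]|_].
    case: nrefl; exists (y * x^-1)%g; first by apply: KA; rewrite groupM ?groupV.
    by rewrite imset_permM -e imset_permK.
  case: pickP => [y /andP[Ky /eqP e]|/(_ x)]; last by rewrite Kx eqxx.
  by rewrite (aut_free2 HP (KA _ Kx) (KA _ Ky) fN e).
have [||r hr er] := @flag_map_aut _ _ HP h.
- move=> B /(std_orbits HP fPhi std)[x Kx [->|->]].
    by rewrite hE1 // aut_flag // KA // fK.
  by rewrite hE2 // aut_flag // KA // fK.
- move=> B j /(std_orbits HP fPhi std)[x Kx [->|->]] j4.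
    rewrite -aut_nb ?KA // (std_nb HP fPhi std j4) -imset_permM hE2 ?groupM // hE1 // fM // fg //.
    by rewrite imset_permM -(std_nb1 HP fPhi std j4) aut_nb // KA // fK.
  rewrite -aut_nb ?KA // (std_nb1 HP fPhi std j4) -imset_permM hE1 ?groupM ?groupV // hE2 //.
  rewrite fM ?groupV // fV // fg // invgK.
  by rewrite imset_permM -(std_nb HP fPhi std j4) aut_nb // KA // fK.
apply: nrefl; exists r => //; rewrite er // -{1}(imset_perm1 Phi) hE1 ?group1 // f1.
by rewrite imset_perm1.
Qed.

End NoFlip.

Section Covering.
Variables (F1 F2 : finType) (P : pstruct F1) (Q : pstruct F2) (g : F1 -> F2).
Hypotheses (HP : is_polytope P 4) (HQ : is_polytope Q 4) (cov : covering P Q g).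

Lemma cov_nb j A : is_flag P A -> j < 4 -> g @: nb P j A = nb Q j (g @: A).
Proof. by move=> fA j4; apply: (nb_eq HQ); case: cov => _ _; apply; apply: nbP. Qed.

Lemma cov_flag A : is_flag P A -> is_flag Q (g @: A).
Proof.
move=> fA; case: cov => _ _ /(_ 0 A (nb P 0 A) (nbP HP fA (isT : 0 < 4))).
exact: adjflag_flagl.
Qed.

Lemma cov_surj B : is_flag Q B -> exists2 A, is_flag P A & g @: A = B.
Proof.
have [A0 fA0] := flag_exists HP.
apply: (@flag_ind0 _ _ HQ (fun B => exists2 A, is_flag P A & g @: A = B) _ (cov_flag fA0)).
  by move=> {}B j fB j4 [A fA <-]; exists (nb P j A); rewrite ?nb_flag // cov_nb.
by exists A0.
Qed.

(** With equal flag counts the surjection on flags is a bijection. If y1 and y2 have the same image,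
    a walk through that image lifts to flags that all contain y1 and ends over a flag through y2;
    the two flags there coincide, and equal ranks give y1 = y2. *)
Lemma cov_inj : #|flags Q| = #|flags P| -> injective g.
Proof.
move=> card.
have eim : (fun A : {set F1} => g @: A) @: flags P = flags Q.
  apply/setP => B; rewrite [RHS]inE; apply/imsetP/idP.
    by move=> [A]; rewrite inE => fA ->; apply: cov_flag.
  by move=> /cov_surj[A fA <-]; exists A; rewrite ?inE.
have /imset_injP inj : #|(fun A : {set F1} => g @: A) @: flags P| == #|flags P|.
  by rewrite eim card.
have grk x : rk Q (g x) = rk P x by case: cov.
move=> y1 y2 e; have [A fA h1] := flag_of HP y1; have [B fB h2] := flag_of HP y2.
have sub (D : {set F2}) : g y1 \in D -> [set g y1] \subset D by rewrite sub1set.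
have [A' [fA' h1' eA']] : exists A', [/\ is_flag P A', y1 \in A' & g @: A' = g @: B].
  apply: (@flag_ind _ _ HQ [set g y1]
    (fun D => exists A', [/\ is_flag P A', y1 \in A' & g @: A' = D]) (g @: A) (cov_flag fA)).
  - by apply/sub/imset_f.
  - move=> D j fD j4 sD sD' [A' [fA' h1' eD]]; exists (nb P j A'); split; rewrite ?nb_flag ?cov_nb ?eD //.
    by rewrite nb_mem // -grk -(nb_mem HQ fD j4) -?sub1set.
  - by exists A.
  - exact: cov_flag.
  - by apply: sub; rewrite e imset_f.
have eAB : A' = B by apply: inj; rewrite ?inE.
apply: (flag_rk_inj HP fB) => //; first by rewrite -eAB.
by rewrite -!grk e.
Qed.

Variables (Phi : {set F1}).
Hypothesis fPhi : is_flag P Phi.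

(** Intertwining on flags replaces an induced homomorphism; freeness of the automorphisms on flags
    makes the relation single-valued. *)
Definition cov_rel (x : {perm F1}) (y : {perm F2}) : Prop :=
  [/\ x \in PAut P, y \in PAut Q & forall A, is_flag P A -> g @: (x @: A) = y @: (g @: A)].

Lemma cov_relP x y : x \in PAut P -> y \in PAut Q -> g @: (x @: Phi) = y @: (g @: Phi) -> cov_rel x y.
Proof.
move=> hx hy e; split=> //.
apply: (@flag_ind0 _ _ HP (fun A => g @: (x @: A) = y @: (g @: A)) _ fPhi) => // A j fA j4 eA.
by rewrite aut_nb // !cov_nb ?aut_flag // aut_nb ?cov_flag // eA.
Qed.

Lemma cov_rels4 beta e1 e2 s1 s2 s3 t1 t2 t3 :
  std_gens P Phi s1 s2 s3 -> std_gens Q (g @: Phi) t1 t2 t3 ->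
  @rels4 (permGrp F1) beta e1 e2 s1 s2 s3 -> @rels4 (permGrp F2) beta e1 e2 t1 t2 t3.
Proof.
move=> hs ht; have [a1 a2 a3] := std_aut hs; have [b1 b2 b3] := std_aut ht.
apply: (@rels4_transfer (permGrp F1) (permGrp F2) cov_rel).
- by split; rewrite ?group1 // => A fA; rewrite !imset_perm1.
- move=> x y x' y' [hx hx' ex] [hy hy' ey]; split; rewrite /= ?groupM // => A fA.
  by rewrite !imset_permM ey ?aut_flag // ex.
- move=> x x' [hx hx' ex]; split; rewrite /= ?groupV // => A fA.
  rewrite -{2}(imset_permKV x A) ex ?imset_permK //.
  by rewrite aut_flag // groupV.
- move=> x y y' [_ hy ey] [_ hy' ey'].
  by apply: (aut_free2 HQ hy hy' (cov_flag fPhi)); rewrite -ey // -ey'.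
- by apply: cov_relP => //; rewrite (std_s1 HP hs) (std_s1 HQ ht) !cov_nb ?nb_flag.
- by apply: cov_relP => //; rewrite (std_s2 HP hs) (std_s2 HQ ht) !cov_nb ?nb_flag.
- by apply: cov_relP => //; rewrite (std_s3 HP hs) (std_s3 HQ ht) !cov_nb ?nb_flag.
Qed.

End Covering.

(** * Chirality and the tight chiral quotients *)

Section GammaFour.
Variables (beta : nat) (e1 e2 : int).
Hypotheses (b5 : 5 <= beta) (se1 : is_sign e1) (se2 : is_sign e2).
Let t := 2 ^ (beta - 2).

Lemma rels4_not_reflexible (F : finType) (P : pstruct F) Phi s1 s2 s3 :
  is_polytope P 4 -> is_flag P Phi -> std_gens P Phi s1 s2 s3 ->
  @rels4 (permGrp F) beta e1 e2 s1 s2 s3 -> #[s2]%g = 2 ^ beta -> ~ reflexible P Phi.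
Proof.
move=> HP fPhi std R4 o2 [r hr er].
have J0 := std_reflect HP fPhi std hr er (isT : 0 < 4).
have J2 := std_reflect HP fPhi std hr er (isT : 2 < 4).
rewrite /std_g /= in J0 J2.
have {J0}J1 : (s1 ^ r = s1^-1)%g by rewrite -[s1]invgK conjVg J0 !invgK.
(* In terms of reflections [r] is r1, which inverts s1 and s2, and [r s2] is r2, whose conjugation
   produces the reflected triple. *)
pose r2 := (r * s2)%g.
have [x1 x2] : (s1 ^ r2 = s2^-1 * s1^-1 * s2 /\ s2 ^ r2 = s2^-1)%g.
  by rewrite /r2 !conjgM J1 J2; split; rewrite conjgE ?mulgA // mulgKV.
have R4r : @rels4 (permGrp F) beta e1 e2 (s1 ^ r2)%g (s2 ^ r2)%g (s3 ^ r2)%g.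
  apply: (@rels4_transfer (permGrp F) (permGrp F) (fun x y => y = x ^ r2)%g) R4 => //=.
  - by rewrite conj1g.
  - by move=> x y _ _ -> ->; rewrite conjMg.
  - by move=> x _ ->; rewrite conjVg.
  - by move=> x y y' -> ->.
have := @rels4_r1 (permGrp F) _ _ _ _ _ _ R4r.
rewrite x1 x2 (_ : (s2^-1 * s1^-1 * s2)%g = @gmul (permGrp F) s1 (@zpow (permGrp F) s2 2)); last first.
  by rewrite (rels4_reflect_a R4).
move/(rels4_chiral b5 se1 R4); rewrite gpow_permE => /eqP.
rewrite -order_dvdn o2 pow2_4t // => /dvdn_leq.
by rewrite leq_pmul2r ?expn_gt0 // muln_gt0 expn_gt0 => /(_ isT).
Qed.

Lemma order_pow2_or (gT : finGroupType) (x : gT) n :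
  (x ^+ (2 ^ n.+1) = 1)%g -> #[x]%g = 2 ^ n.+1 \/ (x ^+ (2 ^ n) = 1)%g.
Proof.
move=> /eqP; rewrite -order_dvdn => /(dvdn_pfactor _ _ (isT : prime 2))[m le e].
move: le; rewrite leq_eqVlt => /predU1P[<-|le]; first by left.
by right; apply/eqP; rewrite -order_dvdn e dvdn_exp2l.
Qed.

(* Tightness pins down the presentation: a proper tight quotient kills b^(2t),
   which makes it invariant under the reflection. *)
Lemma tight_chiral_quotient (F : finType) (Q : pstruct F) Phi t1 t2 t3 :
  tight_chiral4 Q -> is_flag Q Phi -> std_gens Q Phi t1 t2 t3 ->
  @rels4 (permGrp F) beta e1 e2 t1 t2 t3 ->
  #|flags Q| = 2 * (8 * 2 ^ beta * 2 ^ beta.-1).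
Proof.
move=> [HQ ch [p1 [p2 [p3 [type card]]]]] fPhi std R4.
have nrefl := chiral_not_reflexible HQ ch fPhi.
have full : PAut Q = <<[set t1; t2; t3]>>%g := std_full HQ fPhi std nrefl.
have cf := std_card_flags HQ fPhi std nrefl.
have [a1 a2 a3] := std_aut std.
have KE := rels4_nform b5 se1 se2 R4.
set L := <<[set t1; t2; t3]>>%g in full KE *.
have cL : #|L| = p1 * p2 * p3.
  by apply/eqP; rewrite -(eqn_pmul2l (isT : 0 < 2)) -full -cf card -!mulnA.
have o1 : #[t1]%g <= p1.
  apply: (std_order HQ fPhi std nrefl (j := 1)) => //; first exact: (std_s1 HQ std).
  by move=> x y h1 h2 h3; apply: (type 1 x y).
have o2 : #[t2]%g <= p2.
  apply: (std_order HQ fPhi std nrefl (j := 2)) => //; first exact: (std_s2 HQ std).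
  by move=> x y h1 h2 h3; apply: (type 2 x y).
have o3 : #[t3]%g <= p3.
  apply: (std_order HQ fPhi std nrefl (j := 3)) => //; first exact: (std_s3 HQ std).
  by move=> x y h1 h2 h3; apply: (type 3 x y).
(* The order p1 p2 p3 of the group is at most the product of the orders of the generators, and these
   are at most p1, p2, p3; so the quotient is tight as a group. *)
have le := card_nform_le t1 t2 t3; rewrite -KE cL in le.
have [q1 q2 q3] := leq_mul3_eq (order_gt0 t1) (order_gt0 t2) (order_gt0 t3) o1 o2 o3 le.
have tightL : #|L| = #[t1]%g * #[t2]%g * #[t3]%g by rewrite cL q1 q2 q3.
rewrite cf full tightL; congr (2 * _).
have key : (t2 ^+ (2 * t) <> 1)%g.
  move=> b2t.
  have R4' := rels4_reflect b5 R4 (etrans (gpow_permE _ _) b2t).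
  have e1' : @gmul (permGrp F) t1 (@zpow (permGrp F) t2 2) = (t1^-1 ^ t2)%g.
    by rewrite (rels4_reflect_a R4) conjgE mulgA.
  rewrite e1' in R4'.
  have [|||f [fM f1 f2 f3]] := rels4_hom b5 se1 se2 R4 tightL R4'.
  - by rewrite gpow_permE -conjXg expVgn expg_order invg1 conj1g.
  - by rewrite gpow_permE expVgn expg_order invg1.
  - by rewrite gpow_permE expVgn expg_order invg1.
  have L1 : t1 \in L by rewrite mem_gen // !inE eqxx.
  have L2 : t2 \in L by rewrite mem_gen // !inE eqxx orbT.
  have L3 : t3 \in L by rewrite mem_gen // !inE eqxx orbT.
  pose fm := Morphism (fM : {in L &, {morph f : x y / (x * y)%g}}).
  have fL x : x \in L -> f x \in L.
    have sub : L \subset (fm @*^-1 <<[set t1; t2; t3]>>%G)%g.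
      rewrite gen_subG; apply/subsetP => y hy.
      have Ly : y \in L by apply: mem_gen.
      rewrite mem_morphpre //=; move: hy; rewrite !inE -orbA => /or3P[]/eqP->.
      + by rewrite f1 groupJ ?groupV.
      + by rewrite f2 groupV.
      + by rewrite f3 groupV.
    by move=> Lx; have /morphpreP[] := subsetP sub x Lx.
  (* The endomorphism f imitates conjugation by the reflection r2; conjugating further by t2^-1
     imitates r1, which inverts every [std_g j]. *)
  apply: (@std_no_flip _ _ HQ _ _ _ _ fPhi std nrefl (fun x => (f x ^ (t2^-1))%g)).
  - by move=> x y Lx Ly; rewrite fM // conjMg.
  - by move=> x Lx; rewrite groupJ ?groupV // fL.
  have f_1 : f 1%g = 1%g by apply: (morph1 fm).
  have f_V : f (t1^-1)%g = ((f t1 : {perm F})^-1)%g by apply: (morphV fm L1).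
  have f_2 : f t2 = (t2^-1)%g := f2; have f_3 : f t3 = (t3^-1)%g := f3.
  have f_23 : f (t2 * t3)%g = ((f t2 : {perm F}) * f t3)%g by exact: (fM _ _ L2 L3).
  case=> [|[|[|[|//]]]] _; rewrite /std_g /=.
  - by rewrite f_V f1 -conjVg !invgK conjgK.
  - by rewrite f_1 conj1g invg1.
  - by rewrite f_2 conjgE invgK mulVKg.
  - by rewrite f_23 f_2 f_3 conjgE invgK !mulgA mulgV mul1g invMg.
have ob : (t2 ^+ (2 ^ beta) = 1)%g by have := rels4_b4t b5 R4; rewrite -pow2_4t // gpow_permE.
have oc : (t3 ^+ (2 ^ beta.-1) = 1)%g by have := rels4_c2t b5 R4; rewrite -pow2_2t // gpow_permE.
have oa : (t1 ^+ (2 ^ 3) = 1)%g by have := rels4_a8 R4; rewrite gpow_permE.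
have drop : gpow (t1 : permGrp F) 4 = gone _ \/ gpow (t2 : permGrp F) (2 * t) = gone _ \/
    gpow (t3 : permGrp F) t = gone _ -> False.
  by move/(rels4_drop b5 se1 se2 R4); rewrite gpow_permE.
have eb : beta = (beta.-1).+1 by rewrite prednK // (ltn_trans _ b5).
have ec : beta.-1 = (beta - 2).+1 by move: b5; clear; lia.
have -> : #[t1]%g = 8.
  by case: (order_pow2_or oa) => // h; case: drop; left; rewrite gpow_permE.
have -> : #[t2]%g = 2 ^ beta.
  rewrite eb in ob *; case: (order_pow2_or ob) => // h; case: drop; right; left.
  by rewrite gpow_permE /t -pow2_2t.
have -> // : #[t3]%g = 2 ^ beta.-1.
rewrite ec in oc *; case: (order_pow2_or oc) => // h; case: drop; right; right.
by rewrite gpow_permE.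
Qed.

End GammaFour.

(** * The polytope *)

Lemma zpow_cycle (gT : finGroupType) (x : gT) (m : int) : @zpow (grpOf gT) x m \in <[x]>%g.
Proof.
by rewrite -zpowE; case: m => n; rewrite /gzpow gpowE ?groupV mem_cycle.
Qed.

Lemma rels4_permutable (gT : finGroupType) (a b c : gT) beta e1 e2 :
  5 <= beta -> is_sign e1 -> is_sign e2 -> @rels4 (grpOf gT) beta e1 e2 a b c ->
  (<[c]> * <[b]> \subset <[b]> * <[c]>)%g /\ (<[b]> * <[a]> \subset <[a]> * <[b]>)%g.
Proof.
move=> b5 s1 s2 R4; split; apply/subsetP => x /mulsgP[_ _ /cycleP[i ->] /cycleP[j ->] ->].
  have : @nf2 (grpOf gT) b c (c ^+ i * b ^+ j)%g.
    elim: j => [|j IH].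
      by exists 0%R, (Posz i); rewrite gzpow0 gmul1 gzpow_gpow gpowE mulg1.
    by rewrite expgSr mulgA; apply: (nf2_mulb b5 s1 s2 R4 IH).
  by move=> [m [n ->]]; apply: mem_mulg; apply: zpow_cycle.
elim: j => [|j IH].
  by rewrite mulg1 -(mul1g (b ^+ i)%g) mem_mulg ?group1 ?mem_cycle.
rewrite expgSr mulgA; case/mulsgP: IH => u _ hu /cycleP[k ->] ->.
have [m [n e]] := nf_ba b5 s1 s2 R4 k; rewrite gpowE in e.
rewrite -mulgA [(b ^+ k * a)%g]e mulgA mem_mulg ?zpow_cycle // groupM //.
exact: zpow_cycle.
Qed.

Section FaithfulAction.
Variables (gT rT : finGroupType) (f : gT -> rT).
Hypotheses (fM : {morph f : x y / (x * y)%g}) (f_inj : forall x, f x = 1%g -> x = 1%g).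

Lemma faithful_inj : injective f.
Proof.
have f1 : f 1%g = 1%g by apply: (mulgI (f 1%g)); rewrite -fM !mulg1.
move=> x y e; apply/eqP; rewrite eq_mulgV1; apply/eqP/f_inj.
by rewrite fM e -fM mulgV.
Qed.

Lemma faithful_expg n x : f (x ^+ n)%g = (f x ^+ n)%g.
Proof.
elim: n => [|n IH]; last by rewrite !expgS fM IH.
by apply: (mulgI (f 1%g)); rewrite -fM !mulg1.
Qed.

Lemma faithful_order x : #[f x]%g = #[x]%g.
Proof.
have f1 := faithful_expg 0 x; rewrite !expg0 in f1.
apply/eqP; rewrite eqn_dvd !order_dvdn -faithful_expg expg_order f1 eqxx /=.
by apply/eqP/f_inj; rewrite faithful_expg expg_order.
Qed.

Lemma faithful_rels4 beta e1 e2 a b c : @rels4 (grpOf gT) beta e1 e2 a b c ->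
  @rels4 (grpOf rT) beta e1 e2 (f a) (f b) (f c).
Proof.
have f1 : f 1%g = 1%g by apply: (mulgI (f 1%g)); rewrite -fM !mulg1.
have fV x : f (x^-1)%g = (f x)^-1%g by apply: (mulgI (f x)); rewrite -fM !mulgV.
apply: (@rels4_transfer (grpOf gT) (grpOf rT) (fun x y => f x = y)) => //=.
- by move=> x y _ _ <- <-.
- by move=> x _ <-.
- by move=> x y y' <- <-.
Qed.

End FaithfulAction.

Lemma realisation beta e1 e2 : 5 <= beta -> is_sign e1 -> is_sign e2 ->
  exists (F : finType) (P : pstruct F) (Phi : {set F}) (s1 s2 s3 : {perm F}),
    [/\ is_polytope P 4, has_type4 P 8 (2 ^ beta) (2 ^ beta.-1), is_flag P Phi,
        std_gens P Phi s1 s2 s3 & @rels4 (permGrp F) beta e1 e2 s1 s2 s3] /\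
    [/\ #[s1]%g = 8, #[s2]%g = 2 ^ beta, #[s3]%g = 2 ^ beta.-1
      & #|<<[set s1; s2; s3]>>%g| = 8 * 2 ^ beta * 2 ^ beta.-1].
Proof.
move=> b5 h1 h2; have [gT [a [b [c [R4 gen [oa ob oc cG]]]]]] := model_exists b5 h1 h2.
have KE := rels4_nform b5 h1 h2 R4.
have fullG : [set: gT] = (<[a]> * (<[b]> * <[c]>))%g by rewrite gen KE.
have tight : #|(<[a]> * (<[b]> * <[c]>))%g| = #[a]%g * #[b]%g * #[c]%g.
  by rewrite -fullG cardsT cG oa ob oc.
have [ab2 bc2 abc2] : [/\ (a * b * (a * b) = 1)%g, (b * c * (b * c) = 1)%g & (a * b * c * (a * b * c) = 1)%g].
  by case: R4 => _ [[q1 q2 q3] _]; rewrite !gpow2 in q1 q2 q3.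
have [cb_bc ba_ab] := rels4_permutable b5 h1 h2 R4.
have pow_gt1 n : 0 < n -> 1 < 2 ^ n by case: n => // n _; rewrite expnS leq_pmulr ?expn_gt0.
have [a1 b1 c1] : [/\ a != 1%g, b != 1%g & c != 1%g].
  rewrite -!order_eq1 oa ob oc; split=> //; rewrite neq_ltn pow_gt1 ?orbT //; move: b5; clear; lia.
pose K := tgt_sub a b c; pose g := tgt_gen a b c.
have low := tgt_gen_low a b c; have full := tgt_mul_full fullG.
have lower := tgt_lower ab2 abc2 fullG cb_bc; have upper := tgt_upper ab2 bc2 abc2 fullG ba_ab.
have triv := tgt_triv ab2 bc2 abc2 tight b1 a1 c1 cb_bc ba_ab.
have adj := tgt_adj ab2 bc2 abc2 tight cb_bc ba_ab.
have g_gt1 j : 0 < j < 4 -> 1 < #[g j]%g.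
  by case: j => [|[|[|[|//]]]] // _; rewrite /g /= ltn_neqAle order_gt0 andbT eq_sym order_eq1.
have g14 : g 1 \in K 4 by apply: (subsetP (joing_subl _ _)); apply: cycle_id.
have g31 : g 3 \in K 1 by apply: (subsetP (joing_subr _ _)); apply: cycle_id.
have inj h : cact K h = 1%g -> h = 1%g.
  move=> /cact_faithful hK; have k1 := hK 1 isT; have k2 := hK 2 isT; have k4 := hK 4 isT.
  (* The kernel lies in K 1, K 2 and K 4. An element of K 2 is z or a b z with z in <c>; membership
     in K 4 forces z = 1, and then a b in K 1 would put a there. *)
  have [z hz [e|e]] := K2P' ab2 abc2 k2; first by apply: (proj2 (triv 3 h isT _) k4); rewrite e.
  have ab4 : (a * b)%g \in K 4.
    by apply: (groupM g14); apply: (subsetP (joing_subr _ _)); apply: cycle_id.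
  have z1 : z = 1%g by apply: (proj2 (triv 3 z isT hz)); rewrite -(mulKg (a * b) z)%g -e groupM ?groupV.
  have aK1 : a \in K 1.
    rewrite (_ : a = h * b^-1)%g; last by rewrite e z1 mulg1 mulgK.
    by rewrite groupM // groupV; apply: (subsetP (joing_subl _ _)); apply: cycle_id.
  by have /eqP := proj1 (triv 1 a isT (cycle_id a)) aK1; rewrite (negPf a1).
have cM := cactM K.
exists (cface K), (cpoly K), (cbase K), (cact K a), (cact K b), (cact K c); split; split.
- exact: (@cpoly_polytope _ K g).
- by have := @cpoly_type _ K g low full lower upper triv adj g_gt1; rewrite /g /= oa ob oc.
- exact: cbase_flag.
- exact: (@cpoly_std _ K g).
- exact: (faithful_rels4 cM R4).
- by rewrite (faithful_order cM inj).
- by rewrite (faithful_order cM inj).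
- by rewrite (faithful_order cM inj).
have R4s := faithful_rels4 cM R4; have KEs := rels4_nform b5 h1 h2 R4s.
apply/eqP; rewrite eqn_leq; apply/andP; split.
  by rewrite KEs; apply: leq_trans (card_nform_le _ _ _) _; rewrite !(faithful_order cM inj) oa ob oc.
rewrite -cG -cardsT -(card_imset _ (faithful_inj cM inj)); apply: subset_leq_card.
apply/subsetP => _ /imsetP[x _ ->]; have : x \in [set: gT] by rewrite inE.
rewrite fullG => /nform_setP[i [j [k ->]]]; rewrite KEs; apply/nform_setP; exists i, j, k.
by rewrite /nform !cM !(faithful_expg cM).
Qed.

Theorem theorem4p10 (beta : nat) (e1 e2 : int) :
  5 <= beta -> is_sign e1 -> is_sign e2 ->
  exists (F : finType) (P : pstruct F) (Phi : {set F}) (s1 s2 s3 : {perm F}),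
    [/\ atomic4 P, has_type4 P 8 (2 ^ beta) (2 ^ beta.-1), is_flag P Phi,
        std_gens P Phi s1 s2 s3 & presents4 (PAut P) beta e1 e2 s1 s2 s3].
Proof.
move=> b5 h1 h2.
have [F [P [Phi [s1 [s2 [s3 [[HP type fPhi std R4] [o1 o2 o3 card]]]]]]]] := realisation b5 h1 h2.
exists F, P, Phi, s1, s2, s3.
have nrefl := rels4_not_reflexible b5 h1 HP fPhi std R4 o2.
have full : PAut P = <<[set s1; s2; s3]>>%g := std_full HP fPhi std nrefl.
have cf : #|flags P| = 2 * (8 * 2 ^ beta * 2 ^ beta.-1).
  by rewrite (std_card_flags HP fPhi std nrefl) full card.
split=> //; last first.
  split=> // H k1 k2 k3 Rk.
  have tightG : #|<<[set s1; s2; s3]>>%g| = #[s1]%g * #[s2]%g * #[s3]%g by rewrite card o1 o2 o3.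
  have [[q1 q2 q3] _] := Rk.
  (* The orders attained by s1, s2, s3 are the exponents in the relations, so the power conditions
     hold in any group satisfying these. *)
  have [|||f [fM f1 f2 f3]] := rels4_hom b5 h1 h2 R4 tightG Rk; rewrite ?o1 ?o2 ?o3 //.
  by exists f; split=> // x y; rewrite full; apply: fM.
split.
  split=> //; first exact: (std_chiral HP fPhi std nrefl).
  by exists 8, (2 ^ beta), (2 ^ beta.-1); split=> //; rewrite cf !mulnA.
move=> F2 Q tQ [g [cov ninj]]; have [HQ ch _] := tQ.
have fPhi' := cov_flag HP cov fPhi.
have [t1 [t2 [t3 stdQ]]] := chiral_std_gens HQ ch fPhi'.
have R4Q := cov_rels4 HP HQ cov fPhi std stdQ R4.
(* A tight chiral polytope covered by P has as many flags as P, so the covering is injective and not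
   proper. *)
apply: ninj; apply: (cov_inj HP HQ cov).
by rewrite cf (tight_chiral_quotient b5 h1 h2 tQ fPhi' stdQ R4Q).
Qed.
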